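(* Let $n\ge1$, let $\mathcal{E}$ and $\mathcal{E}_*$ be Hilbert spaces, $\beta$ a weight sequence, and let $\Theta:\mathbb{B}^n\to\mathcal{B}(\mathcal{E},\mathcal{E}_* )$ be an analytic function. Then $\Theta$ is a contractive multiplier from $H^2_n(\mathcal{E})$ to $\mathbb{H}^2_n(\beta,\mathcal{E}_* )$ if and only if there exists a contractive multiplier $\tilde\Theta$ from $H^2_n(\mathcal{E})$ to $H^2_n(l^2(\mathbb{Z}_+^n,\mathcal{E}_* ))$ such that $$\Theta(\mathbf{z})=\Psi_{\beta,\mathcal{E}_*}(\mathbf{z})\tilde\Theta(\mathbf{z})\qquad(\mathbf{z}\in\mathbb{B}^n).$$
   Context: All Hilbert spaces are complex and separable; $\mathbb{B}^n$ is the open unit ball of $\mathbb{C}^n$, $\langle\mathbf{z},\mathbf{w}\rangle=\sum_iz_i\bar w_i$, $\mathbb{Z}_+$ is the set of non-negative integers, $z^{\mathbf{k}}=z_1^{k_1}\cdots z_n^{k_n}$, and $\rho_1(\mathbf{k})=|\mathbf{k}|!/\mathbf{k}!$ for $\mathbf{k}\in\mathbb{Z}_+^n$. A weight sequence is a strictly decreasing sequence $\beta=\{\beta_j\}_{j=0}^\infty$ of positive numbers with $\beta_0=1$ and $\liminf\beta_j^{1/j}\ge1$. $\mathbb{H}^2_n(\beta,\mathcal{E})$ is the Hilbert space of analytic $f=\sum_{\mathbf{k}}a_{\mathbf{k}}z^{\mathbf{k}}:\mathbb{B}^n\to\mathcal{E}$ with $\|f\|^2=\sum_{\mathbf{k}}\frac{\beta_{|\mathbf{k}|}}{\rho_1(\mathbf{k})}\|a_{\mathbf{k}}\|^2<\infty$;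 it has reproducing kernel $\sum_{j\ge0}\frac1{\beta_j}\langle\mathbf{z},\mathbf{w}\rangle^jI_{\mathcal{E}}$. The Drury–Arveson space $H^2_n(\mathcal{F})$ is the space of $\mathcal{F}$-valued analytic functions on $\mathbb{B}^n$ with $\|\sum a_{\mathbf{k}}z^{\mathbf{k}}\|^2=\sum\|a_{\mathbf{k}}\|^2/\rho_1(\mathbf{k})<\infty$ (kernel $(1-\langle\mathbf{z},\mathbf{w}\rangle)^{-1}I_{\mathcal{F}}$). Set $\gamma_0=1$ and $\gamma_j=\big(\frac1{\beta_j}-\frac1{\beta_{j-1}}\big)^{-1}$ for $j\ge1$. The universal multiplier $\Psi_{\beta,\mathcal{E}}:\mathbb{B}^n\to\mathcal{B}(l^2(\mathbb{Z}_+^n,\mathcal{E}),\mathcal{E})$ is $\Psi_{\beta,\mathcal{E}}(\mathbf{z})(\{a_{\mathbf{k}}\})=\sum_{\mathbf{k}}\sqrt{\rho_1(\mathbf{k})/\gamma_{|\mathbf{k}|}}\,a_{\mathbf{k}}z^{\mathbf{k}}$. A multiplier from $H^2_n(\mathcal{E}_1)$ to a space $K$ of $\mathcal{E}_2$-valued analytic functions on $\mathbb{B}^n$ is an analytic $\Phi:\mathbb{B}^n\to\mathcal{B}(\mathcal{E}_1,\mathcal{E}_2)$ with $\Phi f\in K$ for all $f\in H^2_n(\mathcal{E}_1)$; $M_\Phi f=\Phi f$. It is contractive if $\|M_\Phi\|\le1$. *)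

(* Defs.v *)
From HB Require Import structures.
From mathcomp Require Import all_boot all_order all_algebra.
From mathcomp Require Import finmap complex.
From mathcomp Require Import all_classical all_reals all_analysis.
From mathcomp Require Import ring.
From mathcomp Require summability.

Set Implicit Arguments.
Unset Strict Implicit.
Unset Printing Implicit Defensive.
Import Order.TTheory GRing.Theory Num.Theory.
Import numFieldNormedType.Exports.
Local Open Scope classical_set_scope.
Local Open Scope complex_scope.
Local Open Scope ring_scope.

(* The norm of a normed module over R[i] takes its values in R[i], where it is
   a nonnegative real; nrm is that norm as an element of R. *)
Definition nrm (R : realType) (E : normedModType R[i]) (x : E) : R :=
  complex.Re `|x|.

Section nrm_theory.
Context {R : realType} {E : normedModType R[i]}.
Implicit Types (x y : E) (a : R[i]).

Lemma nrmE x : (nrm x)%:C = `|x|.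
Proof.
have : 0 <= `|x| by [].
by rewrite /nrm; case: `|x| => u v; rewrite lecE /= => /andP[/eqP -> _].
Qed.

Lemma nrm_ge0 x : 0 <= nrm x.
Proof. by have := normr_ge0 x; rewrite lecE => /andP[]. Qed.

Lemma Re_norm_ge0 a : 0 <= complex.Re `|a|.
Proof. by have := normr_ge0 a; rewrite lecE => /andP[]. Qed.

Lemma nrmD x y : nrm (x + y) <= nrm x + nrm y.
Proof. by rewrite -lecR rmorphD /= !nrmE ler_normD. Qed.

Lemma nrmZ a x : nrm (a *: x) = complex.Re `|a| * nrm x.
Proof.
apply: (fmorph_inj (real_complex R)); rewrite rmorphM /= !nrmE normrZ.
by congr (_ * _); rewrite normc_def.
Qed.

Lemma nrm0_eq0 x : nrm x = 0 -> x = 0.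
Proof. by move=> x0; apply/normr0_eq0; rewrite -nrmE x0. Qed.

Lemma nrm0 : nrm (0 : E) = 0.
Proof. by rewrite /nrm normr0. Qed.

Lemma nrmN x : nrm (- x) = nrm x.
Proof. by rewrite /nrm normrN. Qed.

Lemma nrm_dist x y :
  `|nrm x - nrm y| <= nrm (x - y).
Proof.
have H (u v : E) : nrm u - nrm v <= nrm (u - v).
  by rewrite lerBlDr (le_trans _ (nrmD _ _))// subrK.
by rewrite ler_norml H lerNl opprB andbT (le_trans (H _ _))// -nrmN opprB.
Qed.

Lemma nrm_lt x (e : R) : (`|x| < e%:C) = (nrm x < e).
Proof. by rewrite -nrmE ltcR. Qed.

End nrm_theory.

Lemma ltc0_real (R : realType) (e : R[i]) :
  0 < e -> exists2 d : R, 0 < d & e = d%:C.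
Proof. by case: e => a b; rewrite ltcE /= => /andP[/eqP-> a0]; exists a. Qed.

(* Separable complex Hilbert spaces: complete spaces whose norm is induced by
   an inner product (linear in the first variable). *)
Definition separable_hilbert (R : realType) (E : completeNormedModType R[i]) :
    Prop :=
  (exists dot : {dot E for @Num.conj R[i]}, forall x : E, dot x x = `|x| ^+ 2)
  /\ (exists2 A : set E, countable A & dense A).

(* The normed space of bounded linear operators with the operator norm. *)
Section bounded_operators.
Context (R : realType) (E F : normedModType R[i]).

Definition is_bounded_op (T : E -> F) : Prop :=
  linear T /\ exists M : R, forall x, nrm (T x) <= M * nrm x.

Definition bounded_op_pred : {pred E -> F} := mem [set T | is_bounded_op T].

Lemma bounded_op_submod_closed : submod_closed bounded_op_pred.
Proof.
split=> [|a S T].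
  by rewrite inE; split=> [b x y|]; [rewrite /GRing.zero /= scaler0 addr0|
    exists 0 => x; rewrite mul0r nrm0].
rewrite !inE => -[Slin [M SM]] [Tlin [N TN]].
have E1 x : (a *: S + T) x = a *: S x + T x by [].
split=> [b x y|].
  by rewrite !E1 Slin Tlin !scalerDr !scalerA addrACA (mulrC a b).
exists (complex.Re `|a| * M + N) => x; rewrite E1.
apply: le_trans (nrmD _ _) _; rewrite nrmZ mulrDl lerD// -mulrA.
by rewrite ler_wpM2l// Re_norm_ge0.
Qed.

HB.instance Definition _ := GRing.isSubmodClosed.Build _ _ bounded_op_pred
  bounded_op_submod_closed.

Record bounded_op := BoundedOp {
  bounded_op_fun :> E -> F ;
  bounded_opP : bounded_op_fun \in bounded_op_pred }.

HB.instance Definition _ := [isSub for bounded_op_fun].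
HB.instance Definition _ := [Choice of bounded_op by <:].
HB.instance Definition _ := [SubChoice_isSubLmodule of bounded_op by <:].

Implicit Types S T : bounded_op.

Definition opnorm T : R :=
  inf [set M : R | 0 <= M /\ forall x, nrm (T x) <= M * nrm x].

Let bounds T := [set M : R | 0 <= M /\ forall x, nrm (T x) <= M * nrm x].

Let bounds_lb T : lbound (bounds T) 0.
Proof. by move=> M []. Qed.

Let bounds_has_inf T : has_inf (bounds T).
Proof.
split; last by exists 0; exact: bounds_lb.
have := bounded_opP T; rewrite inE => -[_ [M TM]].
exists `|M|; split=> // x; apply: le_trans (TM x) _.
by rewrite ler_wpM2r ?nrm_ge0 ?ler_norm.
Qed.

Lemma opnorm_ge0 T : 0 <= opnorm T.
Proof. by apply: lb_le_inf; [case: (bounds_has_inf T)|exact: bounds_lb]. Qed.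

Lemma opnormP T x : nrm (T x) <= opnorm T * nrm x.
Proof.
have [->|x0] := eqVneq x 0.
  have := bounded_opP T; rewrite inE => -[_ [M /(_ 0)]].
  by rewrite nrm0 !mulr0.
have x_gt0 : 0 < nrm x.
  by rewrite lt_neqAle nrm_ge0 andbT eq_sym; apply: contra_neq x0 => /nrm0_eq0.
rewrite -ler_pdivrMr//; apply: lb_le_inf; first by case: (bounds_has_inf T).
by move=> M [_ TM]; rewrite ler_pdivrMr.
Qed.

Lemma opnorm_le T M : 0 <= M -> (forall x, nrm (T x) <= M * nrm x) ->
  opnorm T <= M.
Proof. by move=> M0 TM; apply: ge_inf => //; case: (bounds_has_inf T). Qed.

Lemma bounded_opZE a T x : (a *: T) x = a *: T x.
Proof. by []. Qed.

Lemma bounded_opDE S T x : (S + T) x = S x + T x.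
Proof. by []. Qed.

Let opnormD S T : (opnorm (S + T))%:C <= (opnorm S)%:C + (opnorm T)%:C.
Proof.
rewrite -rmorphD /= lecR; apply: opnorm_le => [|x].
  by rewrite addr_ge0 ?opnorm_ge0.
by rewrite bounded_opDE (le_trans (nrmD _ _))// mulrDl lerD ?opnormP.
Qed.

Let opnormZ_le a T : opnorm (a *: T) <= complex.Re `|a| * opnorm T.
Proof.
apply: opnorm_le => [|x]; first by rewrite mulr_ge0 ?opnorm_ge0 ?Re_norm_ge0.
by rewrite bounded_opZE nrmZ -mulrA ler_wpM2l ?opnormP ?Re_norm_ge0.
Qed.

Let opnormZ a T : (opnorm (a *: T))%:C = `|a| * (opnorm T)%:C.
Proof.
have na (c : R[i]) : `|c| = (complex.Re `|c|)%:C by rewrite normc_def.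
rewrite [in RHS]na -rmorphM; congr (_ %:C).
apply/eqP; rewrite eq_le opnormZ_le andTb.
have [->|a0] := eqVneq a 0; first by rewrite normr0 /= mul0r opnorm_ge0.
have a_gt0 : 0 < complex.Re `|a|.
  rewrite lt_neqAle Re_norm_ge0 andbT eq_sym.
  by apply: contra_neq a0 => a0; apply/normr0_eq0; rewrite na a0.
have := opnormZ_le a^-1 (a *: T); rewrite scalerA mulVf// scale1r.
have -> : complex.Re `|a^-1| = (complex.Re `|a|)^-1.
  apply: (fmorph_inj (real_complex R)).
  by rewrite fmorphV /= -!na normfV.
by rewrite -ler_pdivlMl// mulrC.
Qed.

Let opnorm_eq0 T : (opnorm T)%:C = 0 -> T = 0.
Proof.
move=> [T0]; apply/val_inj/funext => x; apply: nrm0_eq0.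
by apply/eqP; rewrite eq_le nrm_ge0 andbT (le_trans (opnormP _ _))// T0 mul0r.
Qed.

HB.instance Definition _ := Lmodule_isNormed.Build R[i] bounded_op
  opnormD opnormZ opnorm_eq0.

End bounded_operators.

(* The space l^2(I, E) of square-summable families. *)
Section square_summable.
Context (R : realType) (I : choiceType) (E : normedModType R[i]).
Implicit Types (a b : I -> E) (c : R[i]) (t : R).

Definition sqsum a : \bar R := \esum_(k in [set: I]) (nrm (a k) ^+ 2)%:E.

Definition l2_pred : {pred I -> E} := mem [set a | (sqsum a < +oo)%E].

Lemma sqsum_ge0 a : (0 <= sqsum a)%E.
Proof. by apply: esum_ge0 => k _; rewrite lee_fin sqr_ge0. Qed.

Let esumZ_le (f : I -> \bar R) t : 0 <= t -> (forall k, 0 <= f k)%E ->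
  (\esum_(k in [set: I]) (t%:E * f k) <= t%:E * \esum_(k in [set: I]) f k)%E.
Proof.
move=> t0 f0; apply: ge_ereal_sup => _ [A [finA _] <-].
rewrite -ge0_mule_fsumr//; apply: lee_wpmul2l; first by rewrite lee_fin.
by apply: esum_ge; exists A.
Qed.

Lemma sqsumZ_le c a : (sqsum (c *: a) <= (complex.Re `|c| ^+ 2)%:E * sqsum a)%E.
Proof.
rewrite /sqsum; under eq_esum do
  rewrite -[(c *: a) _]/(c *: a _) nrmZ exprMn EFinM.
by apply: esumZ_le => [|k]; rewrite ?lee_fin sqr_ge0.
Qed.

Lemma sqsumD_le t a b : 0 < t ->
  (sqsum (a + b)%R <= (1 + t)%:E * sqsum a + (1 + t^-1)%:E * sqsum b)%E.
Proof.
move=> t0; have ti0 : 0 < t^-1 by rewrite invr_gt0.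
have := leeD (@esumZ_le (fun k => (nrm (a k) ^+ 2)%:E) (1 + t) _ _)
  (@esumZ_le (fun k => (nrm (b k) ^+ 2)%:E) (1 + t^-1) _ _).
rewrite -esumD; last 2 first.
- by move=> k _; rewrite -EFinM lee_fin mulr_ge0 ?sqr_ge0// addr_ge0// ltW.
- by move=> k _; rewrite -EFinM lee_fin mulr_ge0 ?sqr_ge0// addr_ge0// ltW.
move=> H; apply: le_trans (H _ _ _ _); last 4 first.
- by rewrite addr_ge0// ltW.
- by move=> k; rewrite lee_fin sqr_ge0.
- by rewrite addr_ge0// ltW.
- by move=> k; rewrite lee_fin sqr_ge0.
apply: le_esum => k _; rewrite -!EFinM -EFinD lee_fin -[(a + b) k]/(a k + b k).
set x := nrm (a k); set y := nrm (b k).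
have : nrm (a k + b k) ^+ 2 <= (x + y) ^+ 2.
  by rewrite ler_sqr ?nnegrE ?addr_ge0 ?nrm_ge0// nrmD.
move=> /le_trans; apply.
have -> : (1 + t) * x ^+ 2 + (1 + t^-1) * y ^+ 2 =
    (x + y) ^+ 2 + t^-1 * (t * x - y) ^+ 2.
  by field; rewrite gt_eqF.
by rewrite lerDl mulr_ge0 ?sqr_ge0// ltW.
Qed.

Lemma l2_submod_closed : submod_closed l2_pred.
Proof.
split=> [|c a b].
  by rewrite inE/= /sqsum esum1// => k _; rewrite /GRing.zero/= nrm0 expr0n.
rewrite !inE/= => a_fin b_fin; apply: le_lt_trans (sqsumD_le _ _ ltr01) _.
rewrite lte_add_pinfty// lte_mul_pinfty// ?lee_fin ?addr_ge0//.
apply: le_lt_trans (sqsumZ_le _ _) _.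
by rewrite lte_mul_pinfty ?lee_fin ?sqr_ge0.
Qed.

HB.instance Definition _ := GRing.isSubmodClosed.Build _ _ l2_pred
  l2_submod_closed.

Record l2 := L2 { l2_fun :> I -> E ; l2P : l2_fun \in l2_pred }.

HB.instance Definition _ := [isSub for l2_fun].
HB.instance Definition _ := [Choice of l2 by <:].
HB.instance Definition _ := [SubChoice_isSubLmodule of l2 by <:].

Implicit Types f g : l2.

Definition l2norm f : R := Num.sqrt (fine (sqsum f)).

Lemma l2norm_ge0 f : 0 <= l2norm f.
Proof. exact: sqrtr_ge0. Qed.

Lemma sqsumE f : sqsum f = (l2norm f ^+ 2)%:E.
Proof.
have f_fin : sqsum f \is a fin_num.
  by rewrite ge0_fin_numE ?sqsum_ge0//; have := l2P f; rewrite inE.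
by rewrite sqr_sqrtr ?fine_ge0 ?sqsum_ge0// fineK.
Qed.

Lemma nrm_le_l2norm f k : nrm (f k) <= l2norm f.
Proof.
rewrite -ler_sqr ?nnegrE ?nrm_ge0 ?l2norm_ge0// -lee_fin -sqsumE.
apply: esum_ge; exists [set k]; first by split.
by rewrite fsbig_set1.
Qed.

Lemma l2norm_le f (M : R) : 0 <= M -> (sqsum f <= (M ^+ 2)%:E)%E ->
  l2norm f <= M.
Proof.
by move=> M0; rewrite sqsumE lee_fin ler_sqr// nnegrE ?l2norm_ge0.
Qed.

Lemma l2norm_eq0 f : l2norm f = 0 -> f = 0.
Proof.
move=> f0; apply/val_inj/funext => k; apply: nrm0_eq0.
by apply/eqP; rewrite eq_le nrm_ge0 andbT -f0 nrm_le_l2norm.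
Qed.

Let l2normD f g : (l2norm (f + g))%:C <= (l2norm f)%:C + (l2norm g)%:C.
Proof.
rewrite -rmorphD lecR.
have [/l2norm_eq0 ->|f0] := eqVneq (l2norm f) 0.
  by rewrite add0r lerDr l2norm_ge0.
have [/l2norm_eq0 ->|g0] := eqVneq (l2norm g) 0.
  by rewrite addr0 lerDl l2norm_ge0.
have f_gt0 : 0 < l2norm f by rewrite lt_neqAle eq_sym f0 l2norm_ge0.
have g_gt0 : 0 < l2norm g by rewrite lt_neqAle eq_sym g0 l2norm_ge0.
apply: l2norm_le; first by rewrite addr_ge0 ?l2norm_ge0.
have := @sqsumD_le (l2norm g / l2norm f) f g (divr_gt0 g_gt0 f_gt0).
rewrite !sqsumE -!EFinM -EFinD => /le_trans; apply; rewrite lee_fin.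
rewrite le_eqVlt; apply/orP; left; apply/eqP.
by field; rewrite f0 g0.
Qed.

Let l2normZ_le c f : l2norm (c *: f) <= complex.Re `|c| * l2norm f.
Proof.
apply: l2norm_le; first by rewrite mulr_ge0 ?l2norm_ge0 ?Re_norm_ge0.
by rewrite exprMn EFinM -sqsumE; exact: sqsumZ_le.
Qed.

Let l2normZ c f : (l2norm (c *: f))%:C = `|c| * (l2norm f)%:C.
Proof.
have na (d : R[i]) : `|d| = (complex.Re `|d|)%:C by rewrite normc_def.
rewrite [in RHS]na -rmorphM; congr (_ %:C).
apply/eqP; rewrite eq_le l2normZ_le andTb.
have [->|c0] := eqVneq c 0; first by rewrite normr0 /= mul0r l2norm_ge0.
have c_gt0 : 0 < complex.Re `|c|.
  rewrite lt_neqAle Re_norm_ge0 andbT eq_sym.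
  by apply: contra_neq c0 => c0; apply/normr0_eq0; rewrite na c0.
have := l2normZ_le c^-1 (c *: f); rewrite scalerA mulVf// scale1r.
have -> : complex.Re `|c^-1| = (complex.Re `|c|)^-1.
  apply: (fmorph_inj (real_complex R)).
  by rewrite fmorphV /= -!na normfV.
by rewrite -ler_pdivlMl// mulrC.
Qed.

Let l2norm_eq0C f : (l2norm f)%:C = 0 -> f = 0.
Proof. by move=> [/l2norm_eq0]. Qed.

HB.instance Definition _ := Lmodule_isNormed.Build R[i] l2
  l2normD l2normZ l2norm_eq0C.

End square_summable.

Section l2_complete.
Context (R : realType) (I : choiceType) (E : completeNormedModType R[i]).
Local Notation l2 := (l2 I E).

Lemma l2_complete (F : set_system l2) : ProperFilter F -> cauchy F -> cvg F.
Proof.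
move=> FF F_cauchy.
have F_close (e : R) : 0 < e ->
    \forall f \near F, \forall g \near F, nrm ((f - g)%R : l2) < e.
  move=> e0; apply: nearP_dep; move/cauchy_ballP : F_cauchy => /(_ e%:C).
  rewrite ltcR => /(_ e0).
  by apply: filterS => -[f g]; rewrite /= -ball_normE /= nrm_lt.
have cvgk k : cvg ((fun f : l2 => f k) @ F).
  apply: cauchy_cvg; apply: cauchy_exP => _ /ltc0_real[e e0 ->].
  have /filter_ex[f fP] := F_close _ e0; exists (f k).
  apply: filterS fP => g; rewrite -ball_normE /= nrm_lt; apply: le_lt_trans.
  exact: (@nrm_le_l2norm _ _ _ (f - g) k).
pose x : I -> E := fun k => lim ((fun f : l2 => f k) @ F).
have x_close (e : R) : 0 < e ->
    \forall f \near F, (sqsum (l2_fun f - x)%R <= (e ^+ 2)%:E)%E.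
  move=> e0; apply: filterS (F_close _ e0) => f fP.
  apply: ge_ereal_sup => _ [A [finA _] <-].
  rewrite fsbig_finite//= sumEFin lee_fin.
  have cvgA : (\sum_(k <- fset_set A) nrm (f k - g k) ^+ 2) @[g --> F] -->
      \sum_(k <- fset_set A) nrm (f k - x k) ^+ 2.
    apply: cvg_big => [|k _]; first exact: add_continuous.
    suff H : nrm (f k - g k) @[g --> F] --> nrm (f k - x k) by exact: (cvgM H H).
    apply/cvgrPdist_lt => d d0; have := cvgk k.
    move=> /cvgrPdist_lt /(_ d%:C); rewrite ltcR => /(_ d0).
    apply: filterS => g; rewrite nrm_lt; apply: le_lt_trans.
    apply: le_trans (nrm_dist _ _) _.
    by rewrite opprB addrC addrA subrK -nrmN opprB.
  rewrite -(cvg_lim _ cvgA)//; apply: limr_le; first exact: cvgP cvgA.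
  apply: filterS fP => g fg.
  have : (sqsum (l2_fun (f - g)%R) <= (e ^+ 2)%:E)%E.
    by rewrite sqsumE lee_fin ler_sqr ?nnegrE ?l2norm_ge0 ?(ltW e0)// ltW.
  rewrite -lee_fin; apply: le_trans.
  apply: esum_ge; exists A; first by split.
  by rewrite fsbig_finite//= sumEFin.
have xP : x \in @l2_pred R I E.
  have /filter_ex[f fx] := x_close _ ltr01.
  have fxP : (l2_fun f - x)%R \in @l2_pred R I E.
    by rewrite inE /=; apply: le_lt_trans fx _; rewrite ltry.
  have -> : x = l2_fun f - (l2_fun f - x) by rewrite opprB addrC subrK.
  by rewrite rpredB// l2P.
apply/cvg_ex; exists (L2 xP); apply/cvgrPdist_le => _ /ltc0_real[e e0 ->].
apply: filterS (x_close _ e0) => f fx.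
rewrite distrC -nrmE lecR; apply: l2norm_le; first exact: ltW.
exact: fx.
Qed.

HB.instance Definition _ := Uniform_isComplete.Build l2 l2_complete.

End l2_complete.

Section multi_index.
Context (n : nat).

Definition multi_index := {ffun 'I_n -> nat}.

Implicit Types k : multi_index.

Definition mdeg k : nat := (\sum_(i < n) k i)%N.

Definition mfact k : nat := (\prod_(i < n) (k i)`!)%N.

Definition rho1 (R : realType) k : R := (mdeg k)`!%:R / (mfact k)%:R.

Definition monomial (R : realType) (z : 'rV[R[i]]_n) k : R[i] :=
  \prod_(i < n) z 0 i ^+ k i.

Definition unit_ball {R : realType} : set 'rV[R[i]]_n :=
  [set z | \sum_(i < n) `|z 0 i| ^+ 2 < 1].

End multi_index.

(* Functions on the ball are total functions of z : 'rV_n whose values outside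
   unit_ball are irrelevant. *)
Section analytic_functions.
Context (R : realType) (n : nat) (E : normedModType R[i]).
Implicit Types (f : 'rV[R[i]]_n -> E) (a : multi_index n -> E).

(* f(z) = sum_k z^k a_k on the ball, as a sum over finite sets of multi-indices
   ordered by inclusion. *)
Definition has_power_series f a : Prop :=
  forall z, unit_ball z ->
    summability.partial_sum (fun k => monomial z k *: a k)
      @ summability.totally --> f z.

(* By Cauchy's formula the functions holomorphic on the ball are those with a
   power series in this sense. For E := bounded_op _ _ the convergence is in
   operator norm. *)
Definition analytic f : Prop := exists a, has_power_series f a.

Definition taylor f : multi_index n -> E := xget (fun=> 0) (has_power_series f).

(* H(b, E), with squared norm sum_k (b_|k| / rho1 k) |a_k|^2. *)
Definition sqnorm (b : nat -> R) f : \bar R :=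
  \esum_(k in [set: multi_index n])
    (b (mdeg k) / rho1 R k * nrm (taylor f k) ^+ 2)%:E.

Definition wspace (b : nat -> R) : set ('rV[R[i]]_n -> E) :=
  [set f | analytic f /\ (sqnorm b f < +oo)%E].

Definition wnorm (b : nat -> R) f : R := Num.sqrt (fine (sqnorm b f)).

End analytic_functions.

(* The weights for which H(b, E) is the Drury-Arveson space. *)
Definition DA_weight (R : realType) (j : nat) : R := 1.

Definition drury_arveson (R : realType) (n : nat) (E : normedModType R[i]) :
    set ('rV[R[i]]_n -> E) :=
  wspace (@DA_weight R).

Section multipliers.
Context (R : realType) (n : nat) (E F : normedModType R[i]).
Implicit Types Phi : 'rV[R[i]]_n -> bounded_op E F.

Definition is_multiplier (b : nat -> R) Phi : Prop :=
  analytic Phi /\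
  forall f, drury_arveson f -> wspace b (fun z => Phi z (f z)).

Definition contractive_multiplier (b : nat -> R) Phi : Prop :=
  is_multiplier b Phi /\
  forall f, drury_arveson f ->
    wnorm b (fun z => Phi z (f z)) <= wnorm (@DA_weight R) f.

End multipliers.

Section weights.
Context (R : realType).
Implicit Types beta : nat -> R.

Record weight_sequence beta : Prop := WeightSequence {
  weight_gt0 : forall j, 0 < beta j ;
  weight_decreasing : forall j, beta j.+1 < beta j ;
  weight0 : beta 0%N = 1 ;
  weight_liminf :
    (1 <= limn_einf (fun j : nat => (beta j `^ (j%:R)^-1)%:E))%E }.

Definition weight_gamma beta (j : nat) : R :=
  if j is i.+1 then ((beta i.+1)^-1 - (beta i)^-1)^-1 else 1.

Definition Psi (n : nat) (E : normedModType R[i]) beta (z : 'rV[R[i]]_n)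
    (a : l2 (multi_index n) E) : E :=
  summability.sum (fun k : multi_index n =>
    ((Num.sqrt (rho1 R k / weight_gamma beta (mdeg k)))%:C * monomial z k)
      *: a k).

End weights.

(* Main.v *)
(* Both directions are read off Taylor coefficients: [Theta] with coefficients
   [A_k] is a contractive multiplier into H(b) iff the convolution
   [a |-> sum_(k + m = p) A_k a_m] is a contraction between the weighted l^2
   spaces, and products of series correspond to convolutions.  If [Theta = Psi
   Theta'], then [Psi] contracts H^2_n(l^2) into H(beta) by Cauchy-Schwarz and the
   Vandermonde identity [sum_(k + m = p) rho k * rho m / gamma_|k| = rho p / beta_|p|].
   Conversely let [X] be multiplication by [Theta] from H = H^2_n(E) to
   K = H(beta, Estar), [T_i] multiplication by [z_i], and [J] on K an operator with
   [|J h|^2 = |h|^2 - |X^* h|^2].  As [|h|^2 - sum_i |T_i^* h|^2] is [|Psi_0^* h|^2]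
   on K, where [Psi_0] is [M_Psi] on constants, and [|f_0|^2] on H, and as
   [X^* T_i^* = T_i^* X^*],
     [sum_i |J T_i^* h|^2 + |Psi_0^* h|^2 = |J h|^2 + |(X^* h)_0|^2],
   so that [(J T_i^* h, Psi_0^* h) |-> (J h, (X^* h)_0)] is isometric.  The adjoint
   of this isometry is a contractive colligation, and its transfer function is the
   factor [Theta'].  Contractivity is an energy balance along the state recursion,
   summed over multi-indices of bounded degree. *)
Require Import Defs.
From HB Require Import structures.
From mathcomp Require Import all_boot all_order all_algebra.
From mathcomp Require Import finmap complex.
From mathcomp Require Import all_classical all_reals all_analysis.
From mathcomp Require Import ring lra.
From mathcomp Require Import summability.

Set Implicit Arguments.
Unset Strict Implicit.
Unset Printing Implicit Defensive.
Import Order.TTheory GRing.Theory Num.Theory.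
Import numFieldNormedType.Exports.
Local Open Scope classical_set_scope.
Local Open Scope complex_scope.
Local Open Scope ring_scope.

Local Existing Instance totally_filter.

(** * Sums over finite subsets *)

(** Where [gamma] comes from: multiplying the kernel of [H(beta)] by [1 - <z,w>] leaves [sum_j
    <z,w>^j / gamma_j = Psi(z) Psi(w)^*]. Contractivity of [Theta] thus says that
    [Psi(z) Psi(w)^* - Theta(z) Theta(w)^*], divided by [1 - <z,w>], is a positive kernel, and a
    factor is sought as in Leech's theorem. As [Psi(z)] is in general not injective, the equation
    does not determine [Theta'] pointwise; one isometry chooses all its values coherently. One space
    plays two roles: in orthonormal coordinates [H(beta, Estar)] is [l2 (multi_index n) Estar],
    which is also the target of the operators [Theta' z]. The domain of the isometry need be neither
    closed nor dense, and extension by zero leaves only a contraction; the energy balance asks for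
    no more. The transfer function is built coefficient by coefficient, so no resolvent is inverted.
    Functions are unconstrained off the ball and [taylor] picks its family by choice, hence the need
    for uniqueness of power series. *)

Lemma partial_sumE (I : choiceType) (V : zmodType) (a : I -> V) (A : {fset I}) :
  partial_sum a A = \sum_(i <- A) a i.
Proof. by rewrite /partial_sum big_seq_fsetE. Qed.

Lemma sum_seq_fset (I : choiceType) (V : nmodType) (s : seq I) (f : I -> V) :
  uniq s -> \sum_(k <- seq_fset tt s) f k = \sum_(k <- s) f k.
Proof.
move=> us; apply: perm_big; apply: uniq_perm => // k; by rewrite seq_fsetE.
Qed.

Lemma sum_fset_sub (I : choiceType) (V : nmodType) (A B : {fset I}) (f : I -> V) :
  (A `<=` B)%fset -> \sum_(k <- B) f k =
    \sum_(k <- A) f k + \sum_(k <- [fset k in B | k \notin A]%fset) f k.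
Proof.
move=> AB; rewrite (big_fsetID _ (mem A) B)/=; congr (_ + _).
apply: eq_fbigl => k; rewrite !inE/=; apply/andP/idP => [[]//|kA].
by split=> //; exact: (fsubsetP AB).
Qed.

Lemma totally_ge (I : choiceType) (A : {fset I}) :
  \forall B \near totally, (A `<=` B)%fset.
Proof. by exists A. Qed.

Section norm_convergence.
Context {R : realType} {E : normedModType R[i]}.

Lemma cvg_nrmP (T : Type) (F : set_system T) (FF : Filter F) (f : T -> E) (l : E) :
  f @ F --> l <-> forall e : R, 0 < e -> \forall t \near F, nrm (l - f t) <= e.
Proof.
split=> [/cvgrPdist_le H e e0|H].
  have := H e%:C; rewrite ltcR => /(_ e0).
  by apply: filterS => t; rewrite -nrmE lecR.
apply/cvgrPdist_le => _ /ltc0_real[e e0 ->].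
by apply: filterS (H e e0) => t; rewrite -nrmE lecR.
Qed.

Lemma cvg_nrm (T : Type) (F : set_system T) (FF : Filter F) (f : T -> E) (l : E) :
  f @ F --> l -> nrm (f t) @[t --> F] --> nrm l.
Proof.
move=> /cvg_nrmP H; apply/cvgrPdist_le => e e0.
by apply: filterS (H e e0) => t; apply: le_trans (nrm_dist _ _).
Qed.

Lemma nrm_sum (I : Type) (r : seq I) (P : pred I) (a : I -> E) :
  nrm (\sum_(i <- r | P i) a i) <= \sum_(i <- r | P i) nrm (a i).
Proof.
elim/big_ind2 : _ => [|x1 x2 y1 y2 h1 h2|//]; first by rewrite nrm0.
by apply: le_trans (nrmD _ _) _; exact: lerD.
Qed.

End norm_convergence.

Section sums.
Context {R : realType} {I : choiceType}.
Implicit Types (a : I -> R).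

Lemma esum_fsetE (a : I -> R) (A : {fset I}) :
  (\sum_(k \in [set` A]) (a k)%:E)%E = (\sum_(k <- A) a k)%:E.
Proof. by rewrite fsbig_finite//= set_fsetK sumEFin. Qed.

Lemma fset_le_esum a (A : {fset I}) :
  ((\sum_(k <- A) a k)%:E <= \esum_(k in [set: I]) (a k)%:E)%E.
Proof.
rewrite -esum_fsetE; apply: esum_ge; exists [set` A] => //.

Qed.

Lemma esum_leP a (M : \bar R) :
  (forall A : {fset I}, ((\sum_(k <- A) a k)%:E <= M)%E) ->
  (\esum_(k in [set: I]) (a k)%:E <= M)%E.
Proof.
move=> H; apply: ge_ereal_sup => _ [A [finA _] <-].
by rewrite fsbig_finite//= sumEFin.
Qed.

Lemma esum_gt a (M : R) : (M%:E < \esum_(k in [set: I]) (a k)%:E)%E ->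
  exists A : {fset I}, M < \sum_(k <- A) a k.
Proof.
move=> H; apply: contrapT => /forallNP H1.
suff : (\esum_(k in [set: I]) (a k)%:E <= M%:E)%E by rewrite leNgt H.
apply: esum_leP => A; rewrite lee_fin leNgt; apply/negP/H1.
Qed.

Lemma fset_sum_ler a (A B : {fset I}) : (forall k, 0 <= a k) ->
  (A `<=` B)%fset -> \sum_(k <- A) a k <= \sum_(k <- B) a k.
Proof.
by move=> a0 AB; rewrite (sum_fset_sub _ AB) lerDl sumr_ge0.
Qed.

Lemma esum_cvg a (l : R) : (forall k, 0 <= a k) ->
  \esum_(k in [set: I]) (a k)%:E = l%:E -> partial_sum a @ totally --> l.
Proof.
move=> a0 al; apply/cvgrPdist_le => e e0.
have [|A hA] := @esum_gt a (l - e); first by rewrite al lte_fin ltrBlDr ltrDl.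
apply: filterS (totally_ge A) => B AB; rewrite partial_sumE.
have h1 := fset_sum_ler a0 AB.
have := fset_le_esum a B; rewrite al lee_fin => h2.
by rewrite ger0_norm ?subr_ge0//; lra.
Qed.

Lemma cvg_esum a (l : R) : (forall k, 0 <= a k) ->
  partial_sum a @ totally --> l -> \esum_(k in [set: I]) (a k)%:E = l%:E.
Proof.
move=> a0 al; apply/eqP; rewrite eq_le; apply/andP; split.
  apply: esum_leP => A; rewrite lee_fin -(cvg_lim _ al)//.
  apply: limr_ge; first exact: cvgP al.
  by apply: filterS (totally_ge A) => B AB; rewrite partial_sumE fset_sum_ler.
rewrite leNgt; apply/negP => h.
have h0 : (0 <= \esum_(k in [set: I]) (a k)%:E)%E.
  by apply: esum_ge0 => k _; rewrite lee_fin.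
case E : (\esum_(k in [set: I]) (a k)%:E)%E h h0 => [s| |]//.
rewrite lte_fin => sl _.
suff : l <= s by rewrite leNgt sl.
rewrite -(cvg_lim _ al)//; apply: limr_le; first exact: cvgP al.
apply: filterS (totally_ge fset0) => A _.
by rewrite partial_sumE -lee_fin -E; exact: fset_le_esum.
Qed.

Lemma esum_fin_cvg a : (forall k, 0 <= a k) ->
  (\esum_(k in [set: I]) (a k)%:E < +oo)%E ->
  exists2 l : R, 0 <= l & \esum_(k in [set: I]) (a k)%:E = l%:E.
Proof.
move=> a0 h.
have h0 : (0 <= \esum_(k in [set: I]) (a k)%:E)%E.
  by apply: esum_ge0 => k _; rewrite lee_fin.
case: esum h h0 => [s| |]//; rewrite lee_fin => _ s0.
by exists s.
Qed.

End sums.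

Section finite_regrouping.
Context {I : choiceType}.

Lemma psum_finite (V : topologicalZmodType) (a : I -> V) (A : {fset I}) :
  (forall k, k \notin A -> a k = 0) ->
  partial_sum a @ totally --> \sum_(k <- A) a k.
Proof.
move=> a0; apply: cvg_near_cst; apply: filterS (totally_ge A) => B AB.
rewrite partial_sumE; apply/esym; apply: (big_fset_incl _ AB) => k kB kA.
exact: a0.
Qed.

(** The regrouped partial sum over [B] is a partial sum of [a] over [phi B], the preimage of [B]
    under [pi]. The sets [phi B] are cofinal because the fibres are finite, so the limit carries
    over. *)
Lemma psum_regroup (J : choiceType) (V : topologicalZmodType) (a : I -> V)
    (pi : I -> J) (F : J -> seq I) (l : V) :
  (forall j, uniq (F j)) -> (forall i j, (i \in F j) = (pi i == j)) ->
  partial_sum a @ totally --> l ->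
  partial_sum (fun j => \sum_(i <- F j) a i) @ totally --> l.
Proof.
move=> Fu Fpi al.
pose phi (B : {fset J}) : {fset I} := seq_fset tt (flatten [seq F j | j <- B]).
have phiE i B : (i \in phi B) = (pi i \in B).
  rewrite seq_fsetE; apply/flatten_mapP/idP => [[j jB]|iB].
    by rewrite Fpi => /eqP->.
  by exists (pi i) => //; rewrite Fpi.
have -> : partial_sum (fun j => \sum_(i <- F j) a i) = partial_sum a \o phi.
  apply/funext => B /=; rewrite !partial_sumE.
  rewrite [RHS](partition_big_imfset _ pi)/=.
  (* Indices with an empty fibre are missed by the image of [pi]; they contribute empty sums. *)
  have -> : [fset pi x | x in phi B]%fset = [fset j in B | F j != [::]]%fset.
    apply/fsetP => j; apply/imfsetP/idP => /=.
      case=> i; rewrite phiE => iB ->; rewrite !inE iB/=.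
      by apply/eqP => h; have := Fpi i (pi i); rewrite h eqxx.
    rewrite !inE => /andP[jB]; case E1 : (F j) => [//|i s] _.
    have := Fpi i j; rewrite E1 mem_head => /esym/eqP ij.
    by exists i => //; rewrite phiE ij.
  rewrite [LHS](big_fsetID _ (fun j => F j != [::]) B)/= [X in _ + X]big1_fset.
    rewrite addr0.
  apply: eq_big_seq => j; rewrite !inE => /andP[jB _].
  rewrite -[RHS]big_filter; apply: perm_big; apply: uniq_perm => //.
    by rewrite filter_uniq.
  move=> i; rewrite Fpi mem_filter phiE.
    by case: eqP => [->|]; rewrite ?jB ?andbF.
  by move=> j; rewrite !inE => /andP[_ /negPn/eqP ->] _; rewrite big_nil.
apply: cvg_comp al => //.
move=> S [A _ AS]; exists [fset pi x | x in A]%fset => // B /= AB; apply: AS.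
apply/fsubsetP => i iA; rewrite phiE; apply: (fsubsetP AB).
by apply/imfsetP; exists i.
Qed.

End finite_regrouping.

Lemma psum_unique (K : numFieldType) (I : choiceType) (V : normedModType K)
    (a : I -> V) (l l' : V) :
  partial_sum a @ totally --> l -> partial_sum a @ totally --> l' -> l = l'.
Proof. by move=> h h'; rewrite -(cvg_lim _ h)// -(cvg_lim _ h'). Qed.

Section absolute_convergence.
Context {R : realType} {I : choiceType}.

(** The majorant [c] is kept apart from the norms so that it can be [nrm (A k) * nrm x], which makes
    the tail of an operator series uniform in [x] up to that factor. *)
Lemma psum_tail {E : normedModType R[i]} (f : I -> E) (c : I -> R) (l : E) (s : R)
    (B : {fset I}) :
  partial_sum f @ totally --> l -> (forall k, nrm (f k) <= c k) ->
  (\esum_(k in [set: I]) (c k)%:E <= s%:E)%E ->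
  nrm (l - \sum_(k <- B) f k) <= s - \sum_(k <- B) c k.
Proof.
move=> fl fc cs.
have c0 k : 0 <= c k by apply: le_trans (fc k); exact: nrm_ge0.
have h : nrm (partial_sum f A - \sum_(k <- B) f k) @[A --> totally] -->
    nrm (l - \sum_(k <- B) f k).
  by apply: cvg_nrm; apply: cvgB fl _; exact: cvg_cst.
rewrite -(cvg_lim _ h)//; apply: limr_le; first exact: cvgP h.
apply: filterS (totally_ge B) => A BA; rewrite partial_sumE.
rewrite (sum_fset_sub _ BA) addrC addKr; apply: le_trans (nrm_sum _ _ _) _.
apply: (@le_trans _ _ (\sum_(k <- [fset k in A | k \notin B]%fset) c k)).
  by apply: ler_sum => k _; exact: fc.
rewrite lerBrDl -(sum_fset_sub _ BA) -lee_fin; apply: le_trans cs; exact: fset_le_esum.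
Qed.

Lemma psum_nrm_le {E : normedModType R[i]} (f : I -> E) (l : E) (s : R) :
  partial_sum f @ totally --> l ->
  (\esum_(k in [set: I]) (nrm (f k))%:E <= s%:E)%E -> nrm l <= s.
Proof.
move=> fl fs; have := psum_tail fset0 fl (fun k => lexx _) fs.
by rewrite !big_seq_fset0 !subr0.
Qed.

Lemma psum_abs_cvg {E : completeNormedModType R[i]} (f : I -> E) :
  (\esum_(k in [set: I]) (nrm (f k))%:E < +oo)%E ->
  cvg (partial_sum f @ totally).
Proof.
move=> /(esum_fin_cvg (fun k => nrm_ge0 _))[s _ fs].
apply: cauchy_cvg; apply: cauchy_exP => _ /ltc0_real[e e0 ->].
have [|A hA] := @esum_gt _ _ (fun k => nrm (f k)) (s - e).
  by rewrite fs lte_fin ltrBlDr ltrDl.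
exists (\sum_(k <- A) f k).
apply: filterS (totally_ge A) => B AB.
rewrite /= -ball_normE /= nrm_lt partial_sumE -nrmN opprB.
rewrite (sum_fset_sub _ AB) addrC addKr; apply: le_lt_trans (nrm_sum _ _ _) _.
have := fset_le_esum (fun k => nrm (f k)) B; rewrite fs lee_fin (sum_fset_sub _ AB).
by move=> h; lra.
Qed.

End absolute_convergence.

(** * Bounded operators and operator-valued series *)

Section operator_series.
Context {R : realType}.

Lemma opE {E F : normedModType R[i]} (T : bounded_op E F) : linear T.
Proof. by have := bounded_opP T; rewrite inE => -[]. Qed.

Section op_linear.
Context {E F : normedModType R[i]}.
Implicit Type T : bounded_op E F.

Lemma opD T x y : T (x + y) = T x + T y.
Proof. by have := opE T 1 x y; rewrite !scale1r. Qed.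

Lemma op0 T : T 0 = 0.
Proof. by apply: (addrI (T 0)); rewrite -opD !addr0. Qed.

Lemma opZ T c x : T (c *: x) = c *: T x.
Proof. by have := opE T c x 0; rewrite op0 !addr0. Qed.

Lemma opN T x : T (- x) = - T x.
Proof. by rewrite -scaleN1r opZ scaleN1r. Qed.

Lemma opB T x y : T (x - y) = T x - T y.
Proof. by rewrite opD opN. Qed.

Lemma op_sum T (I : Type) (r : seq I) (P : pred I) (f : I -> E) :
  T (\sum_(i <- r | P i) f i) = \sum_(i <- r | P i) T (f i).
Proof. exact: (big_morph _ (opD T) (op0 T)). Qed.

Lemma sum_opE (I : Type) (r : seq I) (P : pred I) (A : I -> bounded_op E F) x :
  (\sum_(i <- r | P i) A i) x = \sum_(i <- r | P i) A i x.
Proof. by elim/big_rec2 : _ => [|i y1 y2 _ <-]. Qed.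

Lemma nrm_op T x : nrm (T x) <= nrm T * nrm x.
Proof. exact: opnormP. Qed.

Lemma nrm_op_le T M : 0 <= M -> (forall x, nrm (T x) <= M * nrm x) -> nrm T <= M.
Proof. exact: opnorm_le. Qed.

Lemma bounded_op_ex (f : E -> F) (M : R) : linear f ->
  (forall x, nrm (f x) <= M * nrm x) -> exists T : bounded_op E F, T =1 f.
Proof.
move=> lf bf; have fP : f \in @bounded_op_pred R E F.
  by rewrite inE; split => //; exists M.
by exists (BoundedOp fP).
Qed.

End op_linear.

(** The limit is taken pointwise in the complete space [F]; the tail bound is linear in [nrm x],
    which turns pointwise convergence into convergence in operator norm. *)
Lemma op_series_cvg (I : choiceType) (E : normedModType R[i])
    (F : completeNormedModType R[i]) (A : I -> bounded_op E F) :
  (\esum_(k in [set: I]) (nrm (A k))%:E < +oo)%E ->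
  exists T : bounded_op E F, partial_sum A @ totally --> T.
Proof.
move=> hA.
have [s s0 As] := esum_fin_cvg (fun k => nrm_ge0 (A k)) hA.
have Ax (x : E) : (\esum_(k in [set: I]) (nrm (A k) * nrm x)%:E <= (s * nrm x)%:E)%E.
  apply: esum_leP => B; rewrite lee_fin -mulr_suml ler_wpM2r ?nrm_ge0//.
  by rewrite -lee_fin -As; exact: fset_le_esum.
have Acvg (x : E) : cvg (partial_sum (fun k => A k x) @ totally).
  apply: psum_abs_cvg; apply: le_lt_trans (ltry (s * nrm x)).
  by apply: le_trans (Ax x); apply: le_esum => k _; rewrite lee_fin nrm_op.
pose f (x : E) := lim (partial_sum (fun k => A k x) @ totally).
have ftail (x : E) (B : {fset I}) : nrm (f x - \sum_(k <- B) A k x) <=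
    (s - \sum_(k <- B) nrm (A k)) * nrm x.
  rewrite mulrBl mulr_suml;
  apply: (@psum_tail _ _ _ (fun k => A k x) (fun k => nrm (A k) * nrm x)).
  - exact: Acvg.
  - by move=> k; exact: nrm_op.
  - exact: Ax.
have lf : linear f.
  move=> c x y; rewrite /f; apply: cvg_lim => //.
  have -> : partial_sum (fun k => A k (c *: x + y)) =
      (fun B => c *: partial_sum (fun k => A k x) B + partial_sum (fun k => A k y) B).
    apply/funext => B; rewrite !partial_sumE scaler_sumr -big_split/=.
    by apply: eq_bigr => k _; rewrite opD opZ.
  by apply: cvgD; [apply: cvgZr|]; exact: Acvg.
have [|T Tf] := bounded_op_ex (M := s) lf.
  by move=> x; have := ftail x fset0; rewrite !big_seq_fset0 !subr0.
exists T; apply/cvg_nrmP => e e0.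
have [|B hB] := @esum_gt _ _ (fun k => nrm (A k)) (s - e).
  by rewrite As lte_fin ltrBlDr ltrDl.
apply: filterS (totally_ge B) => C BC; rewrite partial_sumE.
apply: nrm_op_le => [|x]; first exact: ltW.
have -> : (T - \sum_(i <- C) A i) x = f x - \sum_(i <- C) A i x.
  by rewrite -sum_opE -Tf.
apply: le_trans (ftail x C) _; rewrite ler_wpM2r ?nrm_ge0//.
have := fset_sum_ler (fun k => nrm_ge0 (A k)) BC; lra.
Qed.

Lemma partial_sum_prod (I J : choiceType) (V : zmodType) (f : I * J -> V)
    (A : {fset I}) (B : {fset J}) :
  partial_sum f (A `*` B)%fset = \sum_(i <- A) \sum_(j <- B) f (i, j).
Proof.
rewrite partial_sumE -big_allpairs; apply: perm_big; apply: uniq_perm.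
- exact: fset_uniq.
- by apply: allpairs_uniq => // -[? ?] [? ?] _ _ [-> ->].
move=> [i j]; rewrite in_fsetM/=; apply/andP/allpairsP => /= [[iA jB]|].
  by exists (i, j).
by case=> -[i' j'] /= [? ? [-> ->]].
Qed.

Lemma esum_prod_le (I J : choiceType) (a : I -> R) (b : J -> R) (s t : R) :
  (forall i, 0 <= a i) -> (forall j, 0 <= b j) ->
  (\esum_(i in [set: I]) (a i)%:E <= s%:E)%E ->
  (\esum_(j in [set: J]) (b j)%:E <= t%:E)%E ->
  (\esum_(k in [set: I * J]) (a k.1 * b k.2)%:E <= (s * t)%:E)%E.
Proof.
move=> a0 b0 hs ht; apply: esum_leP => C; rewrite lee_fin.
pose A := [fset k.1 | k in C]%fset; pose B := [fset k.2 | k in C]%fset.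
have CAB : (C `<=` A `*` B)%fset.
  apply/fsubsetP => k kC; rewrite in_fsetM; apply/andP.
  by split; apply/imfsetP; exists k.
apply: le_trans (fset_sum_ler _ CAB) _ => [k|]; first exact: mulr_ge0.
rewrite -partial_sumE partial_sum_prod/=.
under eq_bigr do rewrite -mulr_sumr.
rewrite -mulr_suml; apply: ler_pM.
- exact: sumr_ge0.
- exact: sumr_ge0.
- by rewrite -lee_fin; apply: le_trans hs; exact: fset_le_esum.
- by rewrite -lee_fin; apply: le_trans ht; exact: fset_le_esum.
Qed.

(** Absolute convergence yields some limit [y] of the double series; on a large rectangle the double
    sum is a partial sum of [A] applied to a partial sum of [f], which identifies [y] with [T x]. *)
Lemma op_series_mul (I J : choiceType) (E : normedModType R[i])
    (F : completeNormedModType R[i]) (A : I -> bounded_op E F) (f : J -> E)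
    (T : bounded_op E F) (x : E) :
  (\esum_(i in [set: I]) (nrm (A i))%:E < +oo)%E ->
  (\esum_(j in [set: J]) (nrm (f j))%:E < +oo)%E ->
  partial_sum A @ totally --> T -> partial_sum f @ totally --> x ->
  partial_sum (fun k : I * J => A k.1 (f k.2)) @ totally --> T x.
Proof.
move=> Afin ffin AT fx.
have [s s0 As] := esum_fin_cvg (fun k => nrm_ge0 (A k)) Afin.
have [t t0 ft] := esum_fin_cvg (fun k => nrm_ge0 (f k)) ffin.
have : cvg (partial_sum (fun k : I * J => A k.1 (f k.2)) @ totally).
  apply: psum_abs_cvg; apply: le_lt_trans (ltry (s * t)).
  apply: (@le_trans _ _ (\esum_(k in [set: I * J]) (nrm (A k.1) * nrm (f k.2))%:E)).
    by apply: le_esum => k _; rewrite lee_fin nrm_op.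
  by apply: (esum_prod_le (a := fun i => nrm (A i)) (b := fun j => nrm (f j)));
    rewrite ?As ?ft// => ?; exact: nrm_ge0.
move=> /cvg_ex[y hy]; suff -> : T x = y by [].
apply/eqP; rewrite -subr_eq0; apply/eqP/nrm0_eq0/eqP.
rewrite eq_le nrm_ge0 andbT; apply/ler_addgt0Pr => e e0; rewrite add0r.
(* [s] bounds [nrm T] and [nrm x + 1] bounds the partial sum of [f], so the three errors total
   [s d + d (nrm x + 1) + d = e]. *)
pose d := e / (2 + s + nrm x).
have D0 : 0 < 2 + s + nrm x by rewrite ltr_wpDr ?nrm_ge0// ltr_wpDr.
have d0 : 0 < d by exact: divr_gt0.
have /cvg_nrmP/(_ _ d0)[C0 _ hC0] := hy.
have /cvg_nrmP/(_ _ d0)[A0 _ hA0] := AT.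
have /cvg_nrmP hfx := fx.
have [B0 _ hB0] := hfx (Num.min d 1) ltac:(by rewrite lt_min d0 ltr01).
pose A1 := (A0 `|` [fset k.1 | k in C0])%fset.
pose B1 := (B0 `|` [fset k.2 | k in C0])%fset.
have hC := hC0 (A1 `*` B1)%fset.
have hA := hA0 A1; have hB := hB0 B1.
have {hC} : nrm (y - partial_sum A A1 (partial_sum f B1)) <= d.
  have -> : partial_sum A A1 (partial_sum f B1) =
      partial_sum (fun k : I * J => A k.1 (f k.2)) (A1 `*` B1)%fset.
    rewrite partial_sum_prod !partial_sumE sum_opE.
    by apply: eq_bigr => i _; rewrite op_sum.
  apply: hC => /=; apply/fsubsetP => k kC; rewrite in_fsetM !inE.
  by apply/andP; split; apply/orP; right; apply/imfsetP; exists k.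
have {hA} : nrm (T - partial_sum A A1) <= d.
  by apply: hA => /=; apply/fsubsetP => k kA; rewrite !inE kA.
have {hB} : nrm (x - partial_sum f B1) <= Num.min d 1.
  by apply: hB => /=; apply/fsubsetP => k kB; rewrite !inE kB.
rewrite le_min => /andP[hB hB1].
have hTs : nrm T <= s by apply: psum_nrm_le AT _; rewrite As.
set P := partial_sum A A1; set p := partial_sum f B1 => hTP hyP.
have hp : nrm p <= nrm x + 1.
  have -> : p = x - (x - p) by rewrite opprB addrC subrK.
  by apply: le_trans (nrmD _ _) _; rewrite nrmN lerD2l.
have -> : T x - y = T (x - p) + (T - P) p - (y - P p).
  rewrite opB opprB; have -> : (T - P) p = T p - P p by [].
  by rewrite (addrA (T x - T p)) subrK addrA subrK.
apply: le_trans (nrmD _ _) _; rewrite nrmN.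
have h1 : nrm (T (x - p) + (T - P) p) <= s * d + d * (nrm x + 1).
  apply: le_trans (nrmD _ _) _; apply: lerD.
    by apply: le_trans (nrm_op _ _) _; apply: ler_pM; rewrite ?nrm_ge0.
  by apply: le_trans (nrm_op _ _) _; apply: ler_pM; rewrite ?nrm_ge0.
apply: le_trans (lerD h1 hyP) _.
have -> : s * d + d * (nrm x + 1) + d = d * (2 + s + nrm x) by ring.
by rewrite /d divfK// gt_eqF.
Qed.

End operator_series.

(** * Multi-indices *)

Section multi_indices.
Context {n : nat}.
Local Notation mi := (multi_index n).
Implicit Types (k m p : mi) (i : 'I_n).

Definition madd k m : mi := [ffun i => (k i + m i)%N].
Definition msucc i p : mi := [ffun j => (p j + (j == i))%N].
Definition mpred i p : mi := [ffun j => (p j - (j == i))%N].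
Definition midx0 : mi := [ffun => 0%N].

Lemma mdeg_madd k m : mdeg (madd k m) = (mdeg k + mdeg m)%N.
Proof. by rewrite /mdeg -big_split; apply: eq_bigr => i _; rewrite ffunE. Qed.

Lemma mdeg_msucc i p : mdeg (msucc i p) = (mdeg p).+1.
Proof.
rewrite /mdeg -addn1; under eq_bigr do rewrite ffunE.
rewrite big_split/=; congr addn; rewrite -big_mkcond big_pred1_eq//.
Qed.

Lemma mpredK i p : (0 < p i)%N -> msucc i (mpred i p) = p.
Proof.
move=> pi; apply/ffunP => j; rewrite !ffunE; case: eqP => [->|_] /=.
  by rewrite subnK.
by rewrite subn0 addn0.
Qed.

Lemma msuccK i p : mpred i (msucc i p) = p.
Proof. by apply/ffunP => j; rewrite !ffunE addnK. Qed.

Lemma msucc_gt0 i p : (0 < msucc i p i)%N.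
Proof. by rewrite ffunE eqxx addn1. Qed.

Lemma mdeg_mpred i p : (0 < p i)%N -> mdeg p = (mdeg (mpred i p)).+1.
Proof. by move=> pi; rewrite -(mdeg_msucc i) mpredK. Qed.

Lemma mdeg0 : mdeg midx0 = 0%N.
Proof. by rewrite /mdeg big1// => i _; rewrite ffunE. Qed.

Lemma mdeg_eq0 p : (mdeg p == 0%N) = (p == midx0).
Proof.
apply/idP/eqP => [|->]; last by rewrite mdeg0.
rewrite /mdeg sum_nat_eq0 => /forallP h; apply/ffunP => i.
by rewrite ffunE; apply/eqP; exact: h.
Qed.

Lemma leq_mdeg p i : (p i <= mdeg p)%N.
Proof. by rewrite /mdeg (bigD1 i)//= leq_addr. Qed.

Lemma mpred_msucc_madd i k m :
  (0 < k i)%N -> madd (mpred i k) m = mpred i (madd k m).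
Proof.
move=> ki; apply/ffunP => j; rewrite !ffunE; case: eqP => [->|_] /=.
  by rewrite addnBAC.
by rewrite !subn0.
Qed.

Definition box (N : nat) : seq mi :=
  [seq [ffun i => nat_of_ord (g i)] | g : {ffun 'I_n -> 'I_N}].

Lemma mem_box N k : (k \in box N) = [forall i, (k i < N)%N].
Proof.
apply/mapP/forallP => /= [[g _ ->] i|h]; first by rewrite ffunE.
exists [ffun i => Ordinal (h i)]; first by rewrite mem_enum.
by apply/ffunP => i; rewrite !ffunE.
Qed.

Lemma box_uniq N : uniq (box N).
Proof.
rewrite map_inj_uniq ?enum_uniq// => f g /ffunP h; apply/ffunP => i.
by have := h i; rewrite !ffunE => /val_inj.
Qed.

Definition lvl (d : nat) : seq mi := [seq k <- box d.+1 | mdeg k == d].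

Lemma mem_lvl d k : (k \in lvl d) = (mdeg k == d).
Proof.
rewrite mem_filter mem_box; case: eqP => //= <-; apply/forallP => i.
by rewrite ltnS leq_mdeg.
Qed.

Lemma lvl_uniq d : uniq (lvl d).
Proof. by rewrite filter_uniq// box_uniq. Qed.

Definition splits p : seq (mi * mi) :=
  [seq (k, [ffun i => (p i - k i)%N] : mi) |
    k : mi <- [seq k : mi <- box (mdeg p).+1 | [forall i, (k i <= p i)%N]]].

Lemma mem_splits p km : (km \in splits p) = (madd km.1 km.2 == p).
Proof.
case: km => k m /=; apply/mapP/eqP => [[k']|<-].
  rewrite mem_filter => /andP[/forallP h _] [-> ->].
  by apply/ffunP => i; rewrite !ffunE subnKC.
exists k; last by congr (_, _); apply/ffunP => i; rewrite !ffunE addKn.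
rewrite mem_filter mem_box; apply/andP; split; apply/forallP => i.
  by rewrite ffunE leq_addr.
by rewrite ltnS (leq_trans (leq_mdeg _ _))// mdeg_madd leq_addr.
Qed.

Lemma splits_uniq p : uniq (splits p).
Proof.
by rewrite map_inj_uniq ?filter_uniq ?box_uniq// => k k' [].
Qed.

Section reindexing.
Context {V : nmodType}.

(** Pairs [(p, i)] with [p i > 0] in degree [d.+1] correspond to all pairs in degree [d]. This
    drives the inductions on the degree in [sum_rho1_lvl] and [energy]. *)
Lemma sum_lvl_succ (F : 'I_n -> mi -> V) d :
  \sum_(p <- lvl d.+1) \sum_(i | (0 < p i)%N) F i (mpred i p) =
  \sum_(p <- lvl d) \sum_i F i p.
Proof.
rewrite (exchange_big_dep xpredT)//= [RHS]exchange_big/=.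
apply: eq_bigr => i _; rewrite -big_filter -(big_map (mpred i) xpredT (F i)).
apply: perm_big; apply: uniq_perm; last 1 first.
- move=> p; rewrite mem_lvl; apply/mapP/eqP => [[q]|<-].
    rewrite mem_filter mem_lvl => /andP[qi /eqP qd] ->.
    by apply: succn_inj; rewrite -mdeg_mpred.
  exists (msucc i p); last by rewrite msuccK.
  by rewrite mem_filter mem_lvl msucc_gt0 mdeg_msucc eqxx.
- rewrite map_inj_in_uniq ?(filter_uniq _ (lvl_uniq _))// => p q.
  rewrite !mem_filter => /andP[pi _] /andP[qi _] h.
  by rewrite -(mpredK pi) h mpredK.
- exact: lvl_uniq.
Qed.

(** Both sides run over the triples [(k', m, i)] for which [k' + m] plus one unit in coordinate [i]
    is [p]. This moves a coordinate shift through a convolution. *)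
Lemma sum_splits_mpred (F : 'I_n -> mi -> mi -> V) p :
  \sum_(km <- splits p) \sum_(i | (0 < km.1 i)%N) F i (mpred i km.1) km.2 =
  \sum_(i | (0 < p i)%N) \sum_(km <- splits (mpred i p)) F i km.1 km.2.
Proof.
rewrite (exchange_big_dep xpredT)//= [RHS]big_mkcond/=.
apply: eq_bigr => i _; case: ifP => pi; last first.
  rewrite big_seq_cond big1// => km /andP[]; rewrite mem_splits => /eqP km_p ki.
  by move: pi; rewrite -km_p ffunE addn_gt0 ki.
rewrite -big_filter.
rewrite -(big_map (fun km : mi * mi => (mpred i km.1, km.2)) xpredT
  (fun km => F i km.1 km.2)).
apply: perm_big; apply: uniq_perm; last 1 first.
- case=> k m; rewrite mem_splits/=; apply/mapP/eqP => [[[k' m']]|km].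
    rewrite mem_filter mem_splits/= => /andP[ki /eqP <-] [-> ->].
    exact: mpred_msucc_madd.
  exists (msucc i k, m); last by rewrite /= msuccK.
  rewrite mem_filter mem_splits/= msucc_gt0/=; apply/eqP.
  by rewrite -[p](mpredK pi) -km; apply/ffunP => j; rewrite !ffunE addnAC.
- rewrite map_inj_in_uniq ?(filter_uniq _ (splits_uniq _))// => -[k m] [k' m'].
  rewrite !mem_filter/= => /andP[ki _] /andP[ki' _] [h ->].
  by rewrite -(mpredK ki) h mpredK.
- exact: splits_uniq.
Qed.

Lemma sum_splitsC (F : mi -> mi -> V) p :
  \sum_(km <- splits p) F km.1 km.2 = \sum_(km <- splits p) F km.2 km.1.
Proof.
rewrite -(big_map (fun km : mi * mi => (km.2, km.1)) xpredT
  (fun km => F km.1 km.2)); apply: perm_big; apply: uniq_perm.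
- exact: splits_uniq.
- by rewrite map_inj_uniq ?splits_uniq// => -[? ?] [? ?] [-> ->].
have addC k m : madd k m = madd m k.
  by apply/ffunP => i; rewrite !ffunE addnC.
move=> [k m]; rewrite mem_splits/=; apply/eqP/mapP => [<-|[[k' m']]].
  by exists (m, k) => //; rewrite mem_splits addC.
by rewrite mem_splits/= addC => /eqP <- [-> ->].
Qed.

Lemma sum_splits_mpredr (F : 'I_n -> mi -> mi -> V) p :
  \sum_(km <- splits p) \sum_(i | (0 < km.2 i)%N) F i km.1 (mpred i km.2) =
  \sum_(i | (0 < p i)%N) \sum_(km <- splits (mpred i p)) F i km.1 km.2.
Proof.
rewrite (sum_splitsC (fun k m => \sum_(i | (0 < m i)%N) F i k (mpred i m))).
rewrite (sum_splits_mpred (fun i k m => F i m k)).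
by apply: eq_bigr => i _; rewrite (sum_splitsC (fun k m => F i m k)).
Qed.

Lemma sum_splits0r (F : mi -> mi -> V) p :
  (forall k m, m != midx0 -> F k m = 0) ->
  \sum_(km <- splits p) F km.1 km.2 = F p midx0.
Proof.
move=> F0; rewrite (bigD1_seq (p, midx0)) ?splits_uniq//=; last first.
  by rewrite mem_splits/=; apply/eqP/ffunP => i; rewrite !ffunE addn0.
rewrite big_seq_cond big1 ?addr0// => -[k m] /andP[]; rewrite mem_splits/=.
move=> /eqP km km0; apply: F0; apply: contraNneq km0 => m0.
rewrite -km m0; apply/eqP; congr (_, _).
by apply/ffunP => i; rewrite !ffunE addn0.
Qed.

Lemma sum_splits0l (F : mi -> mi -> V) p :
  (forall k m, k != midx0 -> F k m = 0) ->
  \sum_(km <- splits p) F km.1 km.2 = F midx0 p.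
Proof.
move=> F0; rewrite (sum_splitsC F) (sum_splits0r (F := fun k m => F m k))//.
by move=> k m; exact: F0.
Qed.

End reindexing.

Section rho.
Context {R : realType}.
Local Notation rho1 := (rho1 R).

Lemma mfact_gt0 p : (0 < mfact p)%N.
Proof. by apply: prodn_gt0 => i; exact: fact_gt0. Qed.

Lemma rho1_gt0 p : 0 < rho1 p.
Proof. by rewrite divr_gt0// ltr0n ?fact_gt0 ?mfact_gt0. Qed.

Lemma rho1_0 : rho1 midx0 = 1.
Proof.
rewrite /Defs.rho1 mdeg0 /mfact big1 ?divr1// => i _.
by rewrite ffunE.
Qed.

Lemma rho1_mpred i p : (0 < p i)%N ->
  rho1 (mpred i p) = rho1 p * ((p i)%:R / (mdeg p)%:R).
Proof.
move=> pi; have h : mfact p = (p i * mfact (mpred i p))%N.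
  rewrite /mfact (bigD1 i)//= [in RHS](bigD1 i)//= !ffunE eqxx mulnA.
  congr (_ * _)%N; first by rewrite -(prednK pi) factS subn1.
  by apply: eq_bigr => j /negPf ji; rewrite ffunE ji subn0.
rewrite /Defs.rho1 h (mdeg_mpred pi) factS !natrM.
by field; rewrite nat1r !pnatr_eq0 -!lt0n pi mfact_gt0.
Qed.

(** Pascal's rule for multinomial coefficients: the fractions [p i / mdeg p] of [rho1_mpred] add up
    to 1. *)
Lemma rho1_sum p : p != midx0 ->
  \sum_(i | (0 < p i)%N) rho1 (mpred i p) = rho1 p.
Proof.
rewrite -mdeg_eq0 => p0.
under eq_bigr do rewrite rho1_mpred//.
rewrite -mulr_sumr -mulr_suml -natr_sum.
suff -> : (\sum_(i < n | 0 < p i) p i)%N = mdeg p.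
  by rewrite divff ?mulr1// pnatr_eq0.
rewrite /mdeg [RHS](bigID (fun i => 0 < p i)%N)/= [X in (_ + X)%N]big1 ?addn0//.
by move=> i; rewrite -eqn0Ngt => /eqP.
Qed.

(** Induction on the degree: Pascal's rule on [rho1 km.2] moves one unit from [m] to [p], and the
    term [m = 0], where Pascal's rule fails, supplies the last summand [w (mdeg p)]. *)
Lemma rho1_vandermonde (w : nat -> R) p :
  \sum_(km <- splits p) rho1 km.1 * rho1 km.2 * w (mdeg km.1) =
  rho1 p * \sum_(j < (mdeg p).+1) w j.
Proof.
move dE : (mdeg p) => d; elim: d p dE => [|d IH] p dE.
  have /eqP -> : p == midx0 by rewrite -mdeg_eq0 dE.
  rewrite big_ord1 rho1_0 mul1r.
  rewrite (eq_big_seq (fun km => if km.2 == midx0 then w 0%N else 0)); last first.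
    move=> [k m]; rewrite mem_splits/= => /eqP km.
    have := mdeg_madd k m; rewrite km mdeg0 => /esym/eqP.
    rewrite addn_eq0 !mdeg_eq0 => /andP[/eqP -> /eqP ->].
    by rewrite eqxx rho1_0 !mul1r mdeg0.
  rewrite (sum_splits0r (F := fun k m => if m == midx0 then w 0%N else 0)).
    by rewrite eqxx.
  by move=> k m /negPf ->.
have p0 : p != midx0 by rewrite -mdeg_eq0 dE.
pose G k m := if m == midx0 then rho1 k * w (mdeg k) else 0.
pose H i k m := rho1 k * rho1 m * w (mdeg k).
transitivity (\sum_(km <- splits p) (G km.1 km.2 +
    \sum_(i | (0 < km.2 i)%N) H i km.1 (mpred i km.2))).
  apply: eq_bigr => -[k m] _ /=; rewrite /G /H.
  have [->|m0] := eqVneq m midx0.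
    rewrite rho1_0 mulr1 big1 ?addr0// => i.
    by rewrite ffunE.
  by rewrite add0r -(rho1_sum m0) mulr_sumr mulr_suml.
rewrite big_split/= (sum_splits0r (F := G)); last by move=> k m /negPf; rewrite /G => ->.
rewrite (sum_splits_mpredr H) /G eqxx big_ord_recr/= mulrDr addrC dE; congr (_ + _).
rewrite -(rho1_sum p0) mulr_suml; apply: eq_bigr => i pi.
by rewrite IH//; apply: succn_inj; rewrite -mdeg_mpred.
Qed.

End rho.

Section monomials.
Context {R : realType}.
Implicit Types z : 'rV[R[i]]_n.

Lemma monomial_madd z k m : monomial z (madd k m) = monomial z k * monomial z m.
Proof.
rewrite /monomial -big_split; apply: eq_bigr => i _.
by rewrite ffunE exprD.
Qed.

Lemma monomialZ z (c : R[i]) p : monomial (c *: z) p = c ^+ mdeg p * monomial z p.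
Proof.
rewrite /monomial /mdeg -prodrXr -big_split; apply: eq_bigr => i _.
by rewrite mxE exprMn.
Qed.

End monomials.

End multi_indices.

(** * Real inner products *)

Section real_inner_product.
Context {R : realType} {E : normedModType R[i]}.
Implicit Types x y z : E.

(** Real part of the inner product, recovered from the norm by polarization, so that no sesquilinear
    form has to be carried along. *)
Definition rdot x y : R := (nrm (x + y) ^+ 2 - nrm (x - y) ^+ 2) / 4.

(** Real bilinearity suffices: the complex structure is recovered from the invariance of the norm
    under multiplication by ['i]. *)
Definition hilbertian := (forall x y z, rdot (x + y) z = rdot x z + rdot y z) /\
  (forall (a : R) x y, rdot (a%:C *: x) y = a * rdot x y).

Lemma rdotC x y : rdot x y = rdot y x.
Proof. by rewrite /rdot [x + y]addrC -[x - y]opprB nrmN. Qed.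

Lemma rdotNr x y : rdot x (- y) = - rdot x y.
Proof. by rewrite /rdot opprK; ring. Qed.

Lemma rdot0r x : rdot x 0 = 0.
Proof. by rewrite /rdot subr0 addr0 subrr mul0r. Qed.

Lemma nrm_real (a : R) x : nrm (a%:C *: x) = `|a| * nrm x.
Proof. by rewrite nrmZ normc_def /= expr0n /= addr0 sqrtr_sqr. Qed.

Lemma rdotxx x : rdot x x = nrm x ^+ 2.
Proof.
rewrite /rdot subrr nrm0 expr0n subr0 -mulr2n -scaler_nat.
have -> : (2%:R : R[i]) = (2%:R : R)%:C by rewrite rmorph_nat.
by rewrite nrm_real exprMn ger0_norm//; field.
Qed.

Lemma nrmi x : nrm ('i *: x) = nrm x.
Proof. by rewrite nrmZ normc_def /= expr0n expr1n /= add0r sqrtr1 mul1r. Qed.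

Lemma rdotii x y : rdot ('i *: x) ('i *: y) = rdot x y.
Proof. by rewrite /rdot -scalerBr -scalerDr !nrmi. Qed.

Lemma rdotiC x y : rdot ('i *: x) y = - rdot x ('i *: y).
Proof.
rewrite -rdotNr -[RHS]rdotii scalerN scalerA.
by rewrite -expr2 sqr_i scaleN1r opprK.
Qed.

Context (hE : hilbertian).

Lemma rdotDl x y z : rdot (x + y) z = rdot x z + rdot y z.
Proof. exact: hE.1. Qed.

Lemma rdotZl (a : R) x y : rdot (a%:C *: x) y = a * rdot x y.
Proof. exact: hE.2. Qed.

Lemma rdotDr x y z : rdot x (y + z) = rdot x y + rdot x z.
Proof. by rewrite rdotC rdotDl ![rdot _ x]rdotC. Qed.

Lemma rdotZr (a : R) x y : rdot x (a%:C *: y) = a * rdot x y.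
Proof. by rewrite rdotC rdotZl rdotC. Qed.

Lemma rdotNl x y : rdot (- x) y = - rdot x y.
Proof. by rewrite rdotC rdotNr rdotC. Qed.

Lemma rdotBl x y z : rdot (x - y) z = rdot x z - rdot y z.
Proof. by rewrite rdotDl rdotNl. Qed.

Lemma rdotBr x y z : rdot x (y - z) = rdot x y - rdot x z.
Proof. by rewrite rdotDr rdotNr. Qed.

Lemma rdot_suml (I : Type) (r : seq I) (P : pred I) (f : I -> E) y :
  rdot (\sum_(i <- r | P i) f i) y = \sum_(i <- r | P i) rdot (f i) y.
Proof.
elim/big_rec2 : _ => [|i y1 y2 _ <-]; first by rewrite rdotC rdot0r.
exact: rdotDl.
Qed.

(** This makes a map defined by a real adjoint identity complex linear. *)
Lemma rdot_conjc (c : R[i]) x y : rdot (c *: x) y = rdot x (conjc c *: y).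
Proof.
case: c => a b; have -> : a +i* b = a%:C + 'i * b%:C by simpc.
rewrite scalerDl -scalerA rdotDl rdotiC !rdotZl.
have -> : conjc (a%:C + 'i * b%:C) = a%:C - 'i * b%:C by simpc.
rewrite scalerBl rdotBr rdotZr; congr (_ - _).
by rewrite ['i * _]mulrC -scalerA rdotZr.
Qed.

Lemma nrmD_sq x y : nrm (x + y) ^+ 2 = nrm x ^+ 2 + 2 * rdot x y + nrm y ^+ 2.
Proof. by rewrite -rdotxx rdotDl !rdotDr (rdotC y x) !rdotxx; ring. Qed.

Lemma nrmB_sq x y : nrm (x - y) ^+ 2 = nrm x ^+ 2 - 2 * rdot x y + nrm y ^+ 2.
Proof. by rewrite nrmD_sq rdotNr nrmN; ring. Qed.

Lemma rdot_le x y : rdot x y <= nrm x * nrm y.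
Proof.
have [x0|x0] := eqVneq (nrm x) 0.
  by rewrite (nrm0_eq0 x0) nrm0 mul0r rdotC rdot0r.
have xp : 0 < nrm x by rewrite lt_neqAle eq_sym x0 nrm_ge0.
have := sqr_ge0 (nrm ((nrm y)%:C *: x - (nrm x)%:C *: y)).
rewrite nrmB_sq rdotZl rdotZr !nrm_real !ger0_norm ?nrm_ge0// => h.
have [y0|y0] := eqVneq (nrm y) 0.
  by rewrite (nrm0_eq0 y0) nrm0 mulr0 rdot0r.
have yp : 0 < nrm y by rewrite lt_neqAle eq_sym y0 nrm_ge0.
rewrite -(ler_pM2l xp) -(ler_pM2l yp); nra.
Qed.

Lemma rdot_norm_le x y : `|rdot x y| <= nrm x * nrm y.
Proof.
by rewrite ler_norml rdot_le andbT lerNl -rdotNr (le_trans (rdot_le _ _))// nrmN.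
Qed.

Lemma rdot_inj x y : (forall z, rdot x z = rdot y z) -> x = y.
Proof.
move=> h; apply/eqP; rewrite -subr_eq0; apply/eqP/nrm0_eq0/eqP.
by rewrite -sqrf_eq0 -rdotxx rdotBl h subrr.
Qed.

End real_inner_product.

Arguments hilbertian {R} E.

Lemma separable_hilbert_hilbertian (R : realType) (E : completeNormedModType R[i]) :
  separable_hilbert E -> hilbertian E.
Proof.
case=> -[dot dotE] _.
have dD (x y z : E) : dot (x + y) z = dot x z + dot y z by exact: linearDl.
have dDr (x y z : E) : dot x (y + z) = dot x y + dot x z by exact: linearDr.
have dN (x y : E) : dot (- x) y = - dot x y by exact: linearNl.
have dNr (x y : E) : dot x (- y) = - dot x y by exact: linearNr.
have rE (x y : E) : (rdot x y)%:C = (dot x y + dot y x) / 2.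
  rewrite /rdot rmorphM rmorphB !rmorphXn /= !nrmE -!dotE fmorphV rmorph_nat.
  by rewrite !dD !dDr !dN !dNr; field.
have rI (u v : R) : u%:C = v%:C -> u = v by case.
split=> [x y z|a x y]; apply: rI.
  by rewrite rmorphD /= !rE dD dDr; field.
rewrite rE; have -> : dot (a%:C *: x) y = a%:C * dot x y by exact: linearZl_LR.
have -> : dot y (a%:C *: x) = a%:C * dot y x.
  by rewrite linearZr_LR /= conj_Creal//; apply/complex_realP; exists a.
by rewrite -mulrDr -mulrA -rE -rmorphM.
Qed.

Section l2_inner_product.
Context {R : realType} {I : choiceType} {E : normedModType R[i]}.
Local Notation l2 := (l2 I E).
Implicit Types f g : l2.

Lemma l2_nrmE f : \esum_(k in [set: I]) (nrm (f k) ^+ 2)%:E = (nrm f ^+ 2)%:E.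
Proof. exact: sqsumE. Qed.

Lemma l2_nrm_cvg f :
  partial_sum (fun k => nrm (f k) ^+ 2) @ totally --> nrm f ^+ 2.
Proof. by apply: esum_cvg (l2_nrmE f) => k; exact: sqr_ge0. Qed.

Lemma l2_ex (a : I -> E) (M : R) :
  (\esum_(k in [set: I]) (nrm (a k) ^+ 2)%:E <= M%:E)%E ->
  exists2 f : l2, f =1 a & nrm f ^+ 2 <= M.
Proof.
move=> aM; have aP : a \in @l2_pred R I E.
  by rewrite inE; exact: le_lt_trans aM (ltry _).
by exists (L2 aP) => //; rewrite -lee_fin -l2_nrmE.
Qed.

Lemma l2DE f g k : (f + g) k = f k + g k. Proof. by []. Qed.
Lemma l2ZE c f k : (c *: f) k = c *: f k. Proof. by []. Qed.

Lemma l2P_ext f g : f =1 g -> f = g.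
Proof. by move=> h; apply/val_inj/funext. Qed.

Lemma nrm_l2_le f k : nrm (f k) <= nrm f.
Proof. exact: nrm_le_l2norm. Qed.

Lemma rdot_l2_cvg f g :
  partial_sum (fun k => rdot (f k) (g k)) @ totally --> rdot f g.
Proof.
have -> : partial_sum (fun k => rdot (f k) (g k)) = fun A =>
    (partial_sum (fun k => nrm ((f + g) k) ^+ 2) A -
     partial_sum (fun k => nrm ((f - g) k) ^+ 2) A) / 4.
  by apply/funext => A; rewrite !partial_sumE -sumrB mulr_suml.
by apply: cvgMl; apply: cvgB; exact: l2_nrm_cvg.
Qed.

Lemma rdot_l2_finite f g (A : {fset I}) : (forall k, k \notin A -> g k = 0) ->
  rdot f g = \sum_(k <- A) rdot (f k) (g k).
Proof.
move=> gA; apply: (psum_unique (a := (fun k => rdot (f k) (g k)))).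
  exact: rdot_l2_cvg.
by apply: psum_finite => k kA; rewrite gA// rdot0r.
Qed.

Lemma l2_hilbertian : hilbertian E -> hilbertian l2.
Proof.
move=> hE; split => [f g h|a f g].
  apply: (psum_unique (a := (fun k => rdot ((f + g) k) (h k)))).
    exact: rdot_l2_cvg.
  have -> : partial_sum (fun k => rdot ((f + g) k) (h k)) = fun A =>
      partial_sum (fun k => rdot (f k) (h k)) A +
      partial_sum (fun k => rdot (g k) (h k)) A.
    apply/funext => A; rewrite !partial_sumE -big_split; apply: eq_bigr => k _.
    by rewrite l2DE rdotDl.
  by apply: cvgD; exact: rdot_l2_cvg.
apply: (psum_unique (a := (fun k => rdot ((a%:C *: f) k) (g k)))).
  exact: rdot_l2_cvg.
have -> : partial_sum (fun k => rdot ((a%:C *: f) k) (g k)) = fun A =>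
    a * partial_sum (fun k => rdot (f k) (g k)) A.
  apply/funext => A; rewrite !partial_sumE mulr_sumr; apply: eq_bigr => k _.
  by rewrite l2ZE rdotZl.
by apply: cvgMr; exact: rdot_l2_cvg.
Qed.

Lemma single_ex (k : I) (x : E) :
  exists f : l2, (forall j, f j = if j == k then x else 0) /\ nrm f = nrm x.
Proof.
pose a j := if j == k then x else 0.
have ha : partial_sum (fun j => nrm (a j) ^+ 2) @ totally --> nrm x ^+ 2.
  have := @psum_finite I R (fun j => nrm (a j) ^+ 2) [fset k]%fset.
  rewrite big_seq_fset1 /a eqxx; apply => j; rewrite inE => /negPf ->.
  by rewrite nrm0 expr0n.
have {ha} := cvg_esum (fun j => sqr_ge0 _) ha.
move=> ha; have [|f fa _] := @l2_ex a (nrm x ^+ 2); first by rewrite ha.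
exists f; split; first exact: fa.
apply/eqP; rewrite -(eqrXn2 (n := 2)) ?nrm_ge0//; apply/eqP/EFin_inj.
by rewrite -l2_nrmE -ha; apply: eq_esum => j _; rewrite fa.
Qed.

Definition single k x : l2 := projT1 (cid (single_ex k x)).

Lemma singleE k x j : single k x j = if j == k then x else 0.
Proof. by rewrite /single; case: cid => f []. Qed.

Lemma nrm_single k x : nrm (single k x) = nrm x.
Proof. by rewrite /single; case: cid => f []. Qed.

Lemma rdot_single f k x : rdot f (single k x) = rdot (f k) x.
Proof.
rewrite (@rdot_l2_finite f (single k x) [fset k]%fset) => [|j].
  by rewrite big_seq_fset1 singleE eqxx.
by rewrite inE singleE => /negPf ->.
Qed.

Lemma single_lin k c x y : single k (c *: x + y) = c *: single k x + single k y.
Proof.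
apply: l2P_ext => j; rewrite l2DE l2ZE !singleE.
by case: ifP; rewrite ?scaler0 ?addr0.
Qed.

End l2_inner_product.

Section l2_finite.
Context {R : realType} {I : finType} {E : normedModType R[i]}.
Local Notation l2 := (l2 I E).

Lemma rdot_l2_fin (f g : l2) : rdot f g = \sum_k rdot (f k) (g k).
Proof.
have h k : k \in seq_fset tt (enum I) by rewrite seq_fsetE mem_enum.
rewrite (@rdot_l2_finite _ _ _ f g (seq_fset tt (enum I))); last first.
  by move=> k; rewrite h.
by rewrite sum_seq_fset ?enum_uniq// big_enum.
Qed.

Lemma nrm_l2_fin (f : l2) : nrm f ^+ 2 = \sum_k nrm (f k) ^+ 2.
Proof.
by rewrite -rdotxx rdot_l2_fin; apply: eq_bigr => k _; rewrite rdotxx.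
Qed.

Lemma l2_fin_ex (a : I -> E) : exists f : l2, f =1 a.
Proof.
have [|f fa _] := @l2_ex R I E a (\sum_k nrm (a k) ^+ 2); last by exists f.
have -> : \esum_(k in [set: I]) (nrm (a k) ^+ 2)%:E = (\sum_k nrm (a k) ^+ 2)%:E; last by [].
  apply: cvg_esum => [k|]; first exact: sqr_ge0.
  have h k : k \in seq_fset tt (enum I) by rewrite seq_fsetE mem_enum.
  have -> : \sum_k nrm (a k) ^+ 2 = \sum_(k <- seq_fset tt (enum I)) nrm (a k) ^+ 2.
    by rewrite sum_seq_fset ?enum_uniq// big_enum.
  by apply: psum_finite => k; rewrite h.
Qed.

End l2_finite.

(** * Riesz representation over the closure of a range *)

Section riesz.
Context {R : realType} {V : lmodType R[i]} {W : completeNormedModType R[i]}.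
Context (hW : hilbertian W).

(* The vector is the limit of [iota u] along a minimising family for the
   functional [|iota u|^2 / 2 - phi u]. *)
Lemma riesz (iota : V -> W) (phi : V -> R) (M : R) :
  (forall (a : R) u v, iota (a%:C *: u + v) = a%:C *: iota u + iota v) ->
  (forall (a : R) u v, phi (a%:C *: u + v) = a * phi u + phi v) ->
  0 <= M -> (forall u, phi u <= M * nrm (iota u)) ->
  exists w : W, [/\ (forall u, rdot w (iota u) = phi u), nrm w <= M &
    forall e : R, 0 < e -> exists u, nrm (w - iota u) <= e].
Proof.
move=> iL phiL M0 phiM.
pose Q u := nrm (iota u) ^+ 2 / 2 - phi u.
have Q_lb u : - (M ^+ 2 / 2) <= Q u.
  rewrite /Q; have := phiM u; have := sqr_ge0 (nrm (iota u) - M); nra.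
pose A := [set Q u | u in [set: V]].
have infA : has_inf A.
  by split; [exists (Q 0), 0|exists (- (M ^+ 2 / 2)) => _ [u _ <-]].
pose s := inf A.
have sQ u : s <= Q u by apply: ge_inf; [exact: infA.2|exists u].
have Qs e : 0 < e -> exists u, Q u < s + e.
  by move=> e0; have [_ [u _ <-] hu] := inf_adherent e0 infA; exists u.
have iD u v : iota (u + v) = iota u + iota v.
  by have := iL 1 u v; rewrite rmorph1 !scale1r.
have pD u v : phi (u + v) = phi u + phi v.
  by have := phiL 1 u v; rewrite rmorph1 scale1r mul1r.
have i0 : iota 0 = 0 by apply: (addrI (iota 0)); rewrite -iD !addr0.
have p0 : phi 0 = 0 by apply: (addrI (phi 0)); rewrite -pD !addr0.
have iZ (a : R) u : iota (a%:C *: u) = a%:C *: iota u.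
  by have := iL a u 0; rewrite i0 !addr0.
have pZ (a : R) u : phi (a%:C *: u) = a * phi u.
  by have := phiL a u 0; rewrite p0 !addr0.
have Qadd u v (t : R) : Q (u + t%:C *: v) = Q u + t * (rdot (iota u) (iota v) - phi v)
    + t ^+ 2 * nrm (iota v) ^+ 2 / 2.
  rewrite /Q iD iZ pD pZ nrmD_sq// rdotZr// nrm_real exprMn.
  by rewrite real_normK ?num_real//; field.
(* The midpoint of [u] and [v] cannot fall below [s], so by the parallelogram law near-minimisers
   have close images. *)
have Qclose u v e : Q u < s + e -> Q v < s + e -> nrm (iota u - iota v) ^+ 2 <= 8 * e.
  move=> hu hv; have := sQ (u + (1 / 2)%:C *: (v + (-1)%:C *: u)).
  rewrite Qadd; have := Qadd u (v + (-1)%:C *: u) 1; rewrite rmorph1 scale1r.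
  have -> : u + (v + (-1)%:C *: u) = v.
    by rewrite addrCA rmorphN rmorph1 scaleN1r subrr addr0.
  have -> : nrm (iota u - iota v) = nrm (iota (v + (-1)%:C *: u)).
    by rewrite iD iZ rmorphN rmorph1 scaleN1r -nrmN opprB.
  by nra.
pose F := filter_from [set e : R | 0 < e] (fun e => iota @` [set u | Q u < s + e]).
have FF : ProperFilter F.
  apply: filter_from_proper; last first.
    by move=> e e0; have [u hu] := Qs e e0; exists (iota u), u.
  apply: filter_from_filter; first by exists 1 => /=.
  move=> e d e0 d0; exists (Num.min e d); first by rewrite /= lt_min e0 d0.
  by move=> _ [u hu <-]; split; exists u => //;
    apply: lt_le_trans hu _; rewrite lerD2l ge_min lexx ?orbT.
have Fcvg : cvg F.
  apply: cauchy_cvg; apply: cauchy_exP => _ /ltc0_real[e e0 ->].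
  pose d := e ^+ 2 / 16; have d0 : 0 < d by rewrite divr_gt0// exprn_gt0.
  have [u hu] := Qs d d0; exists (iota u), d => // _ [v hv <-].
  rewrite -ball_normE /= nrm_lt -(ltr_pXn2r (n := 2)) ?nnegrE ?nrm_ge0 ?(ltW e0)//.
  apply: le_lt_trans (Qclose _ _ _ hu hv) _.
  by have := exprn_gt0 2 e0; rewrite /d; lra.
pose w := lim F.
have wclose e : 0 < e -> exists u, nrm (w - iota u) <= e /\ Q u < s + e.
  move=> e0.
  have : F [set y | nrm (w - y) <= e].
    have /(@cvgrPdist_le _ _ _ F _ id w)/(_ e%:C) : F --> w by exact: Fcvg.
    rewrite ltcR => /(_ e0); apply: filterS => y; by rewrite -nrmE lecR.
  have : F (iota @` [set u | Q u < s + e]) by exists e.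
  move=> h1 h2; have [y [/= wy [u hu uy]]] := @filter_ex _ _ FF _ (@filterI _ _ _ _ _ h2 h1).
  by exists u; split => //; rewrite uy.
exists w.
have wphi v : rdot w (iota v) = phi v.
  pose N := nrm (iota v); pose D := rdot w (iota v) - phi v.
  have N0 : 0 <= N by exact: nrm_ge0.
  (* First variation at [w]: compare [s] with [Q (u + t v)] for near-minimisers [u] whose images
     approach [w]. *)
  have key t : 0 <= t * D + t ^+ 2 * N ^+ 2 / 2.
    apply/ler_addgt0Pr => e e0.
    have B0 : 0 < 1 + `|t| * N by rewrite ltr_pwDl// mulr_ge0.
    pose d := e / (1 + `|t| * N); have d0 : 0 < d by rewrite divr_gt0.
    have [u [wu hu]] := wclose d d0.
    have := sQ (u + t%:C *: v); rewrite Qadd.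
    have -> : rdot (iota u) (iota v) - phi v = D - rdot (w - iota u) (iota v).
      by rewrite rdotBl// /D; ring.
    have h1 : `|t * rdot (w - iota u) (iota v)| <= `|t| * N * d.
      rewrite normrM -mulrA ler_wpM2l// (le_trans (rdot_norm_le hW _ _))//.
      by rewrite mulrC ler_wpM2l.
    have h2 : d + `|t| * N * d = e by rewrite /d; field; rewrite gt_eqF.
    move: h1; rewrite ler_norml => /andP[h1 h3]; rewrite -/N; nra.
  suff D0 : D = 0 by apply/eqP; rewrite -subr_eq0; apply/eqP.
  (* The quadratic in [t] is least at [- D / N^2]; the added 1 spares the case [N = 0] and still
     gives a negative value unless [D = 0]. *)
  have h1 := key (- (D / (1 + N ^+ 2))).
  have B0 : 0 < 1 + N ^+ 2 by rewrite ltr_pwDl// sqr_ge0.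
  move: h1; have -> : - (D / (1 + N ^+ 2)) * D +
      (- (D / (1 + N ^+ 2))) ^+ 2 * N ^+ 2 / 2 =
      - (D ^+ 2 * (2 + N ^+ 2)) / (2 * (1 + N ^+ 2) ^+ 2).
    by field; rewrite gt_eqF.
  rewrite pmulr_lge0 ?invr_gt0 ?mulr_gt0 ?exprn_gt0// oppr_ge0.
  rewrite pmulr_lle0; last by have := sqr_ge0 N; lra.
  by move=> h; apply/eqP; rewrite -sqrf_eq0 eq_le h sqr_ge0.
split => //; last first.
  by move=> e /wclose[u [wu _]]; exists u.
(* As [w] is a limit of vectors [iota u], the bound on [phi] passes to [rdot w w]. *)
have key : nrm w ^+ 2 <= M * nrm w.
  apply/ler_addgt0Pr => e e0.
  have B0 : 0 < nrm w + M + 1 by rewrite ltr_wpDl// addr_ge0// nrm_ge0.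
  have [u [wu _]] := wclose (e / (nrm w + M + 1)) (divr_gt0 e0 B0).
  set d := _ / _ in wu; have de : d * (nrm w + M + 1) = e by rewrite divfK ?gt_eqF.
  have -> : nrm w ^+ 2 = rdot w (w - iota u) + rdot w (iota u).
    by rewrite rdotBr// subrK rdotxx.
  rewrite wphi; have h1 := rdot_le hW w (w - iota u); have h2 := phiM u.
  have h3 : nrm (iota u) <= nrm w + d.
    have -> : iota u = w - (w - iota u) by rewrite opprB addrC subrK.
    by apply: le_trans (nrmD _ _) _; rewrite nrmN lerD2l.
  have h4 : nrm w * nrm (w - iota u) <= nrm w * d by rewrite ler_wpM2l ?nrm_ge0.
  have h5 : M * nrm (iota u) <= M * (nrm w + d) by rewrite ler_wpM2l.
  have d0 : 0 <= d by apply: le_trans wu; exact: nrm_ge0.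
  by rewrite -de; nra.
have [w0|w0] := eqVneq (nrm w) 0; first by rewrite w0.
by rewrite -(ler_pM2r (_ : 0 < nrm w)) -?expr2// lt_neqAle eq_sym w0 nrm_ge0.
Qed.

(** A vector both orthogonal to the range and in its closure is orthogonal to itself. This pins down
    the representative given by [riesz], and hence makes it linear in the functional. *)
Lemma riesz_unique (iota : V -> W) w :
  (forall u, rdot w (iota u) = 0) ->
  (forall e : R, 0 < e -> exists u, nrm (w - iota u) <= e) -> w = 0.
Proof.
move=> wi wc; apply: nrm0_eq0; apply/eqP; rewrite -sqrf_eq0 eq_le sqr_ge0 andbT.
apply/ler_addgt0Pr => e e0; rewrite add0r.
have B0 : 0 < nrm w + 1 by rewrite ltr_wpDl// nrm_ge0.
have [u wu] := wc (e / (nrm w + 1)) (divr_gt0 e0 B0).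
have -> : nrm w ^+ 2 = rdot w (w - iota u) by rewrite rdotBr// wi subr0 rdotxx.
apply: le_trans (rdot_le hW _ _) _.
apply: le_trans (ler_wpM2l (nrm_ge0 w) wu) _.
rewrite mulrA ler_pdivrMr// mulrDr mulr1 mulrC lerDl; exact: ltW.
Qed.

End riesz.

(** * Power series on the ball *)

Section modulus.
Context {R : realType}.
Implicit Types c d : R[i].

Definition cabs c : R := complex.Re `|c|.

Lemma cabsE c : (cabs c)%:C = `|c|.
Proof. by rewrite /cabs normc_def. Qed.

Lemma cabs_ge0 c : 0 <= cabs c.
Proof. exact: Re_norm_ge0. Qed.

Lemma complexRI (u v : R) : u%:C = v%:C -> u = v.
Proof. by case. Qed.

Lemma cabsM c d : cabs (c * d) = cabs c * cabs d.
Proof. by apply: complexRI; rewrite rmorphM /= !cabsE normrM. Qed.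

Lemma cabs1 : cabs 1 = 1.
Proof. by apply: complexRI; rewrite cabsE normr1. Qed.

Lemma cabsX c k : cabs (c ^+ k) = cabs c ^+ k.
Proof. by elim: k => [|k IH]; rewrite ?cabs1// !exprS cabsM IH. Qed.

Lemma cabs_real (a : R) : cabs a%:C = `|a|.
Proof. by rewrite /cabs normc_def /= expr0n /= addr0 sqrtr_sqr. Qed.

Lemma nrmZc {E : normedModType R[i]} c (x : E) : nrm (c *: x) = cabs c * nrm x.
Proof. exact: nrmZ. Qed.

End modulus.

Section monomial_sums.
Context {R : realType} {n : nat}.
Local Notation mi := (multi_index n).
Implicit Types (z : 'rV[R[i]]_n) (k : mi).

Definition rmon (x : 'I_n -> R) (k : mi) : R := \prod_(i < n) x i ^+ k i.

Lemma rmon_ge0 x k : (forall i, 0 <= x i) -> 0 <= rmon x k.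
Proof. by move=> x0; apply: prodr_ge0 => i _; exact: exprn_ge0. Qed.

Lemma cabs_monomial z k : cabs (monomial z k) = rmon (fun i => cabs (z 0 i)) k.
Proof.
rewrite /monomial /rmon (big_morph _ (@cabsM R) (@cabs1 R)).
by apply: eq_bigr => i _; rewrite cabsX.
Qed.

Lemma unit_ballE z : unit_ball z <-> \sum_(i < n) cabs (z 0 i) ^+ 2 < 1.
Proof.
rewrite /unit_ball /=.
have -> : \sum_(i < n) `|z 0 i| ^+ 2 = (\sum_(i < n) cabs (z 0 i) ^+ 2)%:C.
  by rewrite rmorph_sum; apply: eq_bigr => i _; rewrite rmorphXn /= cabsE.
have -> : (1 : R[i]) = 1%:C by rewrite rmorph1.
by rewrite ltcR.
Qed.

Lemma rmonX x k j : rmon x k ^+ j = rmon (fun i => x i ^+ j) k.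
Proof. by rewrite /rmon -prodrXl; apply: eq_bigr => i _; rewrite exprAC. Qed.

Lemma rmonZ (c : R) x k : rmon (fun i => c * x i) k = c ^+ mdeg k * rmon x k.
Proof.
rewrite /rmon /mdeg -prodrXr -big_split; apply: eq_bigr => i _.
by rewrite exprMn.
Qed.

Lemma rmon_mpred x i k : (0 < k i)%N -> rmon x k = x i * rmon x (mpred i k).
Proof.
move=> ki; rewrite /rmon (bigD1 i)//= [in RHS](bigD1 i)//= mulrA; congr (_ * _).
  by rewrite ffunE eqxx -exprS subn1 prednK.
by apply: eq_bigr => j /negPf ji; rewrite ffunE ji subn0.
Qed.

(** The multinomial theorem, by induction on the degree with Pascal's rule. *)
Lemma sum_rho1_lvl x d : \sum_(k <- lvl d) rho1 R k * rmon x k = (\sum_i x i) ^+ d.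
Proof.
elim: d => [|d IH].
  have h : perm_eq (lvl 0) [:: midx0 : mi].
    by apply: uniq_perm => // [|k]; rewrite ?lvl_uniq// mem_lvl mdeg_eq0 inE.
  rewrite (perm_big _ h) big_seq1 rho1_0 mul1r /rmon big1// => i _.
  by rewrite ffunE.
rewrite exprSr -IH mulr_suml.
under [RHS]eq_bigr do rewrite mulr_sumr.
rewrite -(sum_lvl_succ (fun i k => rho1 R k * rmon x k * x i)).
apply: eq_big_seq => k; rewrite mem_lvl => /eqP kd.
rewrite -rho1_sum -?mdeg_eq0 ?kd// mulr_suml; apply: eq_bigr => i ki.
by rewrite -mulrA (rmon_mpred _ ki) [x i * _]mulrC.
Qed.

Fixpoint lvls (N : nat) : seq mi := if N is M.+1 then lvls M ++ lvl M else [::].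

Lemma mem_lvls N k : (k \in lvls N) = (mdeg k < N)%N.
Proof.
elim: N => [//|N IH]; rewrite /= mem_cat IH mem_lvl.
by rewrite [RHS]ltnS [RHS]leq_eqVlt orbC.
Qed.

Lemma lvls_uniq N : uniq (lvls N).
Proof.
elim: N => [//|N IH] /=; rewrite cat_uniq IH lvl_uniq andbT /=.
by apply/hasPn => k; rewrite mem_lvl mem_lvls => /eqP ->; rewrite ltnn.
Qed.

Lemma sum_lvls (V : nmodType) (F : mi -> V) N :
  \sum_(k <- lvls N) F k = \sum_(d < N) \sum_(k <- lvl d) F k.
Proof.
by elim: N => [|N IH]; rewrite ?big_nil ?big_ord0// big_cat big_ord_recr/= IH.
Qed.

Lemma esum_lvls_le (F : mi -> R) (M : \bar R) : (forall k, 0 <= F k) ->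
  (forall N, ((\sum_(d < N) \sum_(k <- lvl d) F k)%:E <= M)%E) ->
  (\esum_(k in [set: mi]) (F k)%:E <= M)%E.
Proof.
move=> F0 FM; apply: esum_leP => A.
apply: le_trans (FM (\max_(k <- A) (mdeg k).+1)%N); rewrite lee_fin -sum_lvls.
set N := (\max_(k <- A) _)%N.
rewrite -(sum_seq_fset _ (lvls_uniq N)).
apply: fset_sum_ler => //; apply/fsubsetP => k kA; rewrite seq_fsetE mem_lvls.
by rewrite /N (bigD1_seq k)//= leq_max leqnn.
Qed.

Lemma lvls_le_esum (F : mi -> R) N :
  ((\sum_(d < N) \sum_(k <- lvl d) F k)%:E <= \esum_(k in [set: mi]) (F k)%:E)%E.
Proof.
rewrite -sum_lvls.
rewrite -(sum_seq_fset _ (lvls_uniq N)).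
exact: fset_le_esum.
Qed.

Lemma geo_sum_le (s : R) N : 0 <= s < 1 -> \sum_(d < N) s ^+ d <= (1 - s)^-1.
Proof.
move=> /andP[s0 s1]; have h : 0 < 1 - s by rewrite subr_gt0.
rewrite -(ler_pM2l h) divff ?gt_eqF//.
have := subrXX 1 s N; rewrite expr1n => e.
have -> : (1 - s) * \sum_(d < N) s ^+ d = 1 - s ^+ N.
  rewrite e; congr (_ * _); apply: eq_bigr => i _; by rewrite expr1n mul1r.
by rewrite gerBl exprn_ge0.
Qed.

Lemma esum_rho1 (x : 'I_n -> R) : (forall i, 0 <= x i) -> \sum_i x i < 1 ->
  (\esum_(k in [set: mi]) (rho1 R k * rmon x k)%:E <= ((1 - \sum_i x i)^-1)%:E)%E.
Proof.
move=> x0 x1; apply: esum_lvls_le => [k|N].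
  by rewrite mulr_ge0 ?rmon_ge0 ?ltW ?rho1_gt0.
rewrite lee_fin; under eq_bigr do rewrite sum_rho1_lvl.
by apply: geo_sum_le; rewrite x1 sumr_ge0.
Qed.

(** A finite set of multi-indices lies in a box, over which the sum factors into [n] geometric
    sums. *)
Lemma esum_geo (s : R) : 0 <= s < 1 ->
  (\esum_(k in [set: mi]) (s ^+ mdeg k)%:E <= ((1 - s)^-1 ^+ n)%:E)%E.
Proof.
move=> s01; have /andP[s0 s1] := s01; apply: esum_leP => A; rewrite lee_fin.
pose N := (\max_(k <- A) (mdeg k).+1)%N.
apply: (@le_trans _ _ (\sum_(k <- @box n N) s ^+ mdeg k)).
  rewrite -(sum_seq_fset _ (box_uniq N)).
  apply: fset_sum_ler => [k|]; first exact: exprn_ge0.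
  apply/fsubsetP => k kA; rewrite seq_fsetE mem_box; apply/forallP => i.
  apply: leq_ltn_trans (leq_mdeg k i) _.
  by rewrite /N (bigD1_seq k)//= leq_max leqnn.
rewrite /box big_image/=.
have -> : \sum_(f : {ffun 'I_n -> 'I_N}) s ^+ mdeg ([ffun i => nat_of_ord (f i)] : mi)
    = \prod_(i < n) \sum_(d < N) s ^+ d.
  rewrite bigA_distr_bigA/=; apply: eq_bigr => f _.
  by rewrite /mdeg -prodrXr; apply: eq_bigr => i _; rewrite ffunE.
rewrite prodr_const card_ord lerXn2r ?nnegrE ?geo_sum_le//.
  by apply: sumr_ge0 => d _; exact: exprn_ge0.
by rewrite invr_ge0 subr_ge0 ltW.
Qed.

End monomial_sums.

Section power_series.
Context {R : realType} {n : nat}.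
Local Notation mi := (multi_index n).
Implicit Types (z : 'rV[R[i]]_n) (k : mi).

Definition abs_ps (E : normedModType R[i]) (a : mi -> E) : Prop :=
  forall z, unit_ball z ->
    (\esum_(k in [set: mi]) (nrm (monomial z k *: a k))%:E < +oo)%E.

Lemma unit_ballZ z : unit_ball z -> exists2 s : R, 0 < s < 1 &
  unit_ball (s^-1%:C *: z) /\ \sum_i cabs (z 0 i) ^+ 2 < s ^+ 4.
Proof.
move=> /unit_ballE; set t := \sum_i _ => t1.
have t0 : 0 <= t by apply: sumr_ge0 => i _; exact: sqr_ge0.
(* By Bernoulli's inequality [s^4 >= 1 - (1 - t)/2 = (1 + t)/2 > t]. The fourth power is what
   [subexponential_abs] consumes. *)
pose s := 1 - (1 - t) / 8; have s0 : 0 < s by rewrite /s; lra.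
have s1 : s < 1 by rewrite /s; lra.
have ts : t < s ^+ 4.
  have h1 : 1 - (1 - t) / 4 <= s ^+ 2.
    by have := sqr_ge0 ((1 - t) / 8); rewrite /s; nra.
  have h2 : (1 - (1 - t) / 4) ^+ 2 <= s ^+ 4.
    by rewrite (exprM s 2 2) lerXn2r// nnegrE ?sqr_ge0//; lra.
  by apply: lt_le_trans h2; have := sqr_ge0 ((1 - t) / 4); nra.
exists s; first by rewrite s0 s1.
split; last exact: ts.
apply/unit_ballE.
under eq_bigr do rewrite mxE cabsM exprMn cabs_real real_normK ?num_real//.
rewrite -mulr_sumr -/t exprVn mulrC ltr_pdivrMr ?exprn_gt0// mul1r.
apply: lt_le_trans ts _; rewrite (exprD s 2 2) ler_piMl ?exprn_ge0 ?(ltW s0)//.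
by rewrite exprn_ile1 ?ltW.
Qed.

Section existence.
Context {E : normedModType R[i]}.
Implicit Type a : mi -> E.

(** The scale [sqrt (rho1 k)] fits the ball: by the multinomial theorem
    [sqrt (rho1 k) |z^k| <= |z|^|k|]. *)
Definition subexponential a : Prop := forall r : R, 0 < r < 1 ->
  exists C : R, forall k, nrm (a k) * r ^+ mdeg k <= C * Num.sqrt (rho1 R k).

(** With [w^2 = rho1 k], [m = |z^k|] and [q = r^|k|], the term is at most [C w m / q], a product of
    [w m / q^2] and [q] up to [C]. It is dominated by the sum of their squares: a multinomial series
    in [|z_i|^2 / r^4] and a geometric one in [r^2]. *)
Lemma subexponential_abs a : subexponential a -> abs_ps a.
Proof.
move=> ga z zb; have [r /[dup] r01 /andP[r0 r1] [_ zr]] := unit_ballZ zb.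
have [C hC] := ga r r01.
have C0 : 0 <= C.
  have := hC midx0; rewrite rho1_0 sqrtr1 mulr1 mdeg0 expr0 mulr1.
  by apply: le_trans; exact: nrm_ge0.
pose x i := cabs (z 0 i) ^+ 2 / r ^+ 4.
have x0 i : 0 <= x i by rewrite divr_ge0 ?sqr_ge0// exprn_ge0 ?ltW.
have x1 : \sum_i x i < 1.
  by rewrite -mulr_suml ltr_pdivrMr ?exprn_gt0// mul1r.
have r2 : 0 <= r ^+ 2 < 1 by rewrite exprn_ge0 ?(ltW r0)//= exprn_ilt1 ?ltW.
have h1 := esum_rho1 x0 x1; have h2 := @esum_geo R n _ r2.
set S := (1 - _)^-1 in h1; set S' := (_ ^+ n) in h2.
apply: le_lt_trans (ltry (C * S + C * S')).
apply: (@le_trans _ _ (\esum_(k in [set: mi])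
    (C * (rho1 R k * rmon x k) + C * ((r ^+ 2) ^+ mdeg k))%:E)).
  apply: le_esum => k _; rewrite lee_fin nrmZc cabs_monomial.
  set m := rmon _ k; have m0 : 0 <= m by apply: rmon_ge0 => i; exact: cabs_ge0.
  set d := mdeg k; have q0 : 0 < r ^+ d by rewrite exprn_gt0.
  have -> : rmon x k = m ^+ 2 / (r ^+ d) ^+ 4.
    rewrite rmonX /x; under [LHS]eq_bigr do rewrite mulrC.
    by rewrite -/(rmon (fun i => (r ^+ 4)^-1 * cabs (z 0 i) ^+ 2) k) rmonZ mulrC
      exprVn -!exprM mulnC.
  have -> : (r ^+ 2) ^+ d = (r ^+ d) ^+ 2 by rewrite -!exprM mulnC.
  have := hC k; rewrite -/d; set q := r ^+ d in q0 *.
  have rho0 : 0 <= rho1 R k by rewrite ltW ?rho1_gt0.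
  rewrite -[X in _ -> _ <= C * (X * _) + _](sqr_sqrtr rho0).
  set w := Num.sqrt _ => h.
  have h3 : nrm (a k) <= C * w / q by rewrite ler_pdivlMr.
  apply: le_trans (ler_wpM2l m0 h3) _.
  have -> : m * (C * w / q) = C * ((w * m / q ^+ 2) * q) by field; rewrite gt_eqF.
  have -> : C * (w ^+ 2 * (m ^+ 2 / q ^+ 4)) + C * q ^+ 2 =
      C * ((w * m / q ^+ 2) ^+ 2 + q ^+ 2) by field; rewrite gt_eqF.
  apply: ler_wpM2l => //; set u := w * m / q ^+ 2.
  have := sqr_ge0 (u - q); have := sqr_ge0 u; have := sqr_ge0 q; nra.
under eq_esum do rewrite EFinD.
rewrite esumD; last 2 first.
- move=> k _; rewrite lee_fin; apply: mulr_ge0 => //; apply: mulr_ge0.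
    exact: ltW (rho1_gt0 _).
  exact: rmon_ge0.
- by move=> k _; rewrite lee_fin mulr_ge0// !exprn_ge0// ltW.
rewrite EFinD; apply: leeD; apply: esum_leP => A; rewrite lee_fin -mulr_sumr ler_wpM2l//.
  by rewrite -lee_fin; apply: le_trans h1; exact: fset_le_esum.
by rewrite -lee_fin; apply: le_trans h2; exact: fset_le_esum.
Qed.

Lemma sqsum_subexponential a :
  (\esum_(k in [set: mi]) (nrm (a k) ^+ 2 / rho1 R k)%:E < +oo)%E ->
  subexponential a.
Proof.
move=> /esum_fin_cvg[k|M M0 aM r /andP[r0 r1]].
  by rewrite divr_ge0 ?sqr_ge0// ltW ?rho1_gt0.
exists (Num.sqrt M) => k.
have rho0 := @rho1_gt0 n R k.
have h : nrm (a k) ^+ 2 <= M * rho1 R k.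
  rewrite -ler_pdivrMr// -lee_fin -aM.
  have := fset_le_esum (fun k => nrm (a k) ^+ 2 / rho1 R k) [fset k]%fset.
  by rewrite big_seq_fset1.
have -> : Num.sqrt M * Num.sqrt (rho1 R k) = Num.sqrt (M * rho1 R k).
  by rewrite (sqrtrM (rho1 R k) M0).
apply: (@le_trans _ _ (nrm (a k))).
  by rewrite ler_piMr ?nrm_ge0// exprn_ile1 ?ltW.
by rewrite -(ger0_norm (nrm_ge0 (a k))) -sqrtr_sqr ler_wsqrtr.
Qed.

(** Abel's argument: convergence at the dilated point [z / r] bounds the terms there, and returning
    to [z] gains the summable factor [r^|k|]. *)
Lemma has_power_series_abs (f : 'rV[R[i]]_n -> E) a :
  has_power_series f a -> abs_ps a.
Proof.
move=> fa z zb; have [r /[dup] r01 /andP[r0 r1] [zr _]] := unit_ballZ zb.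
have /cvg_nrmP/(_ 1 ltr01)[A _ hA] := fa _ zr.
set z' := r^-1%:C *: z in zr hA; pose t k := monomial z' k *: a k.
(* A term outside [A] is the difference of two partial sums within 1 of the limit, hence the 2; the
   sum covers the terms inside [A]. *)
pose M := 2 + \sum_(k <- A) nrm (t k).
have tM k : nrm (t k) <= M.
  have [kA|kA] := boolP (k \in A).
    rewrite /M (big_fsetD1 k)//= addrCA lerDl addr_ge0// sumr_ge0// => j _.
    exact: nrm_ge0.
  have h1 := hA A (fsubset_refl A); have h2 := hA (k |` A)%fset (fsubsetU1 k A).
  rewrite !partial_sumE in h1 h2; rewrite big_fsetU1//= in h2.
  set s := \sum_(i <- A) _ in h1 h2.
  have -> : t k = (f z' - s) - (f z' - (t k + s)) by rewrite opprB addrC addrA subrK addrK.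
  apply: le_trans (nrmD _ _) _; rewrite nrmN /M.
  have : 0 <= \sum_(k <- A) nrm (t k) by apply: sumr_ge0 => j _; exact: nrm_ge0.
  rewrite -/(t k) in h2; lra.
have h2 := @esum_geo R n r ltac:(by rewrite ltW//= r1).
apply: le_lt_trans (ltry (M * (1 - r)^-1 ^+ n)).
apply: esum_leP => B; rewrite lee_fin.
apply: (@le_trans _ _ (\sum_(k <- B) M * r ^+ mdeg k)).
  apply: ler_sum => k _.
  have -> : monomial z k *: a k = (r ^+ mdeg k)%:C *: t k.
    rewrite /t /z' monomialZ scalerA mulrA -rmorphXn -rmorphM /=.
    by rewrite exprVn divff ?expf_neq0 ?gt_eqF// mul1r.
  have rd0 : 0 <= r ^+ mdeg k by rewrite exprn_ge0 ?(ltW r0).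
  by rewrite nrm_real ger0_norm// mulrC ler_wpM2r.
rewrite -mulr_sumr ler_wpM2l//; last by rewrite -lee_fin (le_trans _ h2)// fset_le_esum.
by apply: le_trans (tM midx0); exact: nrm_ge0.
Qed.

End existence.

Lemma abs_has_power_series (E : completeNormedModType R[i]) (a : mi -> E) :
  abs_ps a -> exists f, has_power_series f a.
Proof.
move=> ha; have H (z : 'rV[R[i]]_n) : exists y : E, unit_ball z ->
    partial_sum (fun k => monomial z k *: a k) @ totally --> y.
  have [zb|zb] := pselect (unit_ball z); last by exists 0.
  by have /cvg_ex[y hy] := psum_abs_cvg (ha z zb); exists y.
by exists (fun z => projT1 (cid (H z))) => z; case: cid.
Qed.

Lemma abs_has_power_series_op (E : normedModType R[i])
    (F : completeNormedModType R[i]) (a : mi -> bounded_op E F) :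
  abs_ps a -> exists f, has_power_series f a.
Proof.
move=> ha; have H (z : 'rV[R[i]]_n) : exists y : bounded_op E F, unit_ball z ->
    partial_sum (fun k => monomial z k *: a k) @ totally --> y.
  have [zb|zb] := pselect (unit_ball z); last by exists 0.
  by have [y hy] := op_series_cvg (ha z zb); exists y.
by exists (fun z => projT1 (cid (H z))) => z; case: cid.
Qed.

Definition mconv (E F : normedModType R[i]) (A : mi -> bounded_op E F)
  (a : mi -> E) p : F := \sum_(km <- splits p) A km.1 (a km.2).

Lemma has_power_series_mul (E : normedModType R[i])
    (F : completeNormedModType R[i]) (Phi : 'rV[R[i]]_n -> bounded_op E F) A f a :
  has_power_series Phi A -> has_power_series f a ->
  has_power_series (fun z => Phi z (f z)) (mconv A a).
Proof.
move=> PA fa z zb.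
have := op_series_mul (has_power_series_abs PA zb) (has_power_series_abs fa zb)
  (PA z zb) (fa z zb).
move=> /(psum_regroup (pi := fun km : mi * mi => madd km.1 km.2) (F := @splits n)).
move=> /(_ (@splits_uniq n)) H.
have {}H := H (fun i j => mem_splits j i).
suff -> : (fun p => monomial z p *: mconv A a p) = fun p =>
    \sum_(km <- splits p) (monomial z km.1 *: A km.1) (monomial z km.2 *: a km.2).
  exact: H.
apply/funext => p.
rewrite /mconv scaler_sumr; apply: eq_big_seq => km.
rewrite mem_splits => /eqP <-.
by rewrite monomial_madd bounded_opZE opZ scalerA.
Qed.

Lemma has_power_series_app (E F : normedModType R[i])
    (T : 'rV[R[i]]_n -> bounded_op E F) A x :
  has_power_series T A -> has_power_series (fun z => T z x) (fun p => A p x).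
Proof.
move=> TA z zb; have /cvg_nrmP H := TA z zb; apply/cvg_nrmP => e e0.
have B0 : 0 < nrm x + 1 by rewrite ltr_wpDl// nrm_ge0.
apply: filterS (H _ (divr_gt0 e0 B0)) => B; rewrite ler_pdivlMr// => h.
have -> : partial_sum (fun p => monomial z p *: A p x) B =
    partial_sum (fun p => monomial z p *: A p) B x.
  by rewrite !partial_sumE sum_opE.
apply: le_trans (nrm_op (T z - partial_sum (fun p => monomial z p *: A p) B) x) _.
by apply: le_trans h; rewrite ler_wpM2l ?nrm_ge0// lerDl.
Qed.

End power_series.

(** * Uniqueness of power series coefficients *)

Lemma digits_lt N m (f : nat -> nat) : (forall i, f i < N)%N ->
  (\sum_(i < m) f i * N ^ i < N ^ m)%N.
Proof.
move=> fN; elim: m => [|m IH]; first by rewrite big_ord0.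
rewrite big_ord_recr/= expnS.
apply: (@leq_trans (N ^ m + f m * N ^ m)); first by rewrite ltn_add2r.
by rewrite -mulSn leq_mul2r fN orbT.
Qed.

Lemma digits_inj N m (f g : nat -> nat) :
  (forall i, f i < N)%N -> (forall i, g i < N)%N ->
  (\sum_(i < m) f i * N ^ i = \sum_(i < m) g i * N ^ i)%N ->
  forall i, (i < m)%N -> f i = g i.
Proof.
move=> fN gN; elim: m => [//|m IH]; rewrite !big_ord_recr/= => h.
have hf := digits_lt m fN; have hg := digits_lt m gN.
have fg : f m = g m.
  have := congr1 (fun x => x %/ N ^ m)%N h.
  have N0 : (0 < N ^ m)%N by exact: leq_ltn_trans hf.
  by rewrite /= ![(_ + _ * _)%N]addnC !divnMDl// !divn_small// !addn0.
move=> i; rewrite ltnS leq_eqVlt => /predU1P[->//|]; apply: IH.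
by move: h; rewrite fg => /addIn.
Qed.

Section uniqueness.
Context {R : realType} {n : nat}.
Local Notation mi := (multi_index n).
Implicit Types (k p : mi).

Definition weight (M : 'I_n -> nat) k : nat := (\sum_(i < n) k i * M i)%N.

(* For [a k != 0] of minimal degree [d], weights [N^n + N^i] with [N = d.+1] make
   comparison of weighted degrees lexicographic below degree [N]. *)
Lemma separating_weight (P : mi -> Prop) : (exists k, P k) ->
  exists M : 'I_n -> nat, (forall i, 0 < M i)%N /\
  exists k, P k /\ forall p, P p -> p != k -> (weight M k < weight M p)%N.
Proof.
move=> exP.
have [d [[k0 [Pk0 k0d]] dmin]] : exists d, (exists k, P k /\ mdeg k = d) /\
    forall p, P p -> (d <= mdeg p)%N.
  pose Q d := `[< exists k, P k /\ mdeg k = d >].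
  have exQ : exists d, Q d by case: exP => k Pk; exists (mdeg k); apply/asboolP; exists k.
  case: (ex_minnP exQ) => d /asboolP Qd dmin; exists d; split=> // p Pp.
  by apply: dmin; apply/asboolP; exists p.
pose N := d.+1; pose M (i : 'I_n) := (N ^ n + N ^ i)%N.
have N0 j : (0 < N ^ j)%N by rewrite expn_gt0.
exists M; split=> [i|]; first by rewrite /M addn_gt0 N0.
pose Q w := `[< exists k, P k /\ weight M k = w >].
have exQ : exists w, Q w.
  by exists (weight M k0); apply/asboolP; exists k0.
case: (ex_minnP exQ) => w /asboolP[k [Pk kw]] wmin; exists k; split=> // p Pp pk.
have wp : (weight M k <= weight M p)%N.
  by rewrite kw; apply: wmin; apply/asboolP; exists p.
rewrite ltn_neqAle wp andbT; apply: contra_neq pk => kp.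
pose D (q : mi) := (\sum_(i < n) q i * N ^ i)%N.
have WE q : weight M q = (mdeg q * N ^ n + D q)%N.
  rewrite /weight /mdeg big_distrl -big_split/=; apply: eq_bigr => i _.
  by rewrite mulnDr.
pose ext q (j : nat) : nat := if insub j is Some i then (q : mi) i else 0%N.
have extE (q : mi) (i : 'I_n) : ext q i = q i by rewrite /ext valK.
have DE (q : mi) : D q = (\sum_(i < n) ext q i * N ^ i)%N.
  by apply: eq_bigr => i _; rewrite extE.
have extN q : mdeg q = d -> forall j, (ext q j < N)%N.
  move=> qd j; rewrite /ext; case: insubP => [i _ _|_//].
  by rewrite /N -qd ltnS leq_mdeg.
(* One more unit of degree costs at least [N ^ n], more than the whole digit part [D k0]; so minimal
   weight forces minimal degree. *)
have degd q : P q -> weight M q = weight M k -> mdeg q = d.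
  move=> Pq qk; apply/eqP; rewrite eqn_leq dmin// andbT.
  have h0 : (weight M k <= weight M k0)%N.
    by rewrite kw; apply: wmin; apply/asboolP; exists k0.
  have h1 : (D k0 < N ^ n)%N by rewrite DE; apply: digits_lt; exact: extN.
  rewrite -ltnS -(ltn_pmul2r (N0 n)); apply: leq_ltn_trans (_ : _ <= weight M q)%N _.
    by rewrite WE leq_addr.
  by rewrite qk (leq_ltn_trans h0)// WE k0d mulSn addnC ltn_add2r.
have pd := degd p Pp (esym kp); have kd := degd k Pk erefl.
have : D p = D k by move: kp; rewrite !WE pd kd => /addnI.
rewrite !DE => h; apply/ffunP => i; rewrite -!extE.
exact: digits_inj (extN _ pd) (extN _ kd) h _ (ltn_ord i).
Qed.

Lemma rmon_weight (t : R) (M : 'I_n -> nat) k :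
  rmon (fun i => t ^+ M i) k = t ^+ weight M k.
Proof.
rewrite /rmon /weight -prodrXr; apply: eq_bigr => i _.
by rewrite -exprM mulnC.
Qed.

(** Along the curve [z_i = t ^ M i] the term of index [k] has order [t ^ weight M k]. The unique
    nonzero term of least weight would dominate all others as [t] tends to 0, yet the sum is 0. *)
Lemma power_series0 (E : normedModType R[i]) (a : mi -> E) :
  has_power_series (fun=> 0) a -> forall k, a k = 0.
Proof.
move=> a0; apply: contrapT => /existsNP h.
have [M [M0 [k [ak kmin]]]] := separating_weight h.
(* For [t <= t0] the squares of the [n] coordinates sum to at most [n / (n + 1) < 1], which keeps
   the curve in the ball. *)
pose t0 : R := (n.+1)%:R^-1.
have t00 : 0 < t0 by rewrite invr_gt0 ltr0n.
have t01 : t0 <= 1 by rewrite invf_le1 ?ltr0n// ler1n.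
pose z (t : R) : 'rV[R[i]]_n := \row_i (t ^+ M i)%:C.
have cz t j : 0 <= t -> cabs (monomial (z t) j) = t ^+ weight M j.
  move=> tp; rewrite cabs_monomial -rmon_weight; apply: eq_bigr => i _.
  by rewrite mxE cabs_real ger0_norm ?exprn_ge0.
have zb t : 0 <= t -> t <= t0 -> unit_ball (z t).
  move=> tp tt0; apply/unit_ballE.
  apply: (@le_lt_trans _ _ (\sum_(i < n) t0)).
    apply: ler_sum => i _; rewrite mxE cabs_real ger0_norm ?exprn_ge0// -exprM.
    apply: le_trans (tt0); rewrite -[leRHS]expr1 ler_wiXn2l//.
      exact: le_trans tt0 t01.
    by rewrite muln_gt0 M0.
  by rewrite sumr_const card_ord -mulr_natr mulrC ltr_pdivrMr ?ltr0n// mul1r ltr_nat.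
have sum0 := has_power_series_abs a0 (zb t0 (ltW t00) (lexx _)).
have [S S0 hS] := esum_fin_cvg (fun j => nrm_ge0 _) sum0.
pose w j := weight M j.
have nz t j : 0 <= t -> nrm (monomial (z t) j *: a j) = t ^+ w j * nrm (a j).
  by move=> tp; rewrite nrmZc cz.
have key u : 0 < u -> u <= 1 -> t0 ^+ w k * nrm (a k) <= u * S.
  move=> u0 u1; pose t := u * t0.
  have tp : 0 <= t by rewrite mulr_ge0// ltW.
  have tt0 : t <= t0 by rewrite ler_piMl// ltW.
  (* [c] isolates the leading term; [e] dominates the others, whose weight exceeds that of [k] by at
     least one and so gains an extra factor [u]. *)
  pose c j := if j == k then nrm (monomial (z t) k *: a k) else 0.
  pose e j := u ^+ (w k).+1 * nrm (monomial (z t0) j *: a j).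
  have e0 j : 0 <= e j by rewrite mulr_ge0 ?exprn_ge0 ?nrm_ge0 ?(ltW u0).
  have c0 j : 0 <= c j by rewrite /c; case: ifP; rewrite ?nrm_ge0.
  have h1 j : nrm (monomial (z t) j *: a j) <= c j + e j.
    rewrite /c; have [->|jk] := eqVneq j k; first by rewrite lerDl.
    have [->|aj] := eqVneq (a j) 0; first by rewrite scaler0 nrm0 add0r e0.
    rewrite add0r /e !nz ?(ltW t00)// /t exprMn mulrA ler_wpM2r ?nrm_ge0//.
    rewrite ler_wpM2r ?exprn_ge0 ?(ltW t00)//.
    by apply: ler_wiXn2l; rewrite ?(ltW u0)//; apply: kmin => //; exact/eqP.
  have h2 : (\esum_(j in [set: mi]) (c j + e j)%:E <=
      (nrm (monomial (z t) k *: a k) + u ^+ (w k).+1 * S)%:E)%E.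
    under eq_esum do rewrite EFinD.
    rewrite esumD; last 2 first.
    - by move=> j _; rewrite lee_fin.
    - by move=> j _; rewrite lee_fin.
    rewrite EFinD; apply: leeD; apply: esum_leP => A; rewrite lee_fin.
      rewrite -big_mkcond/=; have [kA|kA] := boolP (k \in A).
        by rewrite (big_rem k)//= eqxx big1_seq ?addr0// => j /andP[/eqP ->];
          rewrite mem_rem_uniq ?fset_uniq// inE eqxx.
      by rewrite big1_seq ?nrm_ge0// => j /andP[/eqP -> jA]; rewrite jA in kA.
    rewrite -mulr_sumr ler_wpM2l ?exprn_ge0 ?(ltW u0)// -lee_fin -hS.
    exact: fset_le_esum.
  have := psum_tail [fset k]%fset (a0 _ (zb t tp tt0)) h1 h2.
  rewrite !big_seq_fset1 sub0r nrmN /c eqxx => h3.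
  have : nrm (monomial (z t) k *: a k) <= u ^+ (w k).+1 * S.
    by have := e0 k; rewrite /e in h3 *; lra.
  rewrite nz// /t exprMn exprS -!mulrA [leRHS]mulrCA.
  by rewrite ler_pM2l ?exprn_gt0.
have : t0 ^+ w k * nrm (a k) <= 0.
  apply/ler_addgt0Pr => e e0; rewrite add0r.
  pose u := Num.min 1 (e / (S + 1)).
  have S1 : 0 < S + 1 by rewrite ltr_wpDl.
  have u0 : 0 < u by rewrite lt_min ltr01 divr_gt0.
  have u1 : u <= 1 by rewrite ge_min lexx.
  apply: le_trans (key u u0 u1) _.
  have ue : u <= e / (S + 1) by rewrite ge_min lexx orbT.
  rewrite ler_pdivlMr// in ue; have := mulr_ge0 (ltW u0) S0; nra.
rewrite pmulr_rle0 ?exprn_gt0// => h0.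
by apply: ak; apply: nrm0_eq0; apply/eqP; rewrite eq_le h0 nrm_ge0.
Qed.

Lemma power_series_unique (E : normedModType R[i]) (f : 'rV[R[i]]_n -> E)
    (a b : mi -> E) : has_power_series f a -> has_power_series f b -> a = b.
Proof.
move=> fa fb; apply/funext => k; apply/eqP; rewrite -subr_eq0; apply/eqP.
apply: (power_series0 (a := fun k => a k - b k)) => z zb.
have -> : partial_sum (fun k => monomial z k *: (a k - b k)) = fun A =>
    partial_sum (fun k => monomial z k *: a k) A -
    partial_sum (fun k => monomial z k *: b k) A.
  apply/funext => A; rewrite !partial_sumE -sumrB.
  by apply: eq_bigr => j _; rewrite scalerBr.
by rewrite -[X in _ --> X](subrr (f z)); apply: cvgB; [exact: fa|exact: fb].
Qed.

Lemma taylorE (E : normedModType R[i]) (f : 'rV[R[i]]_n -> E) (a : mi -> E) :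
  has_power_series f a -> taylor f = a.
Proof.
move=> fa; apply: power_series_unique (fa); rewrite /taylor.
by case: xgetP => [b -> //|/(_ a)].
Qed.

Definition wsum (E : normedModType R[i]) (b : nat -> R) (a : mi -> E) : \bar R :=
  \esum_(k in [set: mi]) (b (mdeg k) / rho1 R k * nrm (a k) ^+ 2)%:E.

Lemma wsum_ge0 (E : normedModType R[i]) b (a : mi -> E) :
  (forall j, 0 < b j) -> (0 <= wsum b a)%E.
Proof.
move=> b0; apply: esum_ge0 => k _; rewrite lee_fin mulr_ge0 ?sqr_ge0//.
by rewrite ltW// divr_gt0// rho1_gt0.
Qed.

Lemma drury_arveson_coef (E : normedModType R[i]) (f : 'rV[R[i]]_n -> E) a :
  has_power_series f a ->
  drury_arveson f <-> (wsum (@DA_weight R) a < +oo)%E.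
Proof.
move=> fa; rewrite /drury_arveson /wspace /= /sqnorm (taylorE fa).
by split=> [[]//|h]; split=> //; exists a.
Qed.

(** Every family of finite Drury-Arveson norm is the Taylor family of a function, so a condition on
    functions becomes one on families, with the product replaced by [mconv]. *)
Lemma contractive_multiplierP (E F : completeNormedModType R[i]) (b : nat -> R)
    (Phi : 'rV[R[i]]_n -> bounded_op E F) A :
  (forall j, 0 < b j) -> has_power_series Phi A ->
  contractive_multiplier b Phi <->
  forall a : mi -> E, (wsum (@DA_weight R) a < +oo)%E ->
    (wsum b (mconv A a) <= wsum (@DA_weight R) a)%E.
Proof.
move=> b0 PA; have DA0 j : 0 < @DA_weight R j by exact: ltr01.
split=> [[[_ mult] contr] a afin|H].
  have [f fa] : exists f, has_power_series f a.
    apply: abs_has_power_series; apply: subexponential_abs.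
    apply: sqsum_subexponential; apply: le_lt_trans afin.
    by apply: le_esum => k _; rewrite /DA_weight mul1r mulrC.
  have fDA : drury_arveson f by apply/(drury_arveson_coef fa).
  have PfA := has_power_series_mul PA fa.
  have [_] := mult f fDA; have := contr f fDA.
  rewrite /wnorm /sqnorm (taylorE fa) (taylorE PfA) -!/(wsum _ _) => h hfin.
  (* [fine] sends [+oo] to 0, so norms compare as sums only once both are known to be finite. *)
  have f1 : wsum b (mconv A a) \is a fin_num by rewrite ge0_fin_numE ?wsum_ge0.
  have f2 : wsum (@DA_weight R) a \is a fin_num by rewrite ge0_fin_numE ?wsum_ge0.
  rewrite -(fineK f1) -(fineK f2) lee_fin.
  have g1 : 0 <= fine (wsum b (mconv A a)) by rewrite fine_ge0 ?wsum_ge0.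
  have g2 : 0 <= fine (wsum (@DA_weight R) a) by rewrite fine_ge0 ?wsum_ge0.
  by rewrite -(sqr_sqrtr g1) -(sqr_sqrtr g2) ler_sqr ?nnegrE ?sqrtr_ge0.
split; first split; first by exists A.
  move=> f fDA; have [[a fa] _] := fDA.
  have afin := (drury_arveson_coef fa).1 fDA.
  have PfA := has_power_series_mul PA fa.
  split; first by exists (mconv A a).
  by rewrite /sqnorm (taylorE PfA); exact: le_lt_trans (H a afin) afin.
move=> f fDA; have [[a fa] _] := fDA.
have afin := (drury_arveson_coef fa).1 fDA.
have PfA := has_power_series_mul PA fa.
rewrite /wnorm /sqnorm (taylorE fa) (taylorE PfA) -!/(wsum _ _) ler_wsqrtr//.
apply: fine_le; [| |exact: H].
  by rewrite ge0_fin_numE ?wsum_ge0//; exact: le_lt_trans (H a afin) afin.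
by rewrite ge0_fin_numE ?wsum_ge0.
Qed.

End uniqueness.

(** * The universal multiplier *)

(** Cauchy-Schwarz with free weights, from the sign of the quadratic [key]. The freedom lets [W] be
    evaluated by Pascal's rule or by the Vandermonde identity. *)
Lemma sum_sqr_le {R : realType} (I : Type) (r : seq I) (P : pred I) (a w : I -> R) :
  (forall i, P i -> 0 < w i) ->
  (\sum_(i <- r | P i) a i) ^+ 2 <=
  (\sum_(i <- r | P i) w i) * \sum_(i <- r | P i) a i ^+ 2 / w i.
Proof.
move=> w0; set S := \sum_(i <- r | P i) a i; set W := \sum_(i <- r | P i) w i.
set B := \sum_(i <- r | P i) _.
have W0 : 0 <= W by apply: sumr_ge0 => i /w0/ltW.
have key t : 0 <= B - 2 * t * S + t ^+ 2 * W.
  have -> : B - 2 * t * S + t ^+ 2 * W =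
      \sum_(i <- r | P i) w i * (a i / w i - t) ^+ 2.
    rewrite /B /S /W !mulr_sumr -sumrB -big_split/=; apply: eq_bigr => i Pi.
    by field; rewrite gt_eqF ?w0.
  by apply: sumr_ge0 => i /w0/ltW wi; rewrite mulr_ge0 ?sqr_ge0.
move: W0; rewrite le_eqVlt => /predU1P[W0|W0]; last first.
  have := key (S / W).
  have -> : B - 2 * (S / W) * S + (S / W) ^+ 2 * W = B - S ^+ 2 / W.
    by field; rewrite gt_eqF.
  by rewrite subr_ge0 ler_pdivrMr// mulrC.
rewrite -W0 mul0r; suff -> : S = 0 by rewrite expr0n.
apply/eqP; apply/negPn/negP => S0.
have := key ((B + 1) / (2 * S)); rewrite -W0 mulr0 addr0.
have -> : B - 2 * ((B + 1) / (2 * S)) * S = -1 by field.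
by rewrite oppr_ge0 ler10.
Qed.

Lemma nrm_sum_sqr_le {R : realType} {E : normedModType R[i]} (I : Type) (r : seq I)
    (P : pred I) (a : I -> E) (w : I -> R) :
  (forall i, P i -> 0 < w i) ->
  nrm (\sum_(i <- r | P i) a i) ^+ 2 <=
  (\sum_(i <- r | P i) w i) * \sum_(i <- r | P i) nrm (a i) ^+ 2 / w i.
Proof.
move=> w0; apply: le_trans (sum_sqr_le _ _ w0).
rewrite lerXn2r ?nnegrE ?nrm_ge0 ?nrm_sum//.
by apply: sumr_ge0 => i _; exact: nrm_ge0.
Qed.

Section weight_sequences.
Context {R : realType} {beta : nat -> R}.
Context (hbeta : weight_sequence beta).

Lemma weight_gammaV j : (weight_gamma beta j)^-1 =
  if j is i.+1 then (beta i.+1)^-1 - (beta i)^-1 else 1.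
Proof. by case: j => [|j] /=; rewrite ?invr1 ?invrK. Qed.

Lemma weight_gamma_gt0 j : 0 < weight_gamma beta j.
Proof.
rewrite -invr_gt0 weight_gammaV; case: j => [//|j].
by rewrite subr_gt0 ltf_pV2 ?posrE ?(weight_gt0 hbeta)// (weight_decreasing hbeta).
Qed.

Lemma sum_weight_gammaV d : \sum_(j < d.+1) (weight_gamma beta j)^-1 = (beta d)^-1.
Proof.
elim: d => [|d IH].
  by rewrite big_ord1 weight_gammaV (weight0 hbeta) invr1.
by rewrite big_ord_recr/= IH invrK addrC subrK.
Qed.

Lemma weight_gammaV_le j : (weight_gamma beta j)^-1 <= (beta j)^-1.
Proof.
rewrite -sum_weight_gammaV big_ord_recr/= lerDr; apply: sumr_ge0 => i _.
by rewrite invr_ge0 ltW// weight_gamma_gt0.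
Qed.

(** The liminf condition enters here: eventually [s < beta_j^(1/j)], that is [s^j < beta_j]. *)
Lemma weight_growth (s : R) : 0 < s < 1 ->
  exists2 C : R, 0 <= C & forall j, s ^+ j / beta j <= C.
Proof.
move=> /andP[s0 s1]; have := weight_liminf hbeta.
rewrite limn_einf_lim (cvg_lim _ (@cvg_einfs_sup R _))// => h.
have [_ [N _ <-] hN] : exists2 x, range (einfs (fun j => (beta j `^ j%:R^-1)%:E)) x & (s%:E < x)%E.
  by apply/ereal_sup_gtP; apply: lt_le_trans h; rewrite lte_fin.
have b0 := weight_gt0 hbeta.
have nn j : 0 <= s ^+ j / beta j by rewrite divr_ge0 ?exprn_ge0 ?ltW.
(* The 1 serves the indices beyond [N], the sum the others. Cutting at [N.+1] ensures [j > 0] in the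
   tail, so that [j^-1] is a true inverse. *)
exists (1 + \sum_(j < N.+1) s ^+ j / beta j).
  by rewrite addr_ge0// sumr_ge0.
move=> j; have [jN|Nj] := ltnP j N.+1.
  rewrite (bigD1 (Ordinal jN))//= addrCA lerDl addr_ge0// sumr_ge0//.
apply: (@le_trans _ _ 1); last by rewrite lerDl sumr_ge0.
rewrite ler_pdivrMr// mul1r.
have : (s%:E < (beta j `^ j%:R^-1)%:E)%E.
  apply: lt_le_trans hN _; apply: ereal_inf_lbound; exists j => //=.
  exact: ltnW.
rewrite lte_fin => /ltW h1.
have j0 : (0 < j)%N by exact: leq_trans Nj.
have -> : beta j = (beta j `^ j%:R^-1) ^+ j.
  rewrite -powR_mulrn ?powR_ge0// -powRrM mulVf ?powRr1 ?ltW//.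
  by rewrite pnatr_eq0 -lt0n.
by rewrite lerXn2r ?nnegrE ?powR_ge0 ?(ltW s0).
Qed.

End weight_sequences.

Section universal_multiplier.
Context {R : realType} {n : nat} {E : completeNormedModType R[i]} {beta : nat -> R}.
Context (hbeta : weight_sequence beta).
Local Notation mi := (multi_index n).
Local Notation L := (l2 mi E).

Definition psi_c (k : mi) : R := Num.sqrt (rho1 R k / weight_gamma beta (mdeg k)).

Lemma psi_c_sqr k : psi_c k ^+ 2 = rho1 R k / weight_gamma beta (mdeg k).
Proof.
rewrite sqr_sqrtr// divr_ge0// ltW// ?rho1_gt0//; exact: weight_gamma_gt0.
Qed.

Lemma psi_c_gt0 k : 0 < psi_c k.
Proof.
rewrite sqrtr_gt0 divr_gt0// ?rho1_gt0//; exact: weight_gamma_gt0.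
Qed.

Lemma psi_coef_ex k : exists T : bounded_op L E, forall a, T a = (psi_c k)%:C *: a k.
Proof.
have [||T hT] := @bounded_op_ex R L E (fun a => (psi_c k)%:C *: a k) (psi_c k).
- by move=> c a b; rewrite l2DE l2ZE scalerDr !scalerA mulrC.
- move=> a; rewrite nrm_real ger0_norm ?(ltW (psi_c_gt0 _))//.
  by rewrite ler_wpM2l ?nrm_l2_le// ltW// psi_c_gt0.
by exists T.
Qed.

Definition psi_coef k : bounded_op L E := projT1 (cid (psi_coef_ex k)).

Lemma psi_coefE k a : psi_coef k a = (psi_c k)%:C *: a k.
Proof. by rewrite /psi_coef; case: cid. Qed.

(** After squaring, [weight_growth] at [r^2] applies because [1 / gamma_j <= 1 / beta_j]. *)
Lemma psi_subexponential : subexponential psi_coef.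
Proof.
move=> r /andP[r0 r1].
have r2 : 0 < r ^+ 2 < 1 by rewrite exprn_gt0//= exprn_ilt1 ?ltW.
have [C C0 hC] := weight_growth hbeta r2; exists (Num.sqrt C) => k.
have h : nrm (psi_coef k) <= psi_c k.
  apply: nrm_op_le => [|a]; first exact: ltW (psi_c_gt0 k).
  rewrite psi_coefE nrm_real ger0_norm ?(ltW (psi_c_gt0 _))//.
  by rewrite ler_wpM2l ?nrm_l2_le// ltW// psi_c_gt0.
have rd0 : 0 <= r ^+ mdeg k by rewrite exprn_ge0// ltW.
apply: le_trans (ler_wpM2r rd0 h) _.
have rho0 : 0 < rho1 R k by exact: rho1_gt0.
rewrite -ler_sqr ?nnegrE; last 2 first.
- by rewrite mulr_ge0// ltW// psi_c_gt0.
- by rewrite mulr_ge0// sqrtr_ge0.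
rewrite !exprMn psi_c_sqr !sqr_sqrtr ?(ltW rho0)// -mulrA [leRHS]mulrC.
rewrite ler_pM2l//; apply: le_trans (hC (mdeg k)).
rewrite mulrC -!exprM mulnC ler_wpM2l ?exprn_ge0 ?(ltW r0)//.
exact: weight_gammaV_le.
Qed.

Lemma Psi_series : exists T : 'rV[R[i]]_n -> bounded_op L E,
  has_power_series T psi_coef /\
  forall z, unit_ball z -> forall a, Psi beta z a = T z a.
Proof.
have [T hT] := abs_has_power_series_op (subexponential_abs psi_subexponential).
exists T; split=> // z zb a; rewrite /Psi /summability.sum.
apply: cvg_lim => //; have := has_power_series_app (x := a) hT zb.
suff -> : (fun k => monomial z k *: psi_coef k a) = fun k =>
    ((psi_c k)%:C * monomial z k) *: a k by [].
by apply/funext => k; rewrite psi_coefE scalerA mulrC.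
Qed.

Lemma psi_contractive (g : mi -> L) : (wsum (@DA_weight R) g < +oo)%E ->
  (wsum beta (mconv psi_coef g) <= wsum (@DA_weight R) g)%E.
Proof.
have b0 := weight_gt0 hbeta.
have rho0 k : 0 < rho1 R k by exact: rho1_gt0.
move=> /esum_fin_cvg[k|s s0 hs].
  by rewrite mulr_ge0 ?sqr_ge0// ltW// divr_gt0.
rewrite [leRHS]hs.
(* Summed over all pairs, [F] gives at most the squared norm of [g]; grouped along [k + m = p], it
   is what Cauchy-Schwarz leaves in degree [p]. *)
pose F (km : mi * mi) := nrm (g km.2 km.1) ^+ 2 / rho1 R km.2.
have F0 km : 0 <= F km by rewrite divr_ge0 ?sqr_ge0 ?ltW.
have hF : (\esum_(km in [set: mi * mi]) (F km)%:E <= s%:E)%E.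
  apply: esum_leP => C.
  pose A := [fset k.1 | k in C]%fset; pose B := [fset k.2 | k in C]%fset.
  have CAB : (C `<=` A `*` B)%fset.
    apply/fsubsetP => k kC; rewrite in_fsetM; apply/andP.
    by split; apply/imfsetP; exists k.
  apply: (@le_trans _ _ (\sum_(m <- B) (DA_weight R (mdeg m)) / rho1 R m * nrm (g m) ^+ 2)%:E).
    rewrite lee_fin; apply: le_trans (fset_sum_ler F0 CAB) _.
    rewrite -partial_sumE partial_sum_prod exchange_big/=; apply: ler_sum => m _.
    rewrite /F/= -mulr_suml mulrC mul1r ler_pM2l ?invr_gt0//.
    by rewrite -lee_fin -l2_nrmE; exact: (fset_le_esum (fun k => nrm (g m k) ^+ 2)).
  by rewrite -hs; exact: fset_le_esum.
have [t t0 ht] := esum_fin_cvg F0 (le_lt_trans hF (ltry s)).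
have := psum_regroup (pi := fun km : mi * mi => madd km.1 km.2) (F := @splits n)
  (@splits_uniq n) (fun i j => mem_splits j i) (esum_cvg F0 ht).
move=> /cvg_esum H; have {}H := H (fun p => sumr_ge0 _ (fun km _ => F0 km)).
apply: le_trans (_ : _ <= t%:E)%E _; last by rewrite -ht.
rewrite -H; apply: le_esum => p _; rewrite lee_fin /mconv.
rewrite mulrAC ler_pdivrMr//.
under eq_bigr do rewrite psi_coefE.
(* These weights cancel [psi_c] in the quotient and have the Vandermonde sum as their total. *)
pose w (km : mi * mi) := psi_c km.1 ^+ 2 * rho1 R km.2.
have w0 km : 0 < w km by rewrite mulr_gt0// exprn_gt0// psi_c_gt0.
have := @nrm_sum_sqr_le R E _ (splits p) xpredT
  (fun km => (psi_c km.1)%:C *: g km.2 km.1) w (fun km _ => w0 km).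
have -> : \sum_(km <- splits p) w km = rho1 R p / beta (mdeg p).
  rewrite -(sum_weight_gammaV hbeta) -(rho1_vandermonde (fun j => (weight_gamma beta j)^-1)); apply: eq_bigr => km _.
  by rewrite /w psi_c_sqr mulrAC.
have -> : \sum_(km <- splits p) nrm ((psi_c km.1)%:C *: g km.2 km.1) ^+ 2 / w km =
    \sum_(km <- splits p) F km.
  apply: eq_bigr => km _; rewrite nrm_real exprMn real_normK ?num_real// /w /F.
  by field; rewrite !gt_eqF ?psi_c_gt0.
move=> h; apply: le_trans (ler_wpM2l (ltW (b0 _)) h) _.
rewrite mulrA [_ / _]mulrC mulrA divff ?gt_eqF// mul1r mulrC//.
Qed.

End universal_multiplier.

Lemma multiplier_of_factor (R : realType) (n : nat)
    (E Estar : completeNormedModType R[i]) (beta : nat -> R)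
    (Theta : 'rV[R[i]]_n -> bounded_op E Estar)
    (Theta' : 'rV[R[i]]_n -> bounded_op E (l2 (multi_index n) Estar)) :
  weight_sequence beta -> analytic Theta ->
  contractive_multiplier (@DA_weight R) Theta' ->
  (forall z, unit_ball z -> forall x, Theta z x = Psi beta z (Theta' z x)) ->
  contractive_multiplier beta Theta.
Proof.
move=> hbeta [A TA] mT' TPsi.
have [A' TA'] := mT'.1.1.
apply/(contractive_multiplierP (weight_gt0 hbeta) TA) => a afin.
have DA0 j : 0 < @DA_weight R j by exact: ltr01.
have h := (contractive_multiplierP DA0 TA').1 mT' a afin.
have [f fa] : exists f, has_power_series f a.
  apply: abs_has_power_series; apply: subexponential_abs.
  apply: sqsum_subexponential; apply: le_lt_trans afin.
  by apply: le_esum => k _; rewrite /DA_weight mul1r mulrC.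
have [T [hT PsiT]] := @Psi_series R n Estar beta hbeta.
have h1 := has_power_series_mul TA fa.
have h2 := has_power_series_mul hT (has_power_series_mul TA' fa).
(* Both sides are Taylor coefficients of [Theta f], by the factorization on the ball. *)
have -> : mconv A a = mconv (psi_coef hbeta) (mconv A' a).
  apply: power_series_unique h1 _ => z zb.
  by have := h2 z zb; rewrite -(PsiT z zb) -(TPsi z zb).
apply: le_trans (h); apply: (psi_contractive hbeta).
exact: le_lt_trans h afin.
Qed.

(** * Adjoints, defect operators and weighted shifts *)

Lemma adjoint_ex (R : realType) (H : completeNormedModType R[i])
    (K : normedModType R[i]) (X : bounded_op H K) :
  hilbertian H -> hilbertian K ->
  exists Y : bounded_op K H, (forall h a, rdot (Y h) a = rdot h (X a)) /\
    forall h, nrm (Y h) <= nrm X * nrm h.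
Proof.
move=> hH hK.
have Yex h : exists y : H, (forall a, rdot y a = rdot h (X a)) /\
    nrm y <= nrm X * nrm h.
  have [||||w [w1 w2 _]] := @riesz R H H hH idfun (fun a => rdot h (X a)) (nrm X * nrm h).
  - by [].
  - by move=> c u v; rewrite opD opZ rdotDr// rdotZr.
  - by rewrite mulr_ge0 ?nrm_ge0.
  - move=> u /=; apply: le_trans (rdot_le hK _ _) _.
    by rewrite mulrAC mulrC ler_wpM2r ?nrm_ge0 ?nrm_op.
  by exists w.
pose y h := projT1 (cid (Yex h)).
have y1 h a : rdot (y h) a = rdot h (X a) by rewrite /y; case: cid => ? [].
have y2 h : nrm (y h) <= nrm X * nrm h by rewrite /y; case: cid => ? [].
have ylin : linear y.
  move=> c h h'; apply: (rdot_inj hH) => a.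
  by rewrite y1 !rdotDl// !rdot_conjc// !y1 opZ.
have [Y hY] := bounded_op_ex ylin y2.
by exists Y; split=> [h a|h]; rewrite hY.
Qed.

Lemma esum_nat_eq {R : realType} (a : nat -> R) (l : R) : (forall m, 0 <= a m) ->
  (forall N, \sum_(m < N) a m <= l) ->
  (forall e, 0 < e -> exists N, l - e <= \sum_(m < N) a m) ->
  \esum_(m in [set: nat]) (a m)%:E = l%:E.
Proof.
move=> a0 aN ae; pose r N := seq_fset tt (iota 0 N).
have rE N : \sum_(m <- r N) a m = \sum_(m < N) a m.
  by rewrite sum_seq_fset ?iota_uniq// -(big_mkord xpredT) /index_iota subn0.
apply/eqP; rewrite eq_le; apply/andP; split.
  apply: esum_leP => A; rewrite lee_fin.
  apply: le_trans (aN (\max_(m <- A) m.+1)%N); rewrite -rE.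
  apply: fset_sum_ler => //; apply/fsubsetP => m mA.
  by rewrite seq_fsetE mem_iota /= (bigD1_seq m)//= leq_max leqnn.
apply/lee_addgt0Pr => e e0; have [N hN] := ae e e0.
rewrite -leeBlDr//; apply: le_trans (fset_le_esum a (r N)).
by rewrite rE -EFinB lee_fin.
Qed.

(* A square root of [I - X X^*] as a sum of squares of polynomials: with
   [T = X X^*] and [S = I - 2 T], the identity [I - T = (I - T)^2 + T (I - T)] and
   [4 T (I - T) = I - S^2] reduce the claim to
   [|h|^2 - |S h|^2 = sum_m |S^m h - S^(m+2) h|^2], a telescoping sum because
   [|S^m h|^2] decreases. *)
Lemma defect_ex (R : realType) (H K : completeNormedModType R[i])
    (X : bounded_op H K) (Xs : bounded_op K H) :
  hilbertian H -> hilbertian K -> (forall h a, rdot (Xs h) a = rdot h (X a)) ->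
  (forall h, nrm (Xs h) <= nrm h) -> (forall a, nrm (X a) <= nrm a) ->
  exists J : bounded_op K (l2 nat K),
    forall h, nrm (J h) ^+ 2 = nrm h ^+ 2 - nrm (Xs h) ^+ 2.
Proof.
move=> hH hK adj Xs1 X1.
pose T h := X (Xs h).
have Tlin c u v : T (c *: u + v) = c *: T u + T v by rewrite /T opD opZ opD opZ.
have Tsym u v : rdot (T u) v = rdot u (T v).
  by rewrite /T rdotC -adj rdotC adj.
have Tself u : rdot (T u) u = nrm (Xs u) ^+ 2 by rewrite rdotC /T -adj rdotxx.
have Tpos u : nrm (T u) ^+ 2 <= rdot (T u) u.
  by rewrite Tself lerXn2r ?nnegrE ?nrm_ge0 ?X1.
pose S h := h - (2%:R : R)%:C *: T h.
have Slin c u v : S (c *: u + v) = c *: S u + S v.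
  rewrite /S Tlin scalerDr scalerBr !scalerA opprD addrACA.
  by rewrite [_%:C * c]mulrC.
have Ssym u v : rdot (S u) v = rdot u (S v).
  by rewrite /S rdotBl// rdotBr// rdotZl// rdotZr// Tsym.
have Snorm u : nrm u ^+ 2 - nrm (S u) ^+ 2 = 4 * (rdot (T u) u - nrm (T u) ^+ 2).
  rewrite /S nrmB_sq// rdotZr// nrm_real exprMn ger0_norm// (rdotC u); ring.
have S1 u : nrm (S u) ^+ 2 <= nrm u ^+ 2.
  by rewrite -subr_ge0 Snorm mulr_ge0// subr_ge0.
pose P m h := iter m S h.
have Plin m c u v : P m (c *: u + v) = c *: P m u + P m v.
  by elim: m => [//|m IH]; rewrite /P !iterS -!/(P m _) IH Slin.
(* Index 0 carries the summand [|(I - T) h|^2]; the factor 1/2 accounts for the 4 in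
   [4 T (I - T) = I - S^2]. *)
pose f h (m : nat) : K := if m is m'.+1
  then (1 / 2 : R)%:C *: (P m' h - P m'.+2 h) else h - T h.
have fsum h : \esum_(m in [set: nat]) (nrm (f h m) ^+ 2)%:E =
    (nrm h ^+ 2 - nrm (Xs h) ^+ 2)%:E.
  pose b m := nrm (P m h) ^+ 2.
  have b0 m : 0 <= b m by exact: sqr_ge0.
  have bdec m : b m.+1 <= b m by exact: S1.
  (* [S] is symmetric, so [S^m h] and [S^(m+2) h] pair to [|S^(m+1) h|^2] and each square is a
     second difference of [b]. *)
  have fS m : nrm (f h m.+1) ^+ 2 = (b m - 2 * b m.+1 + b m.+2) / 4.
    rewrite /= nrm_real exprMn real_normK ?num_real// nrmB_sq//.
    have -> : rdot (P m h) (P m.+2 h) = b m.+1 by rewrite /P !iterS -Ssym rdotxx.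
    by rewrite /b; field.
  have sumE N : \sum_(m < N.+1) nrm (f h m) ^+ 2 =
      nrm h ^+ 2 - nrm (Xs h) ^+ 2 - (b N - b N.+1) / 4.
    elim: N => [|N IH].
      rewrite big_ord1 /= nrmB_sq// (rdotC h) Tself.
      by have := Snorm h; rewrite Tself /b /= => h1; lra.
    by rewrite big_ord_recr /= IH -[nrm (_ *: _)]/(nrm (f h N.+1)) fS; field.
  apply: esum_nat_eq => [m|N|e e0]; first exact: sqr_ge0.
    apply: (@le_trans _ _ (\sum_(m < N.+1) nrm (f h m) ^+ 2)).
      by rewrite big_ord_recr/= lerDl sqr_ge0.
    by rewrite sumE; have := bdec N; lra.
  (* The remainder is a gap of the decreasing sequence [b >= 0]; if all gaps exceeded [e], [b] would
     become negative. *)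
  suff [N hN] : exists N, b N - b N.+1 <= e.
    by exists N.+1; rewrite sumE; have := bdec N; lra.
  apply: contrapT => /forallNP hN.
  have hb N : b N <= b 0%N - N%:R * e.
    elim: N => [|N IH]; first by rewrite mul0r subr0.
    by have /negP := hN N; rewrite -ltNge -natr1; lra.
  have [N hN'] : exists N : nat, b 0%N / e < N%:R.
    exists (Num.bound (b 0%N / e)); apply: archi_boundP; apply: divr_ge0 (ltW e0).
    exact: b0.
  by move: hN'; rewrite ltr_pdivrMr//; have := hb N; have := b0 N; lra.
have Jex h : exists g : l2 nat K, g =1 f h.
  have [|g gf _] := @l2_ex R nat K (f h) (nrm h ^+ 2 - nrm (Xs h) ^+ 2).
    by rewrite fsum.
  by exists g.
pose J h := projT1 (cid (Jex h)).
have JE h m : J h m = f h m by rewrite /J; case: cid.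
have JN h : nrm (J h) ^+ 2 = nrm h ^+ 2 - nrm (Xs h) ^+ 2.
  by apply/EFin_inj; rewrite -l2_nrmE -fsum; apply: eq_esum => m _; rewrite JE.
have Jlin : linear J.
  move=> c u v; apply: l2P_ext => m; rewrite l2DE l2ZE !JE; case: m => [|m].
    by rewrite /= Tlin scalerBr opprD addrACA.
  have fE g : f g m.+1 = (1 / 2 : R)%:C *: (P m g - P m.+2 g) by [].
  rewrite !fE !Plin opprD addrACA -scalerBr scalerDr !scalerA.
  by rewrite [_%:C * c]mulrC.
have J1 h : nrm (J h) <= 1 * nrm h.
  by rewrite mul1r -ler_sqr ?nnegrE ?nrm_ge0// JN lerBlDr lerDl sqr_ge0.
have [J' hJ'] := bounded_op_ex Jlin J1.
by exists J' => h; rewrite hJ' JN.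
Qed.

Section weighted_shifts.
Context {R : realType} {n : nat} {F : completeNormedModType R[i]}.
Local Notation mi := (multi_index n).
Local Notation K := (l2 mi F).
Context {b : nat -> R}.
Implicit Types (p q : mi) (h : K).
Context (b_gt0 : forall j, 0 < b j) (b_dec : forall j, b j.+1 <= b j).

Definition wscale (p : mi) : R := b (mdeg p) / rho1 R p.

(** The diagonal entry, in degree [j], of [I - sum_i T_i T_i^*] on [H(b)]. *)
Definition wdefect (j : nat) : R := if j is i.+1 then 1 - b i.+1 / b i else 1.

Lemma wscale_gt0 p : 0 < wscale p.
Proof. by rewrite divr_gt0// rho1_gt0. Qed.

Lemma wdefect_ge0 j : 0 <= wdefect j.
Proof. by case: j => [//|j] /=; rewrite subr_ge0 ler_pdivrMr// mul1r. Qed.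

(** By Pascal's rule the ratios add up to [b_d / b_(d-1)] in degree [d > 0], which [wdefect]
    completes to 1. *)
Lemma wscale_sum p :
  \sum_(i | (0 < p i)%N) wscale p / wscale (mpred i p) + wdefect (mdeg p) = 1.
Proof.
have [->|p0] := eqVneq p midx0.
  by rewrite mdeg0 big1 ?add0r// => i; rewrite ffunE.
have [d dp] : exists d, mdeg p = d.+1.
  by exists (mdeg p).-1; rewrite prednK// lt0n mdeg_eq0.
have rho0 q : rho1 R q != 0 by rewrite gt_eqF ?rho1_gt0.
transitivity (\sum_(i | (0 < p i)%N) b d.+1 / b d / rho1 R p * rho1 R (mpred i p)
    + wdefect (mdeg p)).
  congr (_ + _); apply: eq_bigr => i pi; rewrite /wscale dp.
  have -> : mdeg (mpred i p) = d by apply: succn_inj; rewrite -mdeg_mpred.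
  by field; rewrite !rho0 gt_eqF.
rewrite -mulr_sumr rho1_sum// dp /wdefect.
by field; rewrite rho0 gt_eqF.
Qed.

Lemma esum_msucc (i : 'I_n) (G : mi -> R) :
  \esum_(p in [set: mi]) (G (msucc i p))%:E =
  \esum_(p in [set: mi]) (if (0 < p i)%N then G p else 0)%:E.
Proof.
rewrite -(@reindex_esum R mi mi [set: mi] [set p : mi | (0 < p i)%N] (msucc i)
  (fun p => (G p)%:E)); last first.
  split=> [p _ /=|p q _ _ pq|p /= pi]; first exact: msucc_gt0.
    by rewrite -(msuccK i p) pq msuccK.
  by exists (mpred i p) => //; exact: mpredK.
rewrite esum_mkcond; apply: eq_esum => p _.
have -> : (p \in [set p : mi | (0 < p i)%N]) = (0 < p i)%N.
  by apply/idP/idP => [/set_mem//|h]; exact: mem_set.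
by case: ifP.
Qed.

(** Stated for sums, before the operators exist: it provides the square-summability from which
    [bshift] and [dshift] are built. *)
Lemma weighted_shift_sum (h : K) :
  (\sum_(i < n) \esum_(p in [set: mi])
      (wscale (msucc i p) / wscale p * nrm (h (msucc i p)) ^+ 2)%:E +
    \esum_(p in [set: mi]) (wdefect (mdeg p) * nrm (h p) ^+ 2)%:E =
  (nrm h ^+ 2)%:E)%E.
Proof.
pose G i p := wscale p / wscale (mpred i p) * nrm (h p) ^+ 2.
have G0 i p : 0 <= G i p.
  by apply: mulr_ge0 (sqr_ge0 _); apply: divr_ge0; exact: ltW (wscale_gt0 _).
have -> : (\sum_(i < n) \esum_(p in [set: mi])
      (wscale (msucc i p) / wscale p * nrm (h (msucc i p)) ^+ 2)%:E =
    \esum_(p in [set: mi]) (\sum_(i < n) if (0 < p i)%N then G i p else 0)%:E)%E.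
  under [RHS]eq_esum do rewrite -sumEFin.
  rewrite esum_sum => [|p i _ _]; last by rewrite lee_fin; case: ifP.
  apply: eq_bigr => i _; rewrite -esum_msucc; apply: eq_esum => p _.
  by rewrite /G msuccK.
rewrite -esumD; last 2 first.
- move=> p _; rewrite lee_fin; apply: sumr_ge0 => i _; by case: ifP.
- by move=> p _; rewrite lee_fin mulr_ge0 ?sqr_ge0 ?wdefect_ge0.
rewrite -l2_nrmE; apply: eq_esum => p _; rewrite -EFinD -big_mkcond/= /G.
by rewrite -mulr_suml -mulrDl wscale_sum mul1r.
Qed.

Lemma bshift_ex i : exists T : bounded_op K K, forall h p,
  T h p = (Num.sqrt (wscale (msucc i p) / wscale p))%:C *: h (msucc i p).
Proof.
have sq0 p q : 0 <= wscale p / wscale q.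
  by apply: divr_ge0; exact: ltW (wscale_gt0 _).
have ex h : exists2 g : K, (forall p,
    g p = (Num.sqrt (wscale (msucc i p) / wscale p))%:C *: h (msucc i p)) &
    nrm g ^+ 2 <= nrm h ^+ 2.
  apply: l2_ex; rewrite -weighted_shift_sum (bigD1 i)//= -addeA.
  apply: le_trans (leeDl _ _); last first.
    apply: adde_ge0.
      apply: sume_ge0 => j _; apply: esum_ge0 => p _.
      by rewrite lee_fin mulr_ge0 ?sqr_ge0.
    apply: esum_ge0 => p _.
    by rewrite lee_fin mulr_ge0 ?sqr_ge0 ?wdefect_ge0.
  apply: le_esum => p _; rewrite lee_fin nrm_real exprMn.
  by rewrite ger0_norm ?sqrtr_ge0// sqr_sqrtr.
pose T h := projT1 (cid2 (ex h)).
have TE h p : T h p = (Num.sqrt (wscale (msucc i p) / wscale p))%:C *: h (msucc i p).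
  by rewrite /T; case: cid2.
have Tlin : linear T.
  move=> c u v; apply: l2P_ext => p; rewrite l2DE l2ZE !TE l2DE l2ZE.
  by rewrite scalerDr !scalerA mulrC.
have T1 h : nrm (T h) <= 1 * nrm h.
  by rewrite mul1r -ler_sqr ?nnegrE ?nrm_ge0// /T; case: cid2.
have [T' hT'] := bounded_op_ex Tlin T1.
by exists T' => h p; rewrite hT' TE.
Qed.

(** The adjoint of multiplication by [z_i], in orthonormal coordinates. *)
Definition bshift i : bounded_op K K := projT1 (cid (bshift_ex i)).

Lemma bshiftE i h p :
  bshift i h p = (Num.sqrt (wscale (msucc i p) / wscale p))%:C *: h (msucc i p).
Proof. by rewrite /bshift; case: cid. Qed.

Lemma dshift_ex : exists T : bounded_op K K, forall h p,
  T h p = (Num.sqrt (wdefect (mdeg p)))%:C *: h p.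
Proof.
have ex h : exists2 g : K, (forall p,
    g p = (Num.sqrt (wdefect (mdeg p)))%:C *: h p) &
    nrm g ^+ 2 <= nrm h ^+ 2.
  apply: l2_ex; rewrite -weighted_shift_sum.
  apply: le_trans (leeDr _ _); last first.
    apply: sume_ge0 => j _; apply: esum_ge0 => p _.
    by rewrite lee_fin mulr_ge0 ?sqr_ge0// divr_ge0// ltW// wscale_gt0.
  apply: le_esum => p _; rewrite lee_fin nrm_real exprMn.
  by rewrite ger0_norm ?sqrtr_ge0// sqr_sqrtr// wdefect_ge0.
pose T h := projT1 (cid2 (ex h)).
have TE h p : T h p = (Num.sqrt (wdefect (mdeg p)))%:C *: h p.
  by rewrite /T; case: cid2.
have Tlin : linear T.
  move=> c u v; apply: l2P_ext => p; rewrite l2DE l2ZE !TE l2DE l2ZE.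
  by rewrite scalerDr !scalerA mulrC.
have T1 h : nrm (T h) <= 1 * nrm h.
  by rewrite mul1r -ler_sqr ?nnegrE ?nrm_ge0// /T; case: cid2.
have [T' hT'] := bounded_op_ex Tlin T1.
by exists T' => h p; rewrite hT' TE.
Qed.

(** The square root of [I - sum_i T_i T_i^*]. For [beta] it is [Psi_0^*] in coordinates, by
    [psi_c_wroot]; for the Drury-Arveson weights it keeps the constant term alone. *)
Definition dshift : bounded_op K K := projT1 (cid dshift_ex).

Lemma dshiftE h p : dshift h p = (Num.sqrt (wdefect (mdeg p)))%:C *: h p.
Proof. by rewrite /dshift; case: cid. Qed.

Lemma shift_identity h :
  \sum_(i < n) nrm (bshift i h) ^+ 2 + nrm (dshift h) ^+ 2 = nrm h ^+ 2.
Proof.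
apply: EFin_inj; rewrite -weighted_shift_sum EFinD -sumEFin; congr (_ + _)%E.
  apply: eq_bigr => i _; rewrite -l2_nrmE; apply: eq_esum => p _.
  rewrite bshiftE nrm_real exprMn ger0_norm ?sqrtr_ge0// sqr_sqrtr//.
  by apply: divr_ge0; exact: ltW (wscale_gt0 _).
rewrite -l2_nrmE; apply: eq_esum => p _.
by rewrite dshiftE nrm_real exprMn ger0_norm ?sqrtr_ge0// sqr_sqrtr// wdefect_ge0.
Qed.

Lemma bshift_single i p x : bshift i (single p x) = if (0 < p i)%N
  then (Num.sqrt (wscale p / wscale (mpred i p)))%:C *: single (mpred i p) x else 0.
Proof.
apply: l2P_ext => q; rewrite bshiftE singleE; case: ifP => [|pi].
  move=> /eqP <-; rewrite msucc_gt0 l2ZE singleE msuccK eqxx//.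
case: ifP => pi'; last by rewrite scaler0.
rewrite l2ZE singleE; case: eqP => [qp|_]; last by rewrite !scaler0.
by move: pi; rewrite qp mpredK// eqxx.
Qed.

Lemma dshift_single p x :
  dshift (single p x) = (Num.sqrt (wdefect (mdeg p)))%:C *: single p x.
Proof.
apply: l2P_ext => q; rewrite dshiftE l2ZE singleE.
by case: eqP => [->//|_]; rewrite !scaler0.
Qed.

(** Multiplication by [z_i] itself, obtained as the adjoint of [bshift i], which gives its
    boundedness for free. *)
Lemma fshift_ex i : hilbertian F -> exists T : bounded_op K K,
  (forall h g, rdot (T h) g = rdot h (bshift i g)) /\
  forall h p, T h p = if (0 < p i)%N
    then (Num.sqrt (wscale p / wscale (mpred i p)))%:C *: h (mpred i p) else 0.
Proof.
move=> hF; have hK := @l2_hilbertian R mi F hF.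
have [T [adj _]] := adjoint_ex (bshift i) hK hK; exists T; split=> // h p.
apply: (rdot_inj hF) => x; rewrite -rdot_single adj bshift_single.
case: ifP => pi; first by rewrite rdotZr// rdot_single rdotZl.
by rewrite rdot0r rdotC rdot0r.
Qed.

End weighted_shifts.

(** * Colligations and transfer functions *)

Lemma sum_option (V : nmodType) (T : finType) (f : option T -> V) :
  \sum_o f o = f None + \sum_t f (Some t).
Proof.
rewrite (bigD1 None)//=; congr (_ + _).
rewrite (reindex_omap Some id) => [|[]//].
by apply: eq_bigl => t; rewrite eqxx.
Qed.

Lemma DA_gt0 (R : realType) j : 0 < @DA_weight R j.
Proof. exact: ltr01. Qed.

Lemma DA_dec (R : realType) j : @DA_weight R j.+1 <= @DA_weight R j.
Proof. exact: lexx. Qed.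

Lemma nrm_dshift_DA (R : realType) n (E : completeNormedModType R[i])
    (f : l2 (multi_index n) E) :
  nrm (dshift (@DA_gt0 R) (@DA_dec R) f) = nrm (f midx0).
Proof.
suff -> : dshift (@DA_gt0 R) (@DA_dec R) f = single midx0 (f midx0).
  by rewrite nrm_single.
apply: l2P_ext => p; rewrite dshiftE singleE -mdeg_eq0.
case: eqP => [/eqP p0|p0].
  by rewrite (eqP p0) sqrtr1 scale1r; move: p0; rewrite mdeg_eq0 => /eqP ->.
case: (mdeg p) p0 => [//|d] _.
by rewrite /wdefect /DA_weight divr1 subrr sqrtr0 scale0r.
Qed.

(* The adjoint of the isometry [iota h |-> (J h, C h)], extended by [0] off the
   closure of its domain. *)
Lemma isometry_adjoint (R : realType) (K G E : normedModType R[i])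
    (W : completeNormedModType R[i]) (iota : bounded_op K W)
    (J : bounded_op K G) (C : bounded_op K E) :
  hilbertian G -> hilbertian E -> hilbertian W ->
  (forall h, nrm (iota h) ^+ 2 = nrm (J h) ^+ 2 + nrm (C h) ^+ 2) ->
  exists U : G -> E -> W,
  [/\ (forall c g g' x x', U (c *: g + g') (c *: x + x') = c *: U g x + U g' x'),
      (forall g x, nrm (U g x) ^+ 2 <= nrm g ^+ 2 + nrm x ^+ 2) &
      forall g x h, rdot (U g x) (iota h) = rdot g (J h) + rdot x (C h)].
Proof.
move=> hG hE hW iota_norm.
pose phi g x h : R := rdot g (J h) + rdot x (C h).
pose cl (w : W) := forall e : R, 0 < e -> exists u, nrm (w - iota u) <= e.
have ex g x : exists w : W, [/\ (forall h, rdot w (iota h) = phi g x h),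
    nrm w ^+ 2 <= nrm g ^+ 2 + nrm x ^+ 2 & cl w].
  pose M := Num.sqrt (nrm g ^+ 2 + nrm x ^+ 2).
  have gx0 : 0 <= nrm g ^+ 2 + nrm x ^+ 2 by rewrite addr_ge0 ?sqr_ge0.
  have [||||w [w1 w2 w3]] := @riesz R K W hW iota (phi g x) M.
  - by move=> c u v; rewrite opD opZ.
  - move=> c u v; rewrite /phi opD opZ rdotDr// rdotZr// opD opZ rdotDr// rdotZr//.
    by rewrite mulrDr addrACA.
  - exact: sqrtr_ge0.
  - move=> h; apply: le_trans (ler_norm _) _.
    rewrite -ler_sqr ?nnegrE ?mulr_ge0 ?sqrtr_ge0 ?nrm_ge0//.
    rewrite real_normK ?num_real// exprMn sqr_sqrtr// iota_norm /phi.
    have h1 := rdot_norm_le hG g (J h); have h2 := rdot_norm_le hE x (C h).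
    set p := rdot g _ in h1 *; set q := rdot x _ in h2 *.
    have : (p + q) ^+ 2 <= (nrm g * nrm (J h) + nrm x * nrm (C h)) ^+ 2.
      rewrite -[leLHS]real_normK ?num_real// lerXn2r ?nnegrE//.
        by rewrite addr_ge0 ?mulr_ge0 ?nrm_ge0.
      by apply: le_trans (ler_normD _ _) _; exact: lerD.
    move=> /le_trans; apply.
    have := sqr_ge0 (nrm g * nrm (C h) - nrm x * nrm (J h)); nra.
  exists w; split=> //; apply: le_trans (_ : M ^+ 2 <= _); last by rewrite sqr_sqrtr.
  by rewrite lerXn2r ?nnegrE ?nrm_ge0 ?sqrtr_ge0.
pose U g x := projT1 (cid (ex g x)).
have U1 g x h : rdot (U g x) (iota h) = phi g x h by rewrite /U; case: cid => ? [].
have U2 g x : nrm (U g x) ^+ 2 <= nrm g ^+ 2 + nrm x ^+ 2.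
  by rewrite /U; case: cid => ? [].
have U3 g x : cl (U g x) by rewrite /U; case: cid => ? [].
have clD c w w' : cl w -> cl w' -> cl (c *: w + w').
  move=> cw cw' e e0.
  have c0 : 0 < 1 + cabs c by rewrite ltr_pwDl ?cabs_ge0.
  have [u hu] := cw (e / (2 * (1 + cabs c))) ltac:(by rewrite divr_gt0 ?mulr_gt0).
  have [v hv] := cw' (e / 2) ltac:(by rewrite divr_gt0).
  exists (c *: u + v); rewrite opD opZ opprD addrACA -scalerBr.
  apply: le_trans (nrmD _ _) _; rewrite nrmZc.
  have h1 : cabs c * nrm (w - iota u) <= e / 2.
    apply: (@le_trans _ _ ((1 + cabs c) * (e / (2 * (1 + cabs c))))).
      by apply: ler_pM; rewrite ?cabs_ge0 ?nrm_ge0// lerDr.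
    by rewrite le_eqVlt; apply/orP; left; apply/eqP; field; rewrite gt_eqF.
  by apply: le_trans (lerD h1 hv) _; rewrite -splitr.
have Ulin c g g' x x' : U (c *: g + g') (c *: x + x') = c *: U g x + U g' x'.
  apply/eqP; rewrite -subr_eq0; apply/eqP; apply: (riesz_unique hW (iota := iota)) => [h|].
    rewrite rdotBl// rdotDl// rdot_conjc// -opZ !U1 /phi.
    rewrite rdotDl// rdot_conjc// [rdot (_ *: x + _) _](rdotDl hE).
    by rewrite (rdot_conjc hE) !opZ addrACA subrr.
  rewrite -scaleN1r addrC; apply: (clD); last exact: U3.
  by apply: (clD); exact: U3.
by exists U; split.
Qed.

Section colligation.
Context {R : realType} {I : finType} {K G E : completeNormedModType R[i]}.
Context (hK : hilbertian K) (hG : hilbertian G) (hE : hilbertian E).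
Context {bs : I -> bounded_op K K} {ds : bounded_op K K}.
Context {J e : bounded_op K G} {C : bounded_op K E}.
Context (e_iso : forall h, nrm (e h) = nrm h).
Context (lurking : forall h, \sum_i nrm (J (bs i h)) ^+ 2 + nrm (ds h) ^+ 2 =
  nrm (J h) ^+ 2 + nrm (C h) ^+ 2).
Local Notation W := (l2 (option I) G).

(** An [l2] family takes values in a single space, so [ds h] is carried into [G] by the isometry [e]
    and stored at index [None]. The adjoint of [e] brings the output back to [K] without increasing
    the norm. *)
Lemma colligation_ex : exists (V : I -> G -> E -> G) (O : G -> E -> K),
  [/\ (forall i c g g' x x', V i (c *: g + g') (c *: x + x') = c *: V i g x + V i g' x'),
      (forall c g g' x x', O (c *: g + g') (c *: x + x') = c *: O g x + O g' x'),
      (forall g x, \sum_i nrm (V i g x) ^+ 2 + nrm (O g x) ^+ 2 <=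
         nrm g ^+ 2 + nrm x ^+ 2) &
      forall g x h, \sum_i rdot (V i g x) (J (bs i h)) + rdot (O g x) (ds h) =
         rdot g (J h) + rdot x (C h)].
Proof.
have hW : hilbertian W := l2_hilbertian hG.
pose a h (o : option I) : G := if o is Some i then J (bs i h) else e (ds h).
have ex h : exists w : W, w =1 a h by exact: l2_fin_ex.
pose f h := projT1 (cid (ex h)).
have fE h o : f h o = a h o by rewrite /f; case: cid.
have fN h : nrm (f h) ^+ 2 = nrm (J h) ^+ 2 + nrm (C h) ^+ 2.
  rewrite nrm_l2_fin sum_option fE /= e_iso addrC -lurking; congr (_ + _).
  by apply: eq_bigr => i _; rewrite fE.
have flin : linear f.
  by move=> c u v; apply: l2P_ext => -[i|]; rewrite l2DE l2ZE !fE /= !opD !opZ.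
have f1 h : nrm (f h) <= (nrm J + nrm C) * nrm h.
  have h1 := nrm_op J h; have h2 := nrm_op C h.
  rewrite -ler_sqr ?nnegrE ?mulr_ge0 ?addr_ge0 ?nrm_ge0// fN.
  apply: (@le_trans _ _ ((nrm J * nrm h) ^+ 2 + (nrm C * nrm h) ^+ 2)).
    by apply: lerD; rewrite lerXn2r ?nnegrE ?mulr_ge0 ?nrm_ge0.
  have := mulr_ge0 (nrm_ge0 J) (nrm_ge0 C); have := sqr_ge0 (nrm h); nra.
have [iota hi] := bounded_op_ex flin f1.
have iN h : nrm (iota h) ^+ 2 = nrm (J h) ^+ 2 + nrm (C h) ^+ 2 by rewrite hi.
have [U [Ulin U2 U1]] := isometry_adjoint hG hE hW iN.
have [es [esE es1]] := adjoint_ex e hK hG.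
have e1 : nrm e <= 1 by apply: nrm_op_le => // h; rewrite mul1r e_iso.
exists (fun i g x => U g x (Some i)), (fun g x => es (U g x None)); split.
- by move=> i c g g' x x'; rewrite Ulin l2DE l2ZE.
- by move=> c g g' x x'; rewrite Ulin l2DE l2ZE opD opZ.
- move=> g x; apply: le_trans (U2 g x); rewrite nrm_l2_fin sum_option [leRHS]addrC.
  apply: lerD => //; rewrite lerXn2r ?nnegrE ?nrm_ge0//; apply: le_trans (es1 _) _.
  by rewrite ler_piMl ?nrm_ge0.
- move=> g x h; rewrite -U1 hi rdot_l2_fin sum_option fE /= esE addrC.
  by congr (_ + _); apply: eq_bigr => i _; rewrite fE.
Qed.

End colligation.

Section transfer_function.
Context {R : realType} {n : nat} {G E K : normedModType R[i]}.
Local Notation mi := (multi_index n).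
Implicit Types (p k m : mi) (x : E) (f : mi -> E).
Context {V : 'I_n -> G -> E -> G} {O : G -> E -> K}.
Context (Vlin : forall i c g g' x x',
  V i (c *: g + g') (c *: x + x') = c *: V i g x + V i g' x').
Context (Olin : forall c g g' x x',
  O (c *: g + g') (c *: x + x') = c *: O g x + O g' x').
Context (contr : forall g x,
  \sum_i nrm (V i g x) ^+ 2 + nrm (O g x) ^+ 2 <= nrm g ^+ 2 + nrm x ^+ 2).

Definition impulse x p : E := if p == midx0 then x else 0.

(** Taylor coefficients of the solution [s] of [s = sum_i z_i V_i(s, x)] with constant input [x].
    The counter [N] is the degree of [p] in every use. *)
Fixpoint state_rec (N : nat) p x : G := if N is M.+1 then
  \sum_(i | (0 < p i)%N) V i (state_rec M (mpred i p) x) (impulse x (mpred i p))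
  else 0.

Definition state p x : G := state_rec (mdeg p) p x.

Definition transfer p x : K := O (state p x) (impulse x p).

Lemma stateE p x :
  state p x = \sum_(i | (0 < p i)%N) V i (state (mpred i p) x) (impulse x (mpred i p)).
Proof.
rewrite /state; move dp: (mdeg p) => [|d] /=.
  rewrite big_pred0// => i; move/eqP: dp; rewrite mdeg_eq0 => /eqP ->.
  by rewrite ffunE.
apply: eq_bigr => i pi; congr (V i (state_rec _ _ _) _).
by apply: succn_inj; rewrite -dp (mdeg_mpred pi).
Qed.

Lemma impulse_lin c x x' p : impulse (c *: x + x') p = c *: impulse x p + impulse x' p.
Proof. by rewrite /impulse; case: ifP; rewrite ?scaler0 ?addr0. Qed.

Lemma state_lin c x x' p : state p (c *: x + x') = c *: state p x + state p x'.
Proof.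
rewrite /state; move: (mdeg p) => N; elim: N p => [|d IH] p /=; first by rewrite scaler0 addr0.
rewrite scaler_sumr -big_split; apply: eq_bigr => i _.
by rewrite IH impulse_lin Vlin.
Qed.

Lemma transfer_lin c x x' p : transfer p (c *: x + x') = c *: transfer p x + transfer p x'.
Proof. by rewrite /transfer state_lin impulse_lin Olin. Qed.

Lemma V0 i : V i 0 0 = 0.
Proof.
apply: (addrI (V i 0 0)); rewrite addr0.
by have := Vlin i 1 0 0 0 0; rewrite !scale1r !addr0.
Qed.

Lemma VD i g g' x x' : V i (g + g') (x + x') = V i g x + V i g' x'.
Proof. by have := Vlin i 1 g g' x x'; rewrite !scale1r. Qed.

Lemma O0 : O 0 0 = 0.
Proof.
apply: (addrI (O 0 0)); rewrite addr0.
by have := Olin 1 0 0 0 0; rewrite !scale1r !addr0.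
Qed.

Lemma OD g g' x x' : O (g + g') (x + x') = O g x + O g' x'.
Proof. by have := Olin 1 g g' x x'; rewrite !scale1r. Qed.

Lemma V_sum i (T : Type) (r : seq T) (g : T -> G) (x : T -> E) :
  V i (\sum_(t <- r) g t) (\sum_(t <- r) x t) = \sum_(t <- r) V i (g t) (x t).
Proof. by elim: r => [|t r IH]; rewrite ?big_nil ?V0// !big_cons VD IH. Qed.

Lemma O_sum (T : Type) (r : seq T) (g : T -> G) (x : T -> E) :
  O (\sum_(t <- r) g t) (\sum_(t <- r) x t) = \sum_(t <- r) O (g t) (x t).
Proof. by elim: r => [|t r IH]; rewrite ?big_nil ?O0// !big_cons OD IH. Qed.

Definition response f p : G := \sum_(km <- splits p) state km.1 (f km.2).

Lemma sum_impulse f p : \sum_(km <- splits p) impulse (f km.2) km.1 = f p.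
Proof.
rewrite (sum_splits0l (F := fun k m => impulse (f m) k)) /impulse ?eqxx//.
by move=> k m /negPf ->.
Qed.

(** By linearity the convolved states obey the same recursion, in which the impulses recombine into
    the input [f]. *)
Lemma responseE f p : response f p =
  \sum_(i | (0 < p i)%N) V i (response f (mpred i p)) (f (mpred i p)).
Proof.
rewrite /response; under eq_bigr do rewrite stateE.
rewrite (sum_splits_mpred (fun i k m => V i (state k (f m)) (impulse (f m) k))).
by apply: eq_bigr => i _; rewrite -V_sum sum_impulse.
Qed.

Lemma output_response f p :
  \sum_(km <- splits p) transfer km.1 (f km.2) = O (response f p) (f p).
Proof. by rewrite -O_sum sum_impulse. Qed.

(** Output in degrees below [N] plus the state energy stored in degree [N] never exceeds the input.
    Passing to degree [N.+1] costs nothing: weighted Cauchy-Schwarz with weights [rho1 (mpred i p)]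
    has total [rho1 p], and [contr] absorbs the rest. *)
Lemma energy f N :
  \sum_(d < N) \sum_(p <- lvl d) nrm (O (response f p) (f p)) ^+ 2 / rho1 R p +
    \sum_(p <- lvl N) nrm (response f p) ^+ 2 / rho1 R p <=
  \sum_(d < N) \sum_(p <- lvl d) nrm (f p) ^+ 2 / rho1 R p.
Proof.
elim: N => [|N IH].
  rewrite !big_ord0 add0r big_seq big1// => p; rewrite mem_lvl mdeg_eq0 => /eqP ->.
  rewrite responseE big_pred0 ?nrm0 ?expr0n ?mul0r// => i.
  by rewrite ffunE.
rewrite !big_ord_recr/= -addrA.
have step : \sum_(p <- lvl N.+1) nrm (response f p) ^+ 2 / rho1 R p <=
    \sum_(p <- lvl N) \sum_i nrm (V i (response f p) (f p)) ^+ 2 / rho1 R p.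
  rewrite -(sum_lvl_succ (fun i p => nrm (V i (response f p) (f p)) ^+ 2 / rho1 R p)).
  rewrite big_seq [leRHS]big_seq; apply: ler_sum => p.
  rewrite mem_lvl => /eqP pd; rewrite responseE ler_pdivrMr ?rho1_gt0// mulrC.
  have p0 : p != midx0 by rewrite -mdeg_eq0 pd.
  by rewrite -(rho1_sum p0); apply: nrm_sum_sqr_le => i _; exact: rho1_gt0.
apply: le_trans (lerD (lexx _) (lerD (lexx _) step)) _.
rewrite -big_split/=.
apply: (@le_trans _ _ (\sum_(d < N) \sum_(p <- lvl d)
    nrm (O (response f p) (f p)) ^+ 2 / rho1 R p +
  \sum_(p <- lvl N) (nrm (response f p) ^+ 2 / rho1 R p + nrm (f p) ^+ 2 / rho1 R p))).
  rewrite lerD2l; apply: ler_sum => p _; rewrite -mulr_suml -!mulrDl.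
  by rewrite ler_wpM2r ?invr_ge0 ?(ltW (rho1_gt0 _))// addrC.
by rewrite big_split/= addrA lerD2r.
Qed.

Lemma transfer_wsum f :
  (\esum_(p in [set: mi]) (nrm (\sum_(km <- splits p) transfer km.1 (f km.2)) ^+ 2
      / rho1 R p)%:E <=
   \esum_(p in [set: mi]) (nrm (f p) ^+ 2 / rho1 R p)%:E)%E.
Proof.
have ge0 (T : normedModType R[i]) (g : mi -> T) p : 0 <= nrm (g p) ^+ 2 / rho1 R p.
  by rewrite divr_ge0 ?sqr_ge0// ltW// rho1_gt0.
apply: esum_lvls_le => [p|N]; first exact: (ge0 _ (fun p => \sum_(km <- splits p) _)).
apply: le_trans (lvls_le_esum _ N); rewrite lee_fin.
under eq_bigr do under eq_bigr do rewrite output_response.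
by apply: le_trans (energy f N); rewrite lerDl sumr_ge0.
Qed.

(** The constant input [x] has output coefficients [transfer p x]; one term of the output sum is
    kept. *)
Lemma transfer_bound p x : nrm (transfer p x) <= Num.sqrt (rho1 R p) * nrm x.
Proof.
have rho0 (q : mi) : 0 < rho1 R q by exact: rho1_gt0.
rewrite -ler_sqr ?nnegrE ?mulr_ge0 ?sqrtr_ge0 ?nrm_ge0//.
rewrite exprMn (sqr_sqrtr (ltW (rho0 p))) mulrC -ler_pdivrMr// -lee_fin.
have h := transfer_wsum (impulse x).
have <- : \esum_(q in [set: mi]) (nrm (impulse x q) ^+ 2 / rho1 R q)%:E =
    (nrm x ^+ 2)%:E.
  apply: cvg_esum => [q|]; first by rewrite divr_ge0 ?sqr_ge0 ?ltW.
  have := @psum_finite mi R (fun q => nrm (impulse x q) ^+ 2 / rho1 R q) [fset midx0]%fset.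
  rewrite big_seq_fset1 /impulse eqxx rho1_0 divr1; apply => q; rewrite inE => /negPf ->.
  by rewrite nrm0 expr0n mul0r.
apply: le_trans h.
have e : \sum_(km <- splits p) transfer km.1 (impulse x km.2) = transfer p x.
  rewrite (sum_splits0r (F := fun k m => transfer k (impulse x m))) /impulse ?eqxx//.
  move=> k m /negPf ->; apply: (addrI (transfer k 0)); rewrite addr0.
  by have := transfer_lin 1 0 0 k; rewrite !scale1r !addr0.
rewrite -{1}e.
have := fset_le_esum (fun q => nrm (\sum_(km <- splits q) transfer km.1 (impulse x km.2)) ^+ 2 / rho1 R q) [fset p]%fset.
by rewrite big_seq_fset1.
Qed.

Lemma transfer_op_ex p : exists T : bounded_op E K, T =1 transfer p.
Proof.
apply: bounded_op_ex (transfer_bound p) => c x y; exact: transfer_lin.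
Qed.

End transfer_function.

(* The coefficient form of [Psi * Theta' = Theta]; [q k g e] stands for the inner
   product of [e] with the coefficient of index [k] of the function represented by
   the state [g]. *)
Lemma transfer_identity (R : realType) (n : nat) (G E K F : normedModType R[i])
    (V : 'I_n -> G -> E -> G) (O : G -> E -> K)
    (q : multi_index n -> G -> F -> R) (A : multi_index n -> bounded_op E F)
    (P : multi_index n -> bounded_op K F) :
  hilbertian F ->
  (forall k g g' e, q k (g + g') e = q k g e + q k g' e) ->
  (forall (p : multi_index n) g x e, \sum_(i | (0 < p i)%N) q (mpred i p) (V i g x) e +
     rdot (P p (O g x)) e = q p g e + rdot (A p x) e) ->
  forall p x, \sum_(km <- splits p) P km.1 (transfer (V := V) (O := O) km.2 x) = A p x.
Proof.
move=> hF qD id p x; apply: (rdot_inj hF) => e.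
have q0 k : q k 0 e = 0.
  by apply: (addrI (q k 0 e)); rewrite -qD !addr0.
have q_sum k (r : seq 'I_n) (Q : pred 'I_n) (g : 'I_n -> G) :
    q k (\sum_(i <- r | Q i) g i) e = \sum_(i <- r | Q i) q k (g i) e.
  by apply: (big_morph (fun g => q k g e)) => [g1 g2|]; [exact: qD|exact: q0].
pose s m := state (V := V) m x; pose f := impulse (n := n) x.
(* Sum the colligation identity over [k + m = p]. Taking a unit off [k] on the left or off [m] on
   the right yields the same sum, so the state terms cancel. *)
have key : \sum_(km <- splits p)
    (\sum_(i | (0 < km.1 i)%N) q (mpred i km.1) (V i (s km.2) (f km.2)) e +
       rdot (P km.1 (transfer (V := V) (O := O) km.2 x)) e) =
  \sum_(km <- splits p) (q km.1 (s km.2) e + rdot (A km.1 (f km.2)) e).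
  by apply: eq_bigr => km _; exact: id.
move: key; rewrite !big_split/=.
have -> : \sum_(km <- splits p) q km.1 (s km.2) e = \sum_(km <- splits p)
    \sum_(i | (0 < km.2 i)%N) q km.1 (V i (s (mpred i km.2)) (f (mpred i km.2))) e.
  by apply: eq_bigr => km _; rewrite /s stateE q_sum.
rewrite (sum_splits_mpred (fun i k m => q k (V i (s m) (f m)) e)).
rewrite (sum_splits_mpredr (fun i k m => q k (V i (s m) (f m)) e)) => /addrI.
rewrite -!rdot_suml// => ->; congr (rdot _ e).
rewrite (sum_splits0r (F := fun k m => A k (f m))) /f /impulse ?eqxx//.
by move=> k m /negPf ->; exact: op0.
Qed.

(** * The factorization *)

(** All that matters about [K] is the vectors [u p y], which represent the coefficient functionals
    of index [p]: [bs] lowers the index, while [ds] and [C] read off the coefficients of [Psi] and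
    [Theta]. *)
Lemma lurking_isometry_factor (R : realType) (n : nat)
    (K G E : completeNormedModType R[i]) (F : normedModType R[i])
    (bs : 'I_n -> bounded_op K K) (ds : bounded_op K K) (J e : bounded_op K G)
    (C : bounded_op K E) (u : multi_index n -> F -> K)
    (A : multi_index n -> bounded_op E F) (P : multi_index n -> bounded_op K F) :
  hilbertian K -> hilbertian G -> hilbertian E -> hilbertian F ->
  (forall h, nrm (e h) = nrm h) ->
  (forall h, \sum_i nrm (J (bs i h)) ^+ 2 + nrm (ds h) ^+ 2 =
     nrm (J h) ^+ 2 + nrm (C h) ^+ 2) ->
  (forall i p y, bs i (u p y) = if (0 < p i)%N then u (mpred i p) y else 0) ->
  (forall p k y, rdot (P p k) y = rdot k (ds (u p y))) ->
  (forall p x y, rdot x (C (u p y)) = rdot (A p x) y) ->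
  exists T : multi_index n -> bounded_op E K,
    [/\ (forall p, nrm (T p) <= Num.sqrt (rho1 R p)),
        (forall f, (\esum_(p in [set: multi_index n])
           (nrm (mconv T f p) ^+ 2 / rho1 R p)%:E <=
           \esum_(p in [set: multi_index n]) (nrm (f p) ^+ 2 / rho1 R p)%:E)%E) &
        forall p x, mconv P (fun m => T m x) p = A p x].
Proof.
move=> hK hG hE hF e_iso lurking bs_u P_u C_u.
have [V [Z [Vlin Zlin contr id]]] := colligation_ex hK hG hE e_iso lurking.
have ex p := transfer_op_ex Vlin Zlin contr p.
pose T p := projT1 (cid (ex p)).
have TE p : T p =1 transfer (V := V) (O := Z) p by rewrite /T; case: cid.
exists T; split.
- move=> p; apply: nrm_op_le => [|x]; first exact: sqrtr_ge0.
  by rewrite TE; exact: transfer_bound.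
- move=> f; have := transfer_wsum Vlin Zlin contr f.
  congr (_ <= _)%E; apply: eq_esum => p _; congr (nrm _ ^+ 2 / _)%:E.
  by apply: eq_bigr => km _; rewrite TE.
- move=> p x; rewrite /mconv; under eq_bigr do rewrite TE.
  apply: (transfer_identity (q := fun k g y => rdot g (J (u k y)))) => //.
    by move=> k g g' y; rewrite rdotDl.
  move=> p' g x' y; rewrite P_u -C_u -id; congr (_ + _).
  rewrite big_mkcond; apply: eq_bigr => i _; rewrite bs_u.
  by case: ifP => // _; rewrite op0 rdot0r.
Qed.

Section multiplication_operator.
Context {R : realType} {n : nat} {E F : completeNormedModType R[i]}.
Context (hE : hilbertian E) (hF : hilbertian F).
Local Notation mi := (multi_index n).
Local Notation H := (l2 mi E).
Local Notation K := (l2 mi F).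
Context {b : nat -> R}.
Context (b_gt0 : forall j, 0 < b j) (b_dec : forall j, b j.+1 <= b j).
Context {A : mi -> bounded_op E F}.
Context (A_contr : forall a, (wsum (@DA_weight R) a < +oo)%E ->
  (wsum b (mconv A a) <= wsum (@DA_weight R) a)%E).

Definition wroot p : R := Num.sqrt (wscale (n := n) (b := b) p).

Lemma wroot_gt0 p : 0 < wroot p.
Proof. by rewrite sqrtr_gt0 wscale_gt0. Qed.

Definition rho_root (p : mi) : R := Num.sqrt (rho1 R p).

Lemma mconv_lin c (a a' : mi -> E) p :
  mconv A (fun m => c *: a m + a' m) p = c *: mconv A a p + mconv A a' p.
Proof.
rewrite /mconv scaler_sumr -big_split; apply: eq_bigr => km _.
by rewrite opD opZ.
Qed.

(* Multiplication by [Theta], written in the orthogonal coordinates that identify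
   both weighted spaces with [l2]. *)
Lemma mult_op_ex : exists X : bounded_op H K,
  (forall a p, X a p = (wroot p)%:C *: mconv A (fun m => (rho_root m)%:C *: a m) p) /\
  forall a, nrm (X a) <= nrm a.
Proof.
pose r a := fun m => (rho_root m)%:C *: (a : H) m.
have wr a : wsum (@DA_weight R) (r a) = (nrm a ^+ 2)%:E.
  rewrite -l2_nrmE; apply: eq_esum => m _.
  rewrite /r nrm_real ger0_norm ?sqrtr_ge0// exprMn sqr_sqrtr ?(ltW (rho1_gt0 _))//.
  by rewrite /DA_weight mulrA mul1r mulVf ?mul1r// gt_eqF ?rho1_gt0.
have ex a : exists2 g : K, (forall p, g p = (wroot p)%:C *: mconv A (r a) p) &
    nrm g ^+ 2 <= nrm a ^+ 2.
  apply: l2_ex; rewrite -wr; apply: le_trans (A_contr _); last by rewrite wr ltry.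
  apply: le_esum => p _; rewrite lee_fin nrm_real exprMn.
  by rewrite ger0_norm ?sqrtr_ge0// sqr_sqrtr ?(ltW (wscale_gt0 b_gt0 _)).
pose X a := projT1 (cid2 (ex a)).
have XE a p : X a p = (wroot p)%:C *: mconv A (r a) p by rewrite /X; case: cid2.
have X1 a : nrm (X a) <= nrm a.
  by rewrite -ler_sqr ?nnegrE ?nrm_ge0// /X; case: cid2.
have Xlin : linear X.
  move=> c a a'; apply: l2P_ext => p; rewrite l2DE l2ZE !XE.
  have -> : r (c *: a + a') = fun m => c *: r a m + r a' m.
    by apply/funext => m; rewrite /r l2DE l2ZE scalerDr !scalerA mulrC.
  by rewrite mconv_lin scalerDr !scalerA mulrC.
have X1' a : nrm (X a) <= 1 * nrm a by rewrite mul1r.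
have [Y hY] := bounded_op_ex Xlin X1'.
by exists Y; split=> [a p|a]; rewrite hY ?XE.
Qed.

(** Multiplication by [Theta] commutes with multiplication by [z_i]; the square roots only change
    coordinates. *)
Lemma mult_op_fshift (X : bounded_op H K) (T : bounded_op K K) (S : bounded_op H H) i :
  (forall a p, X a p = (wroot p)%:C *: mconv A (fun m => (rho_root m)%:C *: a m) p) ->
  (forall h p, T h p = if (0 < p i)%N
    then (Num.sqrt (wscale (b := b) p / wscale (b := b) (mpred i p)))%:C
      *: h (mpred i p) else 0) ->
  (forall h p, S h p = if (0 < p i)%N
    then (Num.sqrt (wscale (b := @DA_weight R) p / wscale (b := @DA_weight R) (mpred i p)))%:C
      *: h (mpred i p) else 0) ->
  forall a, X (S a) = T (X a).
Proof.
move=> XE TE SE a; apply: l2P_ext => p; rewrite TE !XE.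
pose f k m := A k ((rho_root m)%:C *: a m).
have rho0 (m : mi) : 0 < rho1 R m by exact: rho1_gt0.
(* The single shift is spread over all [j] with an indicator, the shape in which [sum_splits_mpredr]
   moves the unit from [m] to [p]. *)
have -> : mconv A (fun m => (rho_root m)%:C *: S a m) p = \sum_(km <- splits p)
    \sum_(j | (0 < km.2 j)%N) (if j == i then f km.1 (mpred j km.2) else 0).
  apply: eq_bigr => -[k m] _ /=; rewrite SE; case: ifPn => mi0; last first.
    rewrite scaler0 op0 big1// => j mj; case: eqP => // ji.
    by rewrite -ji mj in mi0.
  rewrite (bigD1 i)//= eqxx big1 ?addr0 => [|j /andP[_ /negPf ->]//].
  rewrite /f scalerA -rmorphM /= /rho_root -sqrtrM ?(ltW (rho0 _))//.
  congr (A k ((Num.sqrt _)%:C *: _)).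
  by rewrite /wscale /DA_weight; field; rewrite !gt_eqF.
rewrite (sum_splits_mpredr (fun j k m => if j == i then f k m else 0)).
case: ifPn => pi; last first.
  rewrite big1 ?scaler0// => j pj; apply: big1 => km _; case: eqP => // ji.
  by rewrite -ji pj in pi.
rewrite (bigD1 i)//= eqxx [X in _ + X]big1 ?addr0 => [|j /andP[_ /negPf ->]]; last first.
  by rewrite big1.
have w0 q := wscale_gt0 b_gt0 (n := n) q.
rewrite scalerA -rmorphM /= /wroot -sqrtrM; last by apply: divr_ge0; exact: ltW (w0 _).
by rewrite divfK// gt_eqF.
Qed.

End multiplication_operator.

Lemma wsum_DA (R : realType) n (E : normedModType R[i]) (a : multi_index n -> E) :
  wsum (@DA_weight R) a =
  \esum_(p in [set: multi_index n]) (nrm (a p) ^+ 2 / rho1 R p)%:E.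
Proof. by apply: eq_esum => p _; rewrite /DA_weight mul1r mulrC. Qed.

Section factorization.
Context {R : realType} {n : nat} {E F : completeNormedModType R[i]} {beta : nat -> R}.
Context (hE : hilbertian E) (hF : hilbertian F) (hbeta : weight_sequence beta).
Local Notation mi := (multi_index n).
Local Notation H := (l2 mi E).
Local Notation K := (l2 mi F).
Local Notation G := (l2 nat K).

Let b_gt0 := weight_gt0 hbeta.

Let b_dec j : beta j.+1 <= beta j.
Proof. exact: ltW (weight_decreasing hbeta j). Qed.

Let hH : hilbertian H := l2_hilbertian hE.
Let hK : hilbertian K := l2_hilbertian hF.
Let hG : hilbertian G := l2_hilbertian hK.

(** For [j > 0], [beta_j / gamma_j = 1 - beta_j / beta_(j-1)]: the defect of the shifts on [H(beta)]
    is exactly what [gamma] measures. *)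
Lemma psi_c_wroot (p : mi) :
  psi_c (R := R) (beta := beta) p * wroot (b := beta) p = Num.sqrt (wdefect (b := beta) (mdeg p)).
Proof.
have rho0 : 0 < rho1 R p by exact: rho1_gt0.
have g0 := weight_gamma_gt0 hbeta (mdeg p).
rewrite /psi_c /wroot -sqrtrM; last by rewrite divr_ge0// ltW.
congr Num.sqrt; transitivity (beta (mdeg p) * (weight_gamma beta (mdeg p))^-1).
  by rewrite /wscale; field; rewrite !gt_eqF.
rewrite weight_gammaV; case: (mdeg p) => [|j]; first by rewrite (weight0 hbeta) mulr1.
by rewrite /wdefect; field; rewrite !gt_eqF.
Qed.

Lemma coefficient_factor (A : mi -> bounded_op E F) :
  (forall a, (wsum (@DA_weight R) a < +oo)%E ->
     (wsum beta (mconv A a) <= wsum (@DA_weight R) a)%E) ->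
  exists T : mi -> bounded_op E K,
    [/\ (forall p, nrm (T p) <= Num.sqrt (rho1 R p)),
        (forall f, (\esum_(p in [set: mi]) (nrm (mconv T f p) ^+ 2 / rho1 R p)%:E <=
           \esum_(p in [set: mi]) (nrm (f p) ^+ 2 / rho1 R p)%:E)%E) &
        forall p x, mconv (psi_coef hbeta) (fun m => T m x) p = A p x].
Proof.
move=> A_contr.
have [X [XE X1]] := mult_op_ex b_gt0 A_contr.
have [Xs [adj Xs1']] := adjoint_ex X hH hK.
have X1' : nrm X <= 1 by apply: nrm_op_le => // a; rewrite mul1r.
have Xs1 h : nrm (Xs h) <= nrm h.
  by apply: le_trans (Xs1' h) _; rewrite ler_piMl ?nrm_ge0.
have [J JN] := defect_ex hH hK adj Xs1 X1.
pose bs i := bshift b_gt0 b_dec i : bounded_op K K.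
pose ds := dshift b_gt0 b_dec : bounded_op K K.
have inter i h : Xs (bs i h) = bshift (@DA_gt0 R) (@DA_dec R) i (Xs h).
  have [T [Tadj TE]] := fshift_ex b_gt0 b_dec i hF.
  have [S [Sadj SE]] := fshift_ex (@DA_gt0 R) (@DA_dec R) i hE.
  apply: (rdot_inj hH) => a; rewrite adj rdotC -Tadj.
  by rewrite -(mult_op_fshift b_gt0 XE TE SE) rdotC -adj rdotC Sadj rdotC.
have Clin : linear (fun h : K => Xs h midx0).
  by move=> c u v; rewrite opD opZ l2DE l2ZE.
have C1 h : nrm (Xs h midx0) <= 1 * nrm h.
  by rewrite mul1r; apply: le_trans (nrm_l2_le _ _) (Xs1 h).
have [C hC] := bounded_op_ex Clin C1.
have lurking h : \sum_i nrm (J (bs i h)) ^+ 2 + nrm (ds h) ^+ 2 =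
    nrm (J h) ^+ 2 + nrm (C h) ^+ 2.
  rewrite hC; under eq_bigr do rewrite JN inter.
  rewrite sumrB JN -(shift_identity b_gt0 b_dec h).
  by rewrite -(shift_identity (@DA_gt0 R) (@DA_dec R) (Xs h)) nrm_dshift_DA; ring.
have [e he] : exists e : bounded_op K G, forall h, e h = single 0%N h.
  apply: (bounded_op_ex (M := 1)) => [c u v|h]; first exact: single_lin.
  by rewrite mul1r nrm_single.
have e_iso h : nrm (e h) = nrm h by rewrite he nrm_single.
(* Coordinate [p] is [wroot p] times the Taylor coefficient; dividing by [wroot p] makes [u p y]
   pair with a function to its coefficient of index [p], tested on [y]. *)
pose u p y : K := (wroot (b := beta) p)^-1%:C *: single p y.
have w0 (p : mi) : 0 < wroot (b := beta) p by exact: wroot_gt0.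
apply: (lurking_isometry_factor hK hG hE hF e_iso lurking (u := u)).
- move=> i p y; rewrite /bs /u opZ bshift_single; case: ifP => pi; last first.
    by rewrite scaler0.
  have ws0 q := wscale_gt0 b_gt0 (n := n) q.
  rewrite scalerA -rmorphM /=; congr (_%:C *: _).
  have -> : Num.sqrt (wscale (b := beta) p / wscale (b := beta) (mpred i p)) =
      wroot (b := beta) p / wroot (b := beta) (mpred i p).
    by rewrite sqrtrM ?(ltW (ws0 _))// sqrtrV ?(ltW (ws0 _)).
  by rewrite mulrA mulVf ?mul1r// gt_eqF.
- move=> p k y; rewrite psi_coefE /ds /u opZ dshift_single (rdotZl hF).
  rewrite !(rdotZr hK) rdot_single mulrA; congr (_ * _).
  by rewrite -psi_c_wroot mulrCA mulVf ?mulr1// gt_eqF.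
- move=> p x y; rewrite hC /u opZ l2ZE (rdotZr hE) rdotC -rdot_single.
  rewrite adj rdotC rdot_single XE (rdotZl hF) mulrA mulVf ?gt_eqF// mul1r.
  congr (rdot _ y); rewrite /mconv.
  rewrite (sum_splits0r (F := fun k m => A k ((rho_root m)%:C *: single midx0 x m))).
    by rewrite singleE eqxx /rho_root rho1_0 sqrtr1 scale1r.
  by move=> k m /negPf m0; rewrite singleE m0 scaler0 op0.
Qed.

Lemma factor_of_multiplier (Theta : 'rV[R[i]]_n -> bounded_op E F) :
  contractive_multiplier beta Theta ->
  exists Theta' : 'rV[R[i]]_n -> bounded_op E K,
    contractive_multiplier (@DA_weight R) Theta' /\
    forall z, unit_ball z -> forall x : E, Theta z x = Psi beta z (Theta' z x).
Proof.
move=> mT; have [A TA] := mT.1.1.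
have A_contr := (contractive_multiplierP b_gt0 TA).1 mT.
have [T [Tb Tc TI]] := coefficient_factor A_contr.
have Tsub : subexponential T.
  move=> r /andP[r0 r1]; exists 1 => k; rewrite mul1r.
  apply: le_trans (Tb k); rewrite ler_piMr ?nrm_ge0//.
  by rewrite exprn_ile1 ?ltW.
have [Phi T'] := abs_has_power_series_op (subexponential_abs Tsub).
exists Phi; split.
  apply/(contractive_multiplierP (@DA_gt0 R) T') => a _.
  by rewrite !wsum_DA; exact: Tc.
move=> z zb x.
have [P [hP PsiP]] := @Psi_series R n F beta hbeta.
rewrite (PsiP z zb).
have h1 := has_power_series_app (x := x) TA zb.
have h2 := has_power_series_mul hP (has_power_series_app (x := x) T') zb.
apply: psum_unique h1 _.
suff -> : (fun p => monomial z p *: A p x) = fun p =>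
    monomial z p *: mconv (psi_coef hbeta) (fun m => T m x) p by exact: h2.
by apply/funext => p; rewrite TI.
Qed.

End factorization.

Theorem theorem4p2 (R : realType) (n : nat) (hn : (0 < n)%N)
    (E Estar : completeNormedModType R[i])
    (hE : separable_hilbert E) (hEstar : separable_hilbert Estar)
    (beta : nat -> R) (hbeta : weight_sequence beta)
    (Theta : 'rV[R[i]]_n -> bounded_op E Estar) (hTheta : analytic Theta) :
  contractive_multiplier beta Theta <->
  exists Theta' : 'rV[R[i]]_n -> bounded_op E (l2 (multi_index n) Estar),
    contractive_multiplier (@DA_weight R) Theta' /\
    forall z, unit_ball z -> forall x : E, Theta z x = Psi beta z (Theta' z x).
Proof.
split.
  exact: factor_of_multiplier (separable_hilbert_hilbertian hE)
    (separable_hilbert_hilbertian hEstar) hbeta _.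
by case=> Theta' [mT' TPsi]; exact: multiplier_of_factor mT' TPsi.
Qed.
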